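(* Let $K$ be an algebraically closed field of characteristic zero, let $X$ be a smooth irreducible affine algebraic curve over $K$, let $\mathcal D(X)$ be the ring of differential operators on $X$, and let $\Gamma(X)$ be its quotient division ring. Then $\mathcal D(X)$, and any noncommutative subalgebra $A$ of the division ring $\Gamma(X)$ with Gelfand-Kirillov dimension $\operatorname{GK}(A)<3$, admits the Dixmier partition and satisfies both the homogeneous centralizer condition and the commutative centralizer condition.
   Context: The coordinate algebra $\mathcal O=\mathcal O(X)$ is a finitely generated regular domain of Krull dimension $1$. $\mathcal D(X)=\mathcal D(\mathcal O)=\bigcup_{i\ge0}\mathcal D(\mathcal O)_i\subseteq\operatorname{End}_K(\mathcal O)$, where $\mathcal D(\mathcal O)_0=\{u\in\operatorname{End}_K(\mathcal O):ur-ru=0\text{ for all }r\in\mathcal O\}\simeq\mathcal O$ and $\mathcal D(\mathcal O)_i=\{u\in\operatorname{End}_K(\mathcal O):ur-ru\in\mathcal D(\mathcal O)_{i-1}\text{ for all }r\in\mathcal O\}$. $\mathcal D(X)$ is a Noetherian domain, and $\Gamma(X)$ is its division ring of fractions. For a $K$-algebra $A$ with centre $Z(A)$ and $a\in A$, let $\operatorname{ad} a: b\mapsto[a,b]=ab-ba$, and (with $K$ algebraically closed) put $C(a)=\ker(\operatorname{ad} a)$ (the centralizer of $a$ in $A$); $N(a)=\bigcup_{i\ge0}\ker\big((\operatorname{ad} a)^{i+1}\big)$; $D(a)=\bigoplus_{\lambda\in K}\{b\in A:[a,b]=\lambda b\}$; $F(a)=\{b\in A:\dim_K K[\operatorname{ad}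 a]\,b<\infty\}$. Types of elements $a\in A\setminus Z(A)$: $a\in\Delta_1(A)$ (strongly nilpotent) if $N(a)=A$ and $D(a)=C(a)$; $a\in\Delta_2(A)$ (weakly nilpotent) if $C(a)\ne N(a)\ne A$ and $D(a)=C(a)$; $a\in\Delta_3(A)$ (strongly semi-simple) if $N(a)=C(a)$ and $D(a)=A$; $a\in\Delta_4(A)$ (weakly semi-simple) if $N(a)=C(a)$ and $C(a)\ne D(a)=F(a)\ne A$; $a\in\Delta_5(A)$ (generic) if $N(a)=D(a)=C(a)$. $A$ admits the Dixmier partition if $A\setminus Z(A)=\Delta_1(A)\cup\cdots\cup\Delta_5(A)$. A noncommutative algebra satisfies the commutative centralizer condition if the centralizer of each of its non-central elements is a commutative algebra. A noncommutative algebra $A$ that admits the Dixmier partition satisfies the homogeneous centralizer condition if, for each $a\in A\setminus Z(A)$, the elements of $C(a)\setminus Z(A)$ are of exactly one of the following kinds: (1) all strongly nilpotent; (2) all weakly nilpotent; (3) all generic except for a subset $K^*a'+Z(A)$ of strongly semi-simple elements, for some $a'\in\Delta_3(A)$; (4) all generic except for a subset $K^*a'+Z(A)$ of weakly semi-simple elements, for some $a'\in\Delta_4(A)$; (5) all generic. Here $K^*=K\setminus\{0\}$. *)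

(* Defs.v *)
From HB Require Import structures.
From mathcomp Require Import all_boot all_order all_algebra.
From mathcomp Require Import all_classical all_reals all_analysis.

Set Implicit Arguments.
Unset Strict Implicit.
Unset Printing Implicit Defensive.

Import GRing.Theory.

Local Open Scope classical_set_scope.
Local Open Scope ring_scope.

Local Notation "x %:F" := (@tofrac _ x).

#[short(type="idomainAlgType")]
HB.structure Definition IdomainAlgebra (K : pzRingType) :=
  {O of GRing.IntegralDomain O & GRing.ComUnitAlgebra K O}.

Definition generated_by (R : comNzRingType) (I : {pred R}) n
    (g : 'I_n -> R) : Prop :=
  forall x, x \in I <-> exists c : 'I_n -> R, x = \sum_i c i * g i.

(* An [idealr] is proper; the unit ideal is generated by 1 anyway. *)
Definition noetherian (R : comNzRingType) : Prop :=
  forall I : idealr R, exists n (g : 'I_n -> R), generated_by I g.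

Definition prime_chain (R : comNzRingType) (n : nat) : Prop :=
  exists p : 'I_n.+1 -> prime_idealr R, forall i j : 'I_n.+1, (i < j)%N ->
    {subset p i <= p j} /\ ~ {subset p j <= p i}.

Definition krull_dim (R : comNzRingType) (n : nat) : Prop :=
  prime_chain R n /\ ~ prime_chain R n.+1.

Definition maximal_ideal (R : comNzRingType) (m : idealr R) : Prop :=
  forall I : idealr R, {subset m <= I} -> {subset I <= m}.

Definition regular_local (R : comNzRingType) : Prop :=
  noetherian R /\
  exists m : idealr R,
    [/\ maximal_ideal m,
        forall m' : idealr R, maximal_ideal m' -> m' =i m &
        exists d (g : 'I_d -> R), krull_dim R d /\ generated_by m g].

Section Localization.
Variables (R : idomainType) (p : prime_idealr R).

Definition localization_pred : {pred {fraction R}} :=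
  fun x => `[< exists a s : R, s \notin p /\ x = a%:F / s%:F >].

Lemma notin_prime_mul (s t : R) : s \notin p -> t \notin p -> s * t \notin p.
Proof.
move=> sp tp; apply/negP => /(@prime_idealr_closed_subproof _ p).
by rewrite (negbTE sp) (negbTE tp).
Qed.

Lemma notin_prime_neq0 (s : R) : s \notin p -> s%:F != 0.
Proof.
by move=> sp; rewrite tofrac_eq0; apply: contraNneq sp => ->; exact: rpred0.
Qed.

Lemma localization_subring : subring_closed localization_pred.
Proof.
have p1 : 1 \notin p by case: (@proper_ideal_subproof _ p).
split.
- by apply/asboolP; exists 1, 1; rewrite divr1.
- move=> _ _ /asboolP[a [s [sp ->]]] /asboolP[b [t [tp ->]]].
  apply/asboolP; exists (a * t - b * s), (s * t).
  split; first exact: notin_prime_mul.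
  rewrite -mulNr addf_div ?notin_prime_neq0//.
  by rewrite tofracB !tofracM mulNr.
- move=> _ _ /asboolP[a [s [sp ->]]] /asboolP[b [t [tp ->]]].
  apply/asboolP; exists (a * b), (s * t).
  split; first exact: notin_prime_mul.
  by rewrite !tofracM mulf_div.
Qed.

HB.instance Definition _ :=
  GRing.isSubringClosed.Build {fraction R} localization_pred
    localization_subring.

(* The localization R_p, realised inside the fraction field of R. *)
Definition localization : predArgType :=
  {x : {fraction R} | x \in localization_pred}.

HB.instance Definition _ := SubChoice.on localization.
HB.instance Definition _ :=
  [SubChoice_isSubComNzRing of localization by <:].

End Localization.

Definition regular_ring (R : idomainType) : Prop :=
  noetherian R /\ forall p : prime_idealr R, regular_local (localization p).

Section Subalgebra.
Variables (K : nzRingType) (B : algType K) (S : subalgClosed B).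

Definition subalg : predArgType := {x : B | x \in S}.

HB.instance Definition _ := SubChoice.on subalg.
HB.instance Definition _ := [SubChoice_isSubAlgebra of subalg by <:].

End Subalgebra.

Definition finitely_generated (K : nzRingType) (B : algType K) : Prop :=
  exists n (g : 'I_n -> B), forall S : subalgClosed B,
    (forall i, g i \in S) -> forall x, x \in S.

Section Dimension.
Variables (K : fieldType) (M : lmodType K).

Definition lspan (V : set M) : set M :=
  [set x | exists n (c : 'I_n -> K) (v : 'I_n -> M),
     (forall i, V (v i)) /\ x = \sum_i c i *: v i].

Definition has_dim (V : set M) (n : nat) : Prop :=
  exists v : 'I_n -> M,
    V = lspan (range v) /\
    forall c : 'I_n -> K, \sum_i c i *: v i = 0 -> forall i, c i = 0.

(* V is a linear subspace of finite dimension. *)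
Definition finite_dim (V : set M) : Prop := exists n, has_dim V n.

(* Junk value 0 when V is not a finite-dimensional subspace. *)
Definition dimv_nat (V : set M) : nat := xget 0%N (has_dim V).

End Dimension.

Section Endomorphisms.
Variables (K : fieldType) (O : algType K).

Definition linear_pred : {pred O -> O} := fun f => `[< linear f >].

Lemma linear_predP f : reflect (linear f) (f \in linear_pred).
Proof. exact: asboolP. Qed.

Lemma linear_submod : submod_closed linear_pred.
Proof.
split; first by apply/linear_predP => k x y /=; rewrite scaler0 addr0.
move=> k f g /linear_predP fl /linear_predP gl; apply/linear_predP => l x y.
have E z : (k *: f + g) z = k *: f z + g z by [].
by rewrite !E fl gl !scalerDr !scalerA addrACA (mulrC k l).
Qed.

HB.instance Definition _ :=
  GRing.isSubmodClosed.Build K (O -> O) linear_pred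
    (GRing.submod_closed_semi linear_submod).

Definition endo : predArgType := {f : O -> O | f \in linear_pred}.

HB.instance Definition _ := SubChoice.on endo.
HB.instance Definition _ := [SubChoice_isSubLmodule of endo by <:].

Lemma endoP (u : endo) : linear (val u).
Proof. exact/linear_predP/(valP u). Qed.

Definition mk_endo (f : O -> O) (fl : linear f) : endo :=
  exist _ f (introT (linear_predP f) fl).

Lemma endo_ext (u v : endo) : val u =1 val v -> u = v.
Proof. by move=> uv; apply/val_inj/funext. Qed.

Definition endo_one : endo := mk_endo (fun k x y => erefl (k *: x + y)).

Lemma endo_mul_linear (u v : endo) : linear (val u \o val v).
Proof. by move=> k x y /=; rewrite !endoP. Qed.

Definition endo_mul (u v : endo) : endo := mk_endo (@endo_mul_linear u v).

Lemma endo_mulA : associative endo_mul.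
Proof. by move=> u v w; apply: endo_ext. Qed.

Lemma endo_mul1 : left_id endo_one endo_mul.
Proof. by move=> u; apply: endo_ext. Qed.

Lemma endo_1mul : right_id endo_one endo_mul.
Proof. by move=> u; apply: endo_ext. Qed.

Lemma endo_mulDl : left_distributive endo_mul +%R.
Proof. by move=> u v w; apply: endo_ext. Qed.

Lemma endo_mulDr : right_distributive endo_mul +%R.
Proof.
move=> u v w; apply: endo_ext => x.
by have /= := endoP u 1 (val v x) (val w x); rewrite !scale1r.
Qed.

Lemma endo_one_neq0 : endo_one != 0.
Proof.
apply/eqP => /(congr1 (fun u : endo => val u 1)) /= /eqP.
by rewrite (oner_eq0 O).
Qed.

HB.instance Definition _ := GRing.Zmodule_isNzRing.Build endo
  endo_mulA endo_mul1 endo_1mul endo_mulDl endo_mulDr endo_one_neq0.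

Lemma endo_scaleAl (k : K) (u v : endo) : k *: (u * v) = (k *: u) * v.
Proof. exact: endo_ext. Qed.

HB.instance Definition _ :=
  GRing.Lmodule_isLalgebra.Build K endo endo_scaleAl.

Lemma endo_scaleAr (k : K) (u v : endo) : k *: (u * v) = u * (k *: v).
Proof.
apply: endo_ext => x; have u0 : val u 0 = 0.
  by have := endoP u (-1) 0 0; rewrite scaler0 addr0 scaleN1r addNr.
by have := endoP u k (val v x) 0; rewrite u0 !addr0.
Qed.

HB.instance Definition _ := GRing.Lalgebra_isAlgebra.Build K endo endo_scaleAr.

End Endomorphisms.

Section DifferentialOperators.
Variables (K : fieldType) (O : comAlgType K).
Implicit Types (r : O) (u v : endo O).

Lemma mul_endo_linear r : linear (fun x : O => r * x).
Proof. by move=> k x y; rewrite mulrDr scalerAr. Qed.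

Definition mul_endo r : endo O := mk_endo (@mul_endo_linear r).

Fixpoint diffop_order (i : nat) : set (endo O) :=
  if i is j.+1
  then [set u | forall r, diffop_order j (u * mul_endo r - mul_endo r * u)]
  else [set u | forall r, u * mul_endo r - mul_endo r * u = 0].

Definition diffop_pred : {pred endo O} :=
  fun u => `[< exists i, diffop_order i u >].

Lemma mul_endoC r s : mul_endo r * mul_endo s = mul_endo s * mul_endo r.
Proof. by apply: endo_ext => x /=; rewrite mulrCA. Qed.

Lemma diffop_order0 i : diffop_order i 0.
Proof. by elim: i => [|i IH] r; rewrite mul0r mulr0 subrr. Qed.

Lemma diffop_orderS i u : diffop_order i u -> diffop_order i.+1 u.
Proof.
elim: i u => [|i IH] u ud r; last exact/IH/ud.
by rewrite ud; exact: (diffop_order0 0).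
Qed.

Lemma diffop_order_leq i j u :
  (i <= j)%N -> diffop_order i u -> diffop_order j u.
Proof.
elim: j => [|j IH]; first by rewrite leqn0 => /eqP ->.
rewrite leq_eqVlt => /orP[/eqP <- //|]; rewrite ltnS => ij ud.
exact/diffop_orderS/IH.
Qed.

Lemma diffop_orderP i k u v :
  diffop_order i u -> diffop_order i v -> diffop_order i (k *: u + v).
Proof.
have E r : (k *: u + v) * mul_endo r - mul_endo r * (k *: u + v) =
    k *: (u * mul_endo r - mul_endo r * u) +
    (v * mul_endo r - mul_endo r * v).
  by rewrite mulrDl mulrDr -scalerAl -scalerAr opprD addrACA scalerBr.
elim: i u v E => [|i IH] u v E ud vd r; rewrite E.
  by rewrite ud vd scaler0 addr0.
apply: IH; [|exact: ud|exact: vd] => s.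
by rewrite mulrDl mulrDr -scalerAl -scalerAr opprD addrACA scalerBr.
Qed.

Lemma diffop_orderM i j u v :
  diffop_order i u -> diffop_order j v -> diffop_order (i + j) (u * v).
Proof.
have E (f g h : endo O) :
    f * g * h - h * (f * g) = f * (g * h - h * g) + (f * h - h * f) * g.
  by rewrite mulrBr mulrBl !mulrA addrA subrK.
move: {2}(i + j)%N (leqnn (i + j)) => n; elim: n i j u v => [|n IH] i j u v.
  rewrite leqn0 addn_eq0 => /andP[/eqP -> /eqP ->] ud vd r.
  by rewrite E ud vd mulr0 mul0r addr0.
have addP m x y : diffop_order m x -> diffop_order m y ->
    diffop_order m (x + y).
  by move=> xd yd; rewrite -[x]scale1r; exact: diffop_orderP.
case: i j => [|i] [|j] ijn ud vd.
- by move=> r; rewrite E ud vd mulr0 mul0r addr0.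
- suff H r : diffop_order j (u * v * mul_endo r - mul_endo r * (u * v)).
    by rewrite add0n.
  by rewrite E ud mul0r addr0; exact: (IH 0%N j).
- suff H r : diffop_order i (u * v * mul_endo r - mul_endo r * (u * v)).
    by rewrite addn0.
  rewrite E vd mulr0 add0r.
  by have := IH i 0%N _ v ijn (ud r) vd; rewrite addn0.
- suff H r :
      diffop_order (i.+1 + j) (u * v * mul_endo r - mul_endo r * (u * v)).
    by rewrite addnS.
  rewrite E; apply: addP.
    by apply: (IH i.+1 j) => //; rewrite -ltnS -addnS.
  by rewrite addSnnS; apply: (IH i j.+1).
Qed.

Lemma diffop_subalg : subalg_closed diffop_pred.
Proof.
split.
- apply/asboolP; exists 0%N => r; by rewrite mul1r mulr1 subrr.
- move=> k u v /asboolP[i ud] /asboolP[j vd]; apply/asboolP.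
  exists (maxn i j); apply: diffop_orderP.
    exact: diffop_order_leq (leq_maxl i j) ud.
  exact: diffop_order_leq (leq_maxr i j) vd.
- move=> u v /asboolP[i ud] /asboolP[j vd]; apply/asboolP.
  by exists (i + j)%N; exact: diffop_orderM.
Qed.

HB.instance Definition _ := GRing.isSubalgClosed.Build K (endo O) diffop_pred
  (GRing.subalg_closed_semi diffop_subalg).

Definition diffop := subalg diffop_pred.

End DifferentialOperators.

(* O is the coordinate algebra of a smooth irreducible affine curve. *)
Definition smooth_affine_curve (K : fieldType) (O : idomainAlgType K) : Prop :=
  [/\ finitely_generated O, regular_ring O & krull_dim O 1].

(* D is Noetherian on both sides, so its left and right division rings of
   fractions coincide and are determined up to a unique isomorphism over D. *)
Definition quotient_division_ring (K : fieldType) (D : algType K)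
    (G : unitAlgType K) (iota : {lrmorphism D -> G}) : Prop :=
  [/\ forall x : G, x != 0 -> x \is a GRing.unit,
      injective iota,
      forall x : G, exists a s : D, s != 0 /\ x = iota a * (iota s)^-1 &
      forall x : G, exists a s : D, s != 0 /\ x = (iota s)^-1 * iota a].

Section Dixmier.
Variables (K : fieldType) (A : algType K).
Implicit Types a b z : A.

Definition noncommutative : Prop := ~ commutative (@GRing.mul A).

Definition centre : set A := [set z | forall b, z * b = b * z].

Definition ad a b : A := a * b - b * a.

Definition C_ a : set A := [set b | ad a b = 0].

Definition N_ a : set A := [set b | exists i, iter i.+1 (ad a) b = 0].

(* The sum of the eigenspaces; it is automatically direct. *)
Definition D_ a : set A :=
  lspan [set b | exists lambda : K, ad a b = lambda *: b].

Definition F_ a : set A :=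
  [set b | finite_dim (lspan (range (fun i => iter i (ad a) b)))].

Definition strongly_nilpotent : set A :=
  [set a | [/\ ~ centre a, N_ a = setT & D_ a = C_ a]].

Definition weakly_nilpotent : set A :=
  [set a | [/\ ~ centre a, C_ a <> N_ a, N_ a <> setT & D_ a = C_ a]].

Definition strongly_semisimple : set A :=
  [set a | [/\ ~ centre a, N_ a = C_ a & D_ a = setT]].

Definition weakly_semisimple : set A :=
  [set a | [/\ ~ centre a, N_ a = C_ a, C_ a <> D_ a, D_ a = F_ a &
               F_ a <> setT]].

Definition generic : set A :=
  [set a | [/\ ~ centre a, N_ a = D_ a & D_ a = C_ a]].

Definition dixmier_partition : Prop :=
  ~` centre = strongly_nilpotent `|` weakly_nilpotent `|`
    strongly_semisimple `|` weakly_semisimple `|` generic.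

Definition commutative_centralizer_condition : Prop :=
  noncommutative /\
  forall a, ~ centre a -> forall b c, C_ a b -> C_ a c -> b * c = c * b.

Definition scaled_coset a : set A :=
  [set x | exists (k : K) z, [/\ k != 0, centre z & x = k *: a + z]].

(* In X, all elements are generic except for a subset K^* a' + Z(A) of
   elements of T, for some a' in T. *)
Definition generic_except (T X : set A) : Prop :=
  exists a', [/\ T a', scaled_coset a' `<=` X, scaled_coset a' `<=` T &
    X `\` scaled_coset a' `<=` generic].

Definition centralizer_kind (X : set A) (i : 'I_5) : Prop :=
  match val i with
  | 0 => X `<=` strongly_nilpotent
  | 1 => X `<=` weakly_nilpotent
  | 2 => generic_except strongly_semisimple X
  | 3 => generic_except weakly_semisimple X
  | _ => X `<=` generic
  end%N.

Definition homogeneous_centralizer_condition : Prop :=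
  [/\ noncommutative, dixmier_partition &
      forall a, ~ centre a ->
        exists! i, centralizer_kind (C_ a `\` centre) i].

Fixpoint power_space (V : set A) (n : nat) : set A :=
  if n is m.+1
  then lspan [set x | exists v w, [/\ V v, power_space V m w & x = v * w]]
  else lspan [set 1].

(* K + V + ... + V^n; it equals V^n when 1 lies in V. *)
Definition power_sum (V : set A) (n : nat) : set A :=
  lspan (\bigcup_(i < n.+1) power_space V i).

(* The terms n = 0, 1, where [ln n%:R] is 0, do not affect the limsup. *)
Definition GKdim (R : realType) : \bar R :=
  ereal_sup [set limn_esup
      (fun n => (ln (dimv_nat (power_sum V n))%:R / ln n%:R)%:E)
    | V in @finite_dim K A].

End Dixmier.

(* Main.v *)
Require Import Defs.
From HB Require Import structures.
From mathcomp Require Import all_boot all_order all_algebra.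
From mathcomp Require Import all_classical all_reals all_analysis.
From mathcomp Require Import zify ring lra.

Set Implicit Arguments.
Unset Strict Implicit.
Unset Printing Implicit Defensive.

Import Order.TTheory GRing.Theory Num.Theory.
Local Open Scope classical_set_scope.
Local Open Scope ring_scope.

(** Both halves of the theorem come from one statement about a noncommutative
algebra A embedded in a division algebra G over K. Two things are used.

- In G, the centralizer of a non-scalar element is commutative.
- For no finite W in A do the words in W of length at most 3n contain, for
  every n, a family of n^3 linearly independent elements ([small_growth]).

The second point weakens GKdim < 3 to what is needed. Centralizers in A are
then commutative too, and the centre of A consists of scalars.

Types. Let a be non-central in A. The field C(a) acts on G from the right, and
left multiplication by a is linear; generalised eigenvectors of this operator
with distinct pairs (eigenvalue, height) are independent over C(a), hence so
are their products with powers of a over K. So two-parameter families of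
words with distinct pairs, of length at most i + k + 1, are impossible
([cubic_family_absurd]). Let y be an eigenvector of ad a with nonzero
eigenvalue. If b generates a Jordan block of size 2 of ad a, the
words b^i y^k form such a family: a proper eigenvector excludes Jordan blocks
([no_jordan_block]). Hence N(a) = C(a) or D(a) = C(a), and D(a) = F(a) when
D(a) is not C(a), which is the Dixmier partition. Homogeneity follows from
two facts about commuting a, b, for which C(a) = C(b): N(a) = N(b), and b is
an affine function k a + c of a if both have eigenvectors y, w with nonzero
eigenvalues ([commuting_semisimple_affine]); there the families are
y^i w y^k and y^i w^k.

Centralizers in the division ring Gamma. Dimension one and Zariski's lemma
give a function t over which all functions are algebraic
([curve_algebraic]). The derivation d/dt extends to the function field as a
derivation D, whose constants are the scalars. Commutation with t is locally
nilpotent on differential operators and its kernel is O, so an operator u has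
an order n and a symbol f, a function with [..[u, t].., t] = n! f. Symbols
are multiplicative, and [u, v] has order at most m + n - 1 with coefficient
m f Dg - n g Df in that order. Both facts pass to fractions
([leading_bracket_all]). If an element of Gamma has nonzero order, this
formula shows that elements of its centralizer of equal order have proportional
symbols, so its centralizer is approximated by Laurent polynomials in a single
element, and is commutative ([commuting_positive_order_commutative]).
Elements of order zero are treated separately ([ore_commutative_centralizers]).

Growth of differential operators. A word of length l in fixed operators is
determined by its values on t^i for i up to a multiple of l, and those are
polynomials of degree O(l) in the generators of O. On a curve such
polynomials span a space of dimension O(l) ([curve_linear_growth]), so the
words span one of dimension O(l^2), which is less than cubic
([diffop_small_growth]). *)

(** * Iterated twisted derivations *)

(** A product may obey the Leibniz rule for three different maps: this is the case
of x |-> al x - x e, where e depends on the factor. *)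
Section Leibniz.
Variables (R : nzRingType) (d1 d2 d3 : R -> R).
Hypothesis d3D : {morph d3 : x y / x + y}.
Hypothesis d3M : forall x y, d3 (x * y) = d1 x * y + x * d2 y.

Let d3_0 : d3 0 = 0.
Proof. by apply: (addrI (d3 0)); rewrite -d3D !addr0. Qed.

Lemma iter_leibniz n x y :
  iter n d3 (x * y) =
  \sum_(i < n.+1) (iter i d1 x * iter (n - i) d2 y) *+ 'C(n, i).
Proof.
have d3mn u m : d3 (u *+ m) = d3 u *+ m.
  by elim: m => [|m IH]; rewrite ?d3_0 // !mulrS d3D IH.
elim: n => [|n IH]; first by rewrite big_ord1.
rewrite iterS IH (big_morph d3 d3D d3_0).
under eq_bigr do rewrite d3mn d3M mulrnDl -!iterS.
rewrite big_split /= [RHS]big_ord_recl /= ?subn0 bin0 mulr1n.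
under [X in _ = _ + X]eq_bigr do rewrite /bump /= add1n subSS binS mulrnDr.
rewrite big_split /= addrC [X in X + _ = _]big_ord_recl /= ?subn0 bin0 mulr1n.
rewrite -addrA; congr (_ + _); rewrite addrC [RHS]addrC; congr (_ + _).
rewrite [RHS]big_ord_recr /= bin_small // mulr0n addr0.
by apply: eq_bigr => i _; rewrite /bump /= add1n -[in RHS](subnSK (ltn_ord i)) iterS.
Qed.

(** In the Leibniz expansion of order m + n every term but one has a factor killed
by too many derivations; the surviving binomial is what makes symbols
multiplicative and heights additive. *)
Lemma iter_leibniz_top m n x y :
  iter m.+1 d1 x = 0 -> iter n.+1 d2 y = 0 -> d1 0 = 0 -> d2 0 = 0 ->
  iter (m + n) d3 (x * y) = (iter m d1 x * iter n d2 y) *+ 'C(m + n, m).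
Proof.
move=> xm yn d10 d20.
have it0 (d : R -> R) k : d 0 = 0 -> iter k d 0 = 0.
  by move=> d0; elim: k => //= k ->.
have mlt : (m < (m + n).+1)%N by rewrite ltnS leq_addr.
rewrite iter_leibniz (bigD1 (Ordinal mlt)) //= big1 ?addr0 ?addKn // => i.
rewrite -val_eqE /= neq_ltn => /orP[im|mi].
  have -> : (m + n - i = (m - i).-1 + n.+1)%N by lia.
  by rewrite iterD yn it0 // mulr0 mul0rn.
have -> : val i = (i - m.+1 + m.+1)%N by rewrite subnK.
by rewrite iterD xm it0 // mul0r mul0rn.
Qed.

Lemma iter_leibniz_vanish m n x y :
  iter m.+1 d1 x = 0 -> iter n.+1 d2 y = 0 -> d1 0 = 0 -> d2 0 = 0 ->
  iter (m + n).+1 d3 (x * y) = 0.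
Proof.
move=> xm yn d10 d20; rewrite iterS iter_leibniz_top //.
have d3mn u k : d3 (u *+ k) = d3 u *+ k.
  by elim: k => [|k IH]; rewrite ?d3_0 // !mulrS d3D IH.
by rewrite d3mn d3M -!iterS xm yn mul0r mulr0 addr0 mul0rn.
Qed.

End Leibniz.

(** * Generalised eigenvectors in a division ring *)

Section DivisionRing.
Variable G : unitRingType.
Hypothesis Gdiv : forall x : G, x != 0 -> x \is a GRing.unit.
Implicit Types (e al : G).

Lemma div_mulf_neq0 (x y : G) : x != 0 -> y != 0 -> x * y != 0.
Proof.
move=> /Gdiv ux y0; apply: contra_neq y0 => xy0.
by rewrite -[y](mulKr ux) xy0 mulr0.
Qed.

Lemma div_expf_neq0 (x : G) n : x != 0 -> x ^+ n != 0.
Proof.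
move=> x0; elim: n => [|n IH]; first by rewrite expr0 oner_neq0.
by rewrite exprS div_mulf_neq0.
Qed.

(** The eigenvalue e acts from the right: G is a right vector space over a
commutative subfield containing e, and left multiplication by al is linear. *)
Definition shift al e v : G := al * v - v * e.

Definition has_height al e n v :=
  iter n (shift al e) v != 0 /\ iter n.+1 (shift al e) v = 0.

Lemma shift0 al e : shift al e 0 = 0.
Proof. by rewrite /shift mulr0 mul0r subrr. Qed.

Lemma shiftD al e : {morph shift al e : x y / x + y}.
Proof. by move=> x y; rewrite /shift mulrDr mulrDl opprD addrACA. Qed.

Lemma shift_comm al e e' v : e * e' = e' * e ->
  shift al e (shift al e' v) = shift al e' (shift al e v).
Proof.
move=> c; rewrite /shift !mulrBr !mulrBl -!mulrA c !opprB.
by rewrite addrACA [RHS]addrACA [in RHS](addrC (- _)).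
Qed.

Lemma iter_shift_comm al e e' n v : e * e' = e' * e ->
  iter n (shift al e) (shift al e' v) = shift al e' (iter n (shift al e) v).
Proof. by move=> c; elim: n => //= n ->; rewrite shift_comm. Qed.

Lemma shift_mulr al e l v : e * l = l * e ->
  shift al e (v * l) = shift al e v * l.
Proof. by move=> c; rewrite /shift mulrBl -!mulrA c. Qed.

Lemma has_height_mulr al e n v l : l != 0 -> e * l = l * e ->
  has_height al e n v -> has_height al e n (v * l).
Proof.
move=> l0 c [vn vS].
have E m : iter m (shift al e) (v * l) = iter m (shift al e) v * l.
  by elim: m => //= m ->; rewrite shift_mulr.
by split; rewrite E ?vS ?mul0r // div_mulf_neq0.
Qed.

Lemma has_height_pred al e n v :
  has_height al e n.+1 v -> has_height al e n (shift al e v).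
Proof. by move=> [vn vS]; split; rewrite -iterSr. Qed.

Lemma has_height_shift al e e' n v : e * e' = e' * e -> e != e' ->
  has_height al e n v -> has_height al e n (shift al e' v).
Proof.
move=> c ne [vn vS]; split; rewrite iter_shift_comm // ?vS ?shift0 //.
move: vn vS => /=; set u := iter n _ v => u0 /eqP; rewrite subr_eq0 => /eqP au.
by rewrite /shift au -mulrBr div_mulf_neq0 // subr_eq0.
Qed.

(** Independence of generalised eigenvectors for distinct pairs (eigenvalue,
height): applying v |-> al v - v e0 lowers by one the heights at the eigenvalue
e0 and keeps those at the other eigenvalues, so induction on the total height
applies. Right coefficients are absorbed in the vectors by
[has_height_mulr]. *)
Lemma sum_has_height_neq0 al (s : seq (G * nat * G)) :
  uniq (map fst s) -> s != [::] ->
  {in s &, forall p q, p.1.1 * q.1.1 = q.1.1 * p.1.1} ->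
  {in s, forall p, has_height al p.1.1 p.1.2 p.2} ->
  \sum_(p <- s) p.2 != 0.
Proof.
have [w] := ubnP (\sum_(x <- s) x.1.2.+1)%N.
elim: w s => // w IH s sw su s0 sc sh.
have [[[e0 n0] v0] s_x0] : exists x, x \in s.
  by case: s s0 {sw su sc sh} => // x s _; exists x; exact: mem_head.
pose f (x : G * nat * G) : G * nat * G :=
  (x.1.1, if x.1.1 == e0 then x.1.2.-1 else x.1.2, shift al e0 x.2).
(* The vector of eigenvalue e0 and height 0 is killed, hence left out. *)
pose t := [seq x <- s | x.1 != (e0, 0%N)].
have shsum (r : seq (G * nat * G)) :
    shift al e0 (\sum_(x <- r) x.2) = \sum_(x <- r) shift al e0 x.2.
  exact: (big_morph _ (shiftD al e0) (shift0 al e0)).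
have tsum : \sum_(x <- map f t) x.2 = shift al e0 (\sum_(x <- s) x.2).
  rewrite big_map shsum big_filter [RHS](bigID (fun x => x.1 != (e0, 0%N))) /=.
  rewrite [X in _ + X]big_seq_cond [X in _ + X]big1 ?addr0 //.
  move=> [[e n] v] /= /andP[xs /negPn/eqP[ee nn]].
  by have [_] := sh _ xs; rewrite /= ee nn.
have [t0|t0] := eqVneq t [::].
  have allx x : x \in s -> x.1 = (e0, 0%N).
    move=> xs; apply/eqP; apply: contraT => ne.
    by have : x \in t; [rewrite mem_filter ne | rewrite t0].
  case: s su s0 sh allx {sw sc s_x0 t t0 tsum} => // x [|y s] su _ sh allx.
    rewrite big_seq1; have [] := sh x (mem_head _ _).
    by rewrite (allx x (mem_head _ _)).
  by move: su; rewrite /= inE (allx x) ?(allx y) ?inE ?eqxx ?orbT.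
have ts : {subset t <= s} by move=> x; rewrite mem_filter => /andP[].
suff : \sum_(x <- map f t) x.2 != 0.
  by rewrite tsum; apply: contra_neq => ->; rewrite shift0.
apply: IH.
- rewrite -ltnS; apply: leq_trans sw; rewrite ltnS big_map big_filter big_mkcond /=.
  rewrite (big_rem _ s_x0) /= [X in (_ < X)%N](big_rem _ s_x0) /=.
  rewrite eqxx xpair_eqE eqxx /= -addSn leq_add //; first by case: (n0).
  apply: leq_sum => -[[e n] v] _ /=; case: ifP => // _; case: ifP => // _.
  by case: n.
- pose g (p : G * nat) := (p.1, if p.1 == e0 then p.2.-1 else p.2).
  have -> : map fst (map f t) = map g (map fst t) by rewrite -!map_comp.
  have mt : map fst t = [seq p <- map fst s | p != (e0, 0%N)].
    by rewrite filter_map.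
  rewrite mt map_inj_in_uniq ?filter_uniq //.
  move=> [e n] [e' n']; rewrite !mem_filter !xpair_eqE /=.
  move=> /andP[ne _] /andP[ne' _] [ee']; move: ne ne'; rewrite -ee'.
  case: eqP => /= _; last by move=> _ _ ->.
  by case: n n' => [|n] [|n'] //= _ _ ->.
- by case: (t) t0.
- by move=> _ _ /mapP[x xt ->] /mapP[y yt ->]; exact: (sc x y (ts _ xt) (ts _ yt)).
- move=> _ /mapP[[[e n] v] xt ->] /=; have xs := ts _ xt.
  have := sh _ xs; have := sc _ _ xs s_x0 => /= c.
  have [ee|ne] := eqVneq e e0; last exact: has_height_shift.
  move: xt; rewrite mem_filter ee /= xpair_eqE eqxx /=.
  by case: n {xs} => // n _; rewrite /= ; exact: has_height_pred.
Qed.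
End DivisionRing.

(** * Algebras without cubic families of independent words *)

Definition is_scalar (K : pzRingType) (A : algType K) (x : A) : Prop :=
  exists k : K, x = k%:A.

Definition commutative_centralizers (K : pzRingType) (A : algType K) : Prop :=
  forall x : A, ~ is_scalar x ->
  forall b c, x * b = b * x -> x * c = c * x -> b * c = c * b.

(** The negation is a uniform form of cubic growth: for some finite W and all n,
the words of length at most 3n contain n^3 independent elements. The factor 3
leaves room for words u v a^l with three exponents below n. *)
Definition small_growth (K : fieldType) (A : algType K) : Prop :=
  forall W : seq A, exists n, forall f : 'I_n * 'I_n * 'I_n -> seq A,
    (forall s, {subset f s <= W} /\ (size (f s) <= 3 * n)%N) ->
    exists c : 'I_n * 'I_n * 'I_n -> K,
      (exists s, c s != 0) /\ \sum_s c s *: \prod_(x <- f s) x = 0.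

Section Cubic.
Variables (K : closedFieldType) (G : unitAlgType K).
Hypothesis Gdiv : forall x : G, x != 0 -> x \is a GRing.unit.

Lemma scalar_comm (k : K) (x : G) : k%:A * x = x * k%:A.
Proof. by rewrite -scalerAl -scalerAr mul1r mulr1. Qed.

(** Over an algebraically closed field a polynomial in a is a product of linear
factors a - z, so a non-scalar element of a domain is transcendental. *)
Lemma horner_alg_neq0 (A : algType K) (a : A) (p : {poly K}) :
  (forall x y : A, x != 0 -> y != 0 -> x * y != 0) ->
  ~ is_scalar a -> p != 0 -> horner_alg a p != 0.
Proof.
move=> Adom na p0; have [r pE] := closed_field_poly_normal p.
rewrite pE linearZ /= mulr_algl scaler_eq0 lead_coef_eq0 (negbTE p0) /=.
elim: r {pE} => [|z r IH]; first by rewrite big_nil rmorph1 oner_neq0.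
rewrite big_cons rmorphM Adom //=.
rewrite rmorphB /= horner_algX horner_algC subr_eq0.
by apply/eqP => az; apply: na; exists z.
Qed.

Lemma scalar_powers_free (a : G) n (c : 'I_n -> K) :
  ~ is_scalar a -> \sum_k c k *: a ^+ k = 0 -> forall k, c k = 0.
Proof.
move=> na s0 k; pose p := \poly_(i < n) (if insub i is Some j then c j else 0).
have p0 : p = 0.
  apply/eqP; apply: contraT => /(horner_alg_neq0 (div_mulf_neq0 Gdiv) na).
  rewrite /p poly_def raddf_sum /= -[X in _ != X]s0 => /eqP[]; apply: eq_bigr.
  by move=> i _; rewrite linearZ /= mulr_algl rmorphXn /= horner_algX valK.
by have := coef_poly n (fun i => if insub i is Some j then c j else 0) k;
  rewrite -/p p0 coef0 ltn_ord valK.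
Qed.

Section Words.
Variables (A : algType K) (j : {lrmorphism A -> G}).
Hypotheses (Acub : small_growth A) (GC : commutative_centralizers G).

(** Multiplying the words f i k by powers of a gives a three-parameter family of
words. A linear relation between them collects into a relation with
coefficients in K[a] between the f i k, which are generalised eigenvectors of
left multiplication by al with distinct pairs (e i k, h i k); since the e i k and
K[a] lie in the field C(a), independence contradicts [small_growth]. In use, al
is a up to a scalar. *)
Lemma cubic_family_absurd (a : A) (W : seq A) (f : nat -> nat -> seq A)
    (al : G) (e : nat -> nat -> G) (h : nat -> nat -> nat) :
  ~ is_scalar (j a) ->
  (forall i k, {subset f i k <= W}) ->
  (forall i k, size (f i k) <= i + k + 1)%N ->
  (forall i k, has_height al (e i k) (h i k) (j (\prod_(x <- f i k) x))) ->
  (forall i k, j a * e i k = e i k * j a) ->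
  (forall i k i' k', e i k = e i' k' -> h i k = h i' k' -> i = i' /\ k = k') ->
  False.
Proof.
move=> na fW fs fh ea einj.
have [n Hn] := Acub (a :: W).
have [] := Hn (fun s => f s.1.1 s.1.2 ++ nseq s.2 a).
  move=> [[i k] l] /=; split.
    move=> x; rewrite mem_cat inE => /orP[/fW ->|]; first by rewrite orbT.
    by move=> /nseqP[-> _]; rewrite eqxx.
  rewrite size_cat size_nseq; have := fs i k.
  move: (size _) (ltn_ord i) (ltn_ord k) (ltn_ord l) => sz; lia.
move=> c [[[[i0 k0] l0] c0] sum0].
pose q (p : 'I_n * 'I_n) : G := \sum_l c (p, l) *: j a ^+ l.
pose v (p : 'I_n * 'I_n) : G := j (\prod_(x <- f p.1 p.2) x).
have vq0 : \sum_p v p * q p = 0.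
  rewrite -[RHS](raddf0 j) -sum0 raddf_sum /=.
  rewrite (eq_bigr (fun p => \sum_l v p * (c (p, l) *: j a ^+ l))); last first.
    by move=> p _; rewrite mulr_sumr.
  rewrite pair_bigA /=; apply: eq_bigr => -[[i k] l] _ /=.
  rewrite linearZ /= big_cat rmorphM /= -scalerAr; congr (_ *: (_ * _)).
  by rewrite big_nseq_cond /= iter_mulr_1 rmorphXn.
have qa p : j a * q p = q p * j a.
  rewrite /q mulr_sumr mulr_suml; apply: eq_bigr => l _.
  by rewrite -scalerAr -scalerAl -exprS -exprSr.
have q0 : q (i0, k0) != 0.
  apply/eqP => q0; move/eqP: c0; apply.
  exact: (scalar_powers_free na q0 l0).
pose s := [seq ((e p.1 p.2, h p.1 p.2), v p * q p) |
  p : 'I_n * 'I_n <- index_enum ('I_n * 'I_n)%type & q p != 0].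
have : \sum_(x <- s) x.2 != 0.
  apply: (@sum_has_height_neq0 _ Gdiv al).
  - rewrite -map_comp map_inj_uniq ?filter_uniq ?index_enum_uniq // => -[i k] [i' k'].
    by move=> /= [ee hh]; have [/val_inj-> /val_inj->] := einj _ _ _ _ ee hh.
  - rewrite -size_eq0 size_map size_eq0 -has_filter; apply/hasP.
    by exists (i0, k0); rewrite ?mem_index_enum.
  - move=> _ _ /mapP[x _ ->] /mapP[y _ ->] /=.
    exact: (GC na).
  - move=> _ /mapP[x xq ->] /=; move: xq; rewrite mem_filter => /andP[xq _].
    by apply: has_height_mulr => //; apply: (GC na).
rewrite big_map big_filter big_mkcond /= -[X in _ != X]vq0 => /eqP[].
by apply: eq_bigr => p _; case: eqP => //= ->; rewrite mulr0.
Qed.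

End Words.
End Cubic.

(** * Eigenvectors and Jordan blocks of inner derivations *)

Section Affine.
Variables (K : closedFieldType) (G : unitAlgType K).
Hypothesis Gdiv : forall x : G, x != 0 -> x \is a GRing.unit.
Hypothesis charK : [pchar K] =i pred0.
Hypothesis GC : commutative_centralizers G.
Variables (A : algType K) (j : {lrmorphism A -> G}).
Hypothesis jinj : injective j.
Hypothesis Acub : small_growth A.

Lemma natK_neq0 n : (n.+1%:R : K) != 0.
Proof. by rewrite (proj1 (pcharf0P K) charK). Qed.

Lemma mulrn_neq0 (V : lmodType K) (x : V) n : x != 0 -> x *+ n.+1 != 0.
Proof. by move=> x0; rewrite -scaler_nat scaler_eq0 negb_or natK_neq0. Qed.

Lemma mulrn_scalar_neq0 (k : K) n : k != 0 -> k *+ n.+1 != 0.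
Proof. by move=> k0; rewrite -mulr_natr mulf_neq0 // natK_neq0. Qed.

Lemma mulrn_inj (x : K) m n : x != 0 -> x *+ m = x *+ n -> m = n.
Proof.
wlog mn : m n / (m <= n)%N => [W|] x0 e.
  by case: (leqP m n) => [/W|/ltnW/W/(_ x0 (esym e))]; [apply|].
apply/eqP; move: e; rewrite -(subnK mn) mulrnDr => /eqP.
rewrite -{1}[x *+ m]add0r eq_sym (inj_eq (addIr _)).
case: (n - m)%N => // k; rewrite -[x]mulr1 -[_ *+ k.+1]mulrnAr.
by rewrite mulf_eq0 (negbTE x0) (negbTE (natK_neq0 k)).
Qed.

Lemma mul_scalar_r (x : G) (k : K) : x * k%:A = k *: x.
Proof. by rewrite -scalerAr mulr1. Qed.

Lemma eigen_pow (x y : G) (l : K) n :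
  x * y = y * x + l *: y -> x * y ^+ n = y ^+ n * x + (l *+ n) *: y ^+ n.
Proof.
move=> xy; elim: n => [|n IH].
  by rewrite expr0 mulr1 mul1r mulr0n scale0r addr0.
rewrite exprS mulrA xy mulrDl -mulrA IH mulrDr -scalerAl -scalerAr mulrA.
by rewrite -addrA -scalerDl -mulrSr.
Qed.

(** In characteristic zero the binomial coefficient is nonzero, so heights add and
eigenvalues a + k, a + l combine to a + (k + l). *)
Lemma has_height_mul (a x y : G) (k l : K) m n :
  has_height a (a + k%:A) m x -> has_height a (a + l%:A) n y ->
  has_height a (a + (k + l)%:A) (m + n) (x * y).
Proof.
move=> [xm xS] [yn yS].
have M u v : shift a (a + (k + l)%:A) (u * v) =
    shift a (a + k%:A) u * v + u * shift a (a + l%:A) v.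
  rewrite /shift !mulrBr !mulrBl !mulrDr !mulrDl !mul_scalar_r.
  rewrite -scalerAl -scalerAr scalerDl !mulrA !opprD !addrA.
  by rewrite (addrAC (a * u * v) (- (u * a * v))) subrK (addrAC (a * u * v)).
split.
  rewrite (iter_leibniz_top (shiftD _ _) M xS yS) ?shift0 //.
  have : (0 < 'C(m + n, m))%N by rewrite bin_gt0 leq_addr.
  case: 'C(m + n, m) => // c _.
  apply: (@mulrn_neq0 (GRing.UnitAlgebra.sort G)).
  exact: div_mulf_neq0.
by rewrite (iter_leibniz_vanish (shiftD _ _) M xS yS) ?shift0.
Qed.

Lemma has_height_exp (a x : G) (k : K) n i :
  has_height a (a + k%:A) n x ->
  has_height a (a + (k *+ i)%:A) (n * i) (x ^+ i).
Proof.
move=> xh; elim: i => [|i IH].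
  rewrite muln0 expr0 mulr0n scale0r addr0; split; first exact: oner_neq0.
  by rewrite /= /shift mulr1 mul1r subrr.
by rewrite exprS mulrS mulnS; exact: has_height_mul.
Qed.

(** The word b^i y^k has eigenvalue a + (m i + l k) and height i. As l is nonzero
these pairs are distinct, which [cubic_family_absurd] forbids. *)
Lemma no_jordan_block (a b y : A) (m l : K) :
  ~ is_scalar (j a) -> y != 0 -> l != 0 -> a * y - y * a = l *: y ->
  let b' := a * b - b * a - m *: b in
  b' != 0 -> a * b' - b' * a = m *: b' -> False.
Proof.
move=> na y0 l0 ay b' b'0 ab'.
have j0 x : x != 0 -> j x != 0 by rewrite -(inj_eq jinj) raddf0.
have shE k v : shift (j a) (j a + k%:A) (j v) = j (a * v - v * a - k *: v).
  rewrite /shift mulrDr mul_scalar_r !raddfB /= !rmorphM linearZ.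
  by rewrite opprD addrA.
have bh : has_height (j a) (j a + m%:A) 1 (j b).
  split; first by rewrite /= shE j0.
  by rewrite /= !shE ab' subrr raddf0.
have yh : has_height (j a) (j a + l%:A) 0 (j y).
  by split; rewrite /= ?j0 // shE ay subrr raddf0.
apply: (@cubic_family_absurd _ _ Gdiv _ j Acub GC a [:: b; y]
  (fun i k => nseq i b ++ nseq k y) (j a)
  (fun i k => j a + (m *+ i + l *+ k)%:A) (fun i k => i) na).
- move=> i k x; rewrite mem_cat !inE => /orP[] /nseqP[-> _];
    by rewrite eqxx ?orbT.
- by move=> i k; rewrite size_cat !size_nseq leq_addr.
- move=> i k; rewrite big_cat !big_nseq_cond /= !iter_mulr_1 rmorphM !rmorphXn.
  have := has_height_mul (has_height_exp i bh) (has_height_exp k yh).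
  by rewrite mul1n mul0n addn0.
- by move=> i k; rewrite mulrDl mulrDr scalar_comm.
- move=> i k i' k' /addrI e ii'; split=> //; move: e; rewrite ii'.
  move=> /eqP; rewrite -subr_eq0 -scalerBl scaler_eq0 oner_eq0 orbF subr_eq0.
  by move=> /eqP/addrI/(mulrn_inj l0).
Qed.

Section CommonEigenvector.
Variables (a b y w : A) (l m : K).
Hypotheses (na : ~ is_scalar (j a)) (nb : ~ is_scalar (j b)).
Hypotheses (ab : a * b = b * a) (y0 : y != 0) (w0 : w != 0).
Hypotheses (l0 : l != 0) (m0 : m != 0).
Hypotheses (ay : a * y = y * a + l *: y) (bw : b * w = w * b + m *: w).

Let j_neq0 x : x != 0 -> j x != 0.
Proof. by rewrite -(inj_eq jinj) raddf0. Qed.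

Let jay : j a * j y = j y * j a + l *: j y.
Proof. by rewrite -!rmorphM ay raddfD /= linearZ. Qed.

Let jbw : j b * j w = j w * j b + m *: j w.
Proof. by rewrite -!rmorphM bw raddfD /= linearZ. Qed.

Let jab : j a * j b = j b * j a.
Proof. by rewrite -!rmorphM ab. Qed.

Let prod_word2 (u v : A) i k :
  j (\prod_(x <- nseq i u ++ nseq k v) x) = j u ^+ i * j v ^+ k.
Proof.
by rewrite big_cat !big_nseq_cond /= !iter_mulr_1 rmorphM !rmorphXn.
Qed.

Lemma eigen_noncomm (x z : G) (k : K) n :
  z != 0 -> k != 0 -> x * z = z * x + k *: z ->
  x * z ^+ n.+1 != z ^+ n.+1 * x.
Proof.
move=> z0 k0 /eigen_pow ->; rewrite -subr_eq0 addrAC subrr add0r.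
by rewrite scaler_eq0 negb_or div_expf_neq0 // mulrn_scalar_neq0.
Qed.

(** Put h = w^-1 a w - a. Both a and w^-1 a w commute with b, so h commutes with a,
and so do its conjugates h_k = y^-k h y^k. The word y^i w y^k is an eigenvector
with eigenvalue a + l (i + k) + h_k, hence two of these eigenvalues agree; this
gives y^r h = (h + s) y^r for some r > 0 and scalar s. A combination
z = h + q a then commutes with y^r and with a. Since a and y^r do not commute,
z is a scalar. *)
Lemma twist_affine : exists p c : K, j a * j w = j w * (p *: j a + c%:A).
Proof.
have uy : j y \is a GRing.unit by apply/Gdiv/j_neq0.
have uw : j w \is a GRing.unit by apply/Gdiv/j_neq0.
pose h := (j w)^-1 * j a * j w - j a.
have aw : j a * j w = j w * (j a + h) by rewrite /h addrC subrK -mulrA mulVKr.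
have wbw : (j w)^-1 * j b * j w = j b + m%:A.
  by rewrite -mulrA jbw mulrDr mulKr // -scalerAr mulVr.
have ha : j a * h = h * j a.
  suff E : j a * ((j w)^-1 * j a * j w) = (j w)^-1 * j a * j w * j a.
    by rewrite /h mulrBr mulrBl E.
  apply: (GC nb); first by rewrite jab.
  have : (j b + m%:A) * ((j w)^-1 * j a * j w) =
         (j w)^-1 * j a * j w * (j b + m%:A).
    by rewrite -wbw -!mulrA !mulVKr // !mulrA -[_ * j b * j a]mulrA -jab !mulrA.
  by rewrite mulrDl mulrDr scalar_comm => /addIr.
pose hk k := j y ^- k * h * j y ^+ k.
have uyk k : j y ^+ k \is a GRing.unit by rewrite unitrX.
have hka k : j a * hk k = hk k * j a.
  have : (j a + (l *+ k)%:A) * hk k = hk k * (j a + (l *+ k)%:A).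
    have -> : j a + (l *+ k)%:A = j y ^- k * j a * j y ^+ k.
      by rewrite -mulrA (eigen_pow _ jay) mulrDr mulKr // -scalerAr mulVr.
    rewrite /hk -!mulrA !mulVKr // !mulrA.
    by rewrite -[_ * j a * h]mulrA ha !mulrA.
  by rewrite mulrDl mulrDr scalar_comm => /addIr.
(* Distinct eigenvalues would make y^i w y^k a forbidden family. *)
have [[[i k] [i' k']] /= [E ne]] : exists q : (nat * nat) * (nat * nat),
    (l *+ (q.1.1 + q.1.2))%:A + hk q.1.2 =
    (l *+ (q.2.1 + q.2.2))%:A + hk q.2.2 /\ q.1 <> q.2.
  apply: contrapT => noex.
  apply: (@cubic_family_absurd _ _ Gdiv _ j Acub GC a [:: w; y]
    (fun i k => nseq i y ++ w :: nseq k y) (j a)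
    (fun i k => j a + ((l *+ (i + k))%:A + hk k)) (fun i k => 0%N) na).
  - move=> i k x; rewrite mem_cat inE => /orP[/nseqP[-> _]|/orP[/eqP->|]].
    + by rewrite !inE eqxx orbT.
    + by rewrite mem_head.
    + by move=> /nseqP[-> _]; rewrite !inE eqxx orbT.
  - by move=> i k; rewrite size_cat /= !size_nseq addnS addn1.
  - move=> i k; rewrite big_cat big_cons !big_nseq_cond /= !iter_mulr_1.
    rewrite !rmorphM !rmorphXn; split=> /=.
      by rewrite !div_mulf_neq0 ?div_expf_neq0 ?j_neq0.
    apply/eqP; rewrite subr_eq0; apply/eqP.
    have au : j a * (j w * j y ^+ k) =
        j w * j y ^+ k * (j a + (l *+ k)%:A + hk k).
      have hE : h * j y ^+ k = j y ^+ k * hk k by rewrite /hk -mulrA mulVKr.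
      rewrite mulrA aw -mulrA mulrDl (eigen_pow _ jay) hE !mulrDr.
      by rewrite !mul_scalar_r -scalerAr !mulrA.
    rewrite [j a * (_ * _)]mulrA (eigen_pow _ jay) mulrDl -mulrA au -scalerAl.
    rewrite [_ ^+ i * (_ * (_ + _ + _))]mulrA; set v := _ ^+ i * _.
    rewrite !mulrDr !mul_scalar_r mulrnDr scalerDl -!addrA; congr (_ + _).
    by rewrite addrA [LHS]addrC.
  - by move=> i k; rewrite !mulrDl !mulrDr scalar_comm hka.
  - move=> i k i' k' /addrI E _; apply: contrapT => ne; apply: noex.
    by exists ((i, k), (i', k')); split=> //= -[? ?]; apply: ne.
have [r [s hs]] : exists r s,
    j y ^+ r.+1 * h = h * j y ^+ r.+1 + s *: j y ^+ r.+1.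
  have key i1 i2 k1 r : (l *+ (i1 + k1))%:A + hk k1 =
      (l *+ (i2 + (k1 + r.+1)))%:A + hk (k1 + r.+1) ->
      exists s, j y ^+ r.+1 * h = h * j y ^+ r.+1 + s *: j y ^+ r.+1.
    move=> e; pose s := l *+ (i2 + (k1 + r.+1)) - l *+ (i1 + k1).
    exists s; apply: (mulIr (uyk k1)).
    have -> : j y ^+ r.+1 * h * j y ^+ k1 = j y ^+ (k1 + r.+1) * hk k1.
      by rewrite /hk addnC exprD -!mulrA mulVKr.
    have -> : hk k1 = hk (k1 + r.+1)%N + s%:A.
      by apply: (addrI (l *+ (i1 + k1))%:A); rewrite e /s scalerBl addrCA
        [X in _ = _ + X]addrC subrK addrC.
    rewrite mulrDr mul_scalar_r /hk -!mulrA mulVKr // addnC exprD [RHS]mulrDl.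
    by rewrite -scalerAl -[in RHS]mulrA.
  have [kk'|k'k|kk'] := ltngtP k k'.
  - have [r rE] : exists r, k' = (k + r.+1)%N by exists (k' - k.+1)%N; lia.
    by rewrite rE in E; have [s hs] := key _ _ _ _ E; exists r, s.
  - have [r rE] : exists r, k = (k' + r.+1)%N by exists (k - k'.+1)%N; lia.
    by rewrite rE in E; have [s hs] := key _ _ _ _ (esym E); exists r, s.
  - case: ne; move: E; rewrite kk' => /addIr/eqP.
    rewrite -subr_eq0 -scalerBl scaler_eq0 oner_eq0 orbF subr_eq0.
    by move=> /eqP/(mulrn_inj l0)/addIn ->.
pose q := s / (l *+ r.+1); pose z := h + q *: j a.
have za : z * j a = j a * z by rewrite mulrDl mulrDr ha -scalerAl -scalerAr.
have zy : z * j y ^+ r.+1 = j y ^+ r.+1 * z.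
  rewrite mulrDl -scalerAl (eigen_pow _ jay) scalerDr scalerA.
  rewrite divfK ?mulrn_scalar_neq0 // mulrDr hs -scalerAr -!addrA.
  by congr (_ + _); rewrite addrC.
have [c zE] : is_scalar z.
  apply: contrapT => nz; have := eigen_noncomm r (j_neq0 y0) l0 jay.
  by rewrite (GC nz za zy) eqxx.
exists (1 - q), c; rewrite aw; congr (_ * _).
by rewrite -zE /z scalerBl scale1r [h + _]addrC [RHS]addrA subrK.
Qed.

(** By [twist_affine], a w = w (p a + c). If p = 1, the element m a - c b commutes
with b and with w, which do not commute, so it is a scalar. If p <> 1, then
a0 = a + c / (p - 1) satisfies a0 w = p w a0, and y^i w^k has eigenvalue
l i + p^k a0. Here p is not a root of unity, since w^r commutes neither with b
nor, therefore, with a0; so the eigenvalues are distinct, which is forbidden. *)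
Lemma commuting_semisimple_affine : exists k c : K, k != 0 /\ b = k *: a + c%:A.
Proof.
have [p [c aw]] := twist_affine.
have [p1|p1] := eqVneq p 1.
  move: aw; rewrite p1 scale1r mulrDr mul_scalar_r => aw.
  have [d dE] : is_scalar (m *: j a - c *: j b).
    apply: contrapT => nd; have := eigen_noncomm 0 (j_neq0 w0) m0 jbw.
    rewrite expr1 (GC nd) ?eqxx //.
      by rewrite mulrBl mulrBr -!scalerAl -!scalerAr jab.
    rewrite mulrBl mulrBr -!scalerAl -!scalerAr aw jbw !scalerDr !scalerA.
    by rewrite (mulrC c) opprD addrACA subrr addr0.
  have c0 : c != 0.
    apply/eqP => c0; apply: na; exists (m^-1 * d); move: dE.
    rewrite c0 scale0r subr0 => /(congr1 (fun x => m^-1 *: x)).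
    by rewrite !scalerA mulVf // scale1r.
  exists (c^-1 * m), (- (c^-1 * d)); rewrite mulf_neq0 ?invr_eq0 //; split=> //.
  apply: jinj; rewrite raddfD /= !linearZ /= rmorph1 -!scalerA scaleNr.
  by rewrite -scalerA -dE -scalerBr opprB addrC subrK scalerA mulVf // scale1r.
exfalso; have p10 : p - 1 != 0 by rewrite subr_eq0.
pose a0 := j a + (c / (p - 1))%:A.
have na0 : ~ is_scalar a0.
  move=> [d dE]; apply: na; exists (d - c / (p - 1)).
  by rewrite scalerBl -dE addrK.
have a0w : a0 * j w = j w * (p *: a0).
  rewrite mulrDl aw scalar_comm -mulrDr -addrA -scalerDl scalerDr scalerA.
  congr (_ * (_ + _%:A)); have -> : c = c / (p - 1) * (p - 1) by rewrite divfK.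
  rewrite mulfK // mulrBr mulr1 subrK; exact: mulrC.
have p0 : p != 0.
  apply/eqP => p0; move: a0w; rewrite p0 scale0r mulr0 => /eqP.
  apply/negP; rewrite div_mulf_neq0 ?j_neq0 //.
  by apply/eqP => a00; apply: na0; exists 0; rewrite scale0r.
have a0y : a0 * j y = j y * a0 + l *: j y.
  by rewrite mulrDl mulrDr jay scalar_comm addrAC.
have a0wk k : a0 * j w ^+ k = p ^+ k *: (j w ^+ k * a0).
  elim: k => [|k IH]; first by rewrite !expr0 mulr1 mul1r scale1r.
  rewrite !exprS mulrA a0w -scalerAr -scalerAl -(mulrA (j w) a0) IH.
  by rewrite -scalerAr scalerA mulrA.
have a0b : a0 * j b = j b * a0 by rewrite mulrDl mulrDr jab scalar_comm.
have a0a : j a * a0 = a0 * j a by rewrite mulrDl mulrDr scalar_comm.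
clearbody a0.
have pinj k k' : p ^+ k = p ^+ k' -> k = k'.
  have noroot r : p ^+ r.+1 != 1.
    apply/eqP => pr1; have := eigen_noncomm r (j_neq0 w0) m0 jbw.
    rewrite (GC na0 a0b) ?eqxx //.
    by rewrite a0wk pr1 scale1r.
  have lt_absurd k1 k2 : (k1 < k2)%N -> p ^+ k1 = p ^+ k2 -> False.
    move=> lt e; have := noroot (k2 - k1.+1)%N; rewrite subnSK // => /eqP; apply.
    apply: (mulfI (expf_neq0 k1 p0)).
    by rewrite -exprD subnKC 1?ltnW // mulr1.
  by move=> e; case: (ltngtP k k') => // lt; case: (lt_absurd _ _ lt).
apply: (@cubic_family_absurd _ _ Gdiv _ j Acub GC a [:: w; y]
  (fun i k => nseq i y ++ nseq k w) a0
  (fun i k => (l *+ i)%:A + p ^+ k *: a0) (fun i k => 0%N) na).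
- by move=> i k x; rewrite mem_cat !inE => /orP[] /nseqP[-> _];
    rewrite eqxx ?orbT.
- by move=> i k; rewrite size_cat !size_nseq leq_addr.
- move=> i k; rewrite prod_word2; split=> /=.
    by rewrite div_mulf_neq0 ?div_expf_neq0 ?j_neq0.
  apply/eqP; rewrite subr_eq0; apply/eqP.
  rewrite mulrA (eigen_pow _ a0y) mulrDl -scalerAl -mulrA a0wk -scalerAr.
  by rewrite mulrDr mul_scalar_r -scalerAr addrC mulrA.
- by move=> i k; rewrite mulrDl mulrDr scalar_comm -(scalerAl _ a0)
    -(scalerAr _ _ a0) a0a.
- move=> i k i' k' E _.
  have pk : p ^+ k = p ^+ k'.
    apply/eqP; rewrite -subr_eq0; apply: contrapT => /negP d0; apply: na0.
    exists ((p ^+ k - p ^+ k')^-1 * (l *+ i' - l *+ i)); rewrite -scalerA.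
    have -> : (l *+ i' - l *+ i)%:A = (p ^+ k - p ^+ k') *: a0.
      by apply/eqP; rewrite !scalerBl subr_eq addrAC -subr_eq opprK addrC E addrC.
    by rewrite scalerA mulVf ?scale1r //; apply/eqP.
  split; last exact: pinj.
  move: E; rewrite pk => /addIr/eqP.
  rewrite -subr_eq0 -scalerBl scaler_eq0 oner_eq0 orbF subr_eq0.
  by move=> /eqP/(mulrn_inj l0).
Qed.

End CommonEigenvector.
End Affine.

(** * Spans and dimension *)

Section Span.
Variables (K : fieldType) (M : lmodType K).
Implicit Types (V W : set M) (x y : M).

Lemma lspan_ind V (P : M -> Prop) :
  P 0 -> (forall x y, P x -> P y -> P (x + y)) ->
  (forall k x, V x -> P (k *: x)) -> forall x, lspan V x -> P x.
Proof.
move=> P0 PD PZ _ [n [c [v [Vv ->]]]]; elim/big_rec: _ => // i x _ Px.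
by apply: PD => //; apply: PZ.
Qed.

Lemma lspan_gen V x : V x -> lspan V x.
Proof.
move=> Vx; exists 1%N, (fun=> 1), (fun=> x); split=> //.
by rewrite big_ord1 scale1r.
Qed.

Lemma lspan0 V : lspan V 0.
Proof.
by exists 0%N, (fun=> 0), (fun=> 0); split; [case | rewrite big_ord0].
Qed.

Lemma lspanD V x y : lspan V x -> lspan V y -> lspan V (x + y).
Proof.
move=> [m [c [v [Vv ->]]]] [n [d [w [Vw ->]]]]; exists (m + n)%N.
exists (fun i => match fintype.split i with inl i => c i | inr i => d i end).
exists (fun i => match fintype.split i with inl i => v i | inr i => w i end).
split; first by move=> i; case: (fintype.split i).
by rewrite big_split_ord /=; congr (_ + _); apply: eq_bigr => i _;
  rewrite -/(unsplit (inl i)) -/(unsplit (inr i)) unsplitK.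
Qed.

Lemma lspanZ V k x : lspan V x -> lspan V (k *: x).
Proof.
move=> [n [c [v [Vv ->]]]]; exists n, (fun i => k * c i), v; split=> //.
by rewrite scaler_sumr; apply: eq_bigr => i _; rewrite scalerA.
Qed.

Lemma lspan_sum V I (r : seq I) (F : I -> M) :
  (forall i, lspan V (F i)) -> lspan V (\sum_(i <- r) F i).
Proof.
move=> VF; elim/big_rec: _ => [|i x _]; first exact: lspan0.
exact: lspanD.
Qed.

Lemma lspan_subset V W : V `<=` lspan W -> lspan V `<=` lspan W.
Proof.
move=> VW; apply: (@lspan_ind V (lspan W)) => [|x y|k x /VW]; first exact: lspan0.
  exact: lspanD.
exact: lspanZ.
Qed.

Lemma lspan_rangeP (T : finType) (w : T -> M) x :
  lspan (range w) x <-> exists c : T -> K, x = \sum_i c i *: w i.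
Proof.
split; last first.
  by move=> [c ->]; apply: lspan_sum => i; apply/lspanZ/lspan_gen; exists i.
move: x; apply: (@lspan_ind _ (fun x => exists c : T -> K, _)) => [|_ _ [c ->] [d ->]|k _ [t _ <-]].
- by exists (fun=> 0); rewrite big1 // => i _; rewrite scale0r.
- exists (fun i => c i + d i); rewrite -big_split; apply: eq_bigr => i _.
  by rewrite scalerDl.
- exists (fun i => k *+ (i == t)); rewrite (bigD1 t) //= eqxx mulr1n.
  rewrite big1 ?addr0 // => i /negbTE ->.
  by rewrite mulr0n scale0r.
Qed.

Definition linearly_free (T : finType) (v : T -> M) : Prop :=
  forall c : T -> K, \sum_i c i *: v i = 0 -> forall i, c i = 0.

(** Steinitz exchange: otherwise the matrix of the v i in terms of the w s has a
nonzero left kernel. *)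
Lemma free_card_le (S T : finType) (v : T -> M) (w : S -> M) :
  (forall i, lspan (range w) (v i)) -> linearly_free v -> (#|T| <= #|S|)%N.
Proof.
move=> vw vfree; rewrite leqNgt; apply/negP => lt.
have /choice[a aE] : forall i, exists c : S -> K, v i = \sum_s c s *: w s.
  by move=> i; apply/lspan_rangeP.
pose B := \matrix_(i < #|T|, s < #|S|) a (enum_val i) (enum_val s).
have /rowV0Pn[u] : kermx B != 0.
  rewrite kermx_eq0 /row_free; apply/eqP => rB.
  by have := rank_leq_col B; rewrite rB leqNgt lt.
move=> /sub_kermxP uB u0; move/negP: u0; apply; apply/eqP/rowP => i.
rewrite mxE -[i]enum_valK; apply: (vfree (fun t => u 0 (enum_rank t))).
rewrite (eq_bigr (fun t => \sum_s (u 0 (enum_rank t) * a t s) *: w s)).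
  rewrite exchange_big big1 //= => s _; rewrite -scaler_suml.
  have := congr1 (fun N : 'rV_ _ => N 0 (enum_rank s)) uB; rewrite !mxE => E.
  rewrite (reindex (@enum_val T predT)) /=; last first.
    by exists enum_rank => t _; rewrite ?enum_valK ?enum_rankK.
  rewrite [X in X *: _](_ : _ = 0) ?scale0r // -[RHS]E; apply: eq_bigr => t _.
  by rewrite mxE enum_rankK enum_valK.
by move=> t _; rewrite aE scaler_sumr; apply: eq_bigr => s _; rewrite scalerA.
Qed.

Lemma free_card_has_dim (T : finType) (v : T -> M) V n :
  has_dim V n -> (forall i, V (v i)) -> linearly_free v -> (#|T| <= n)%N.
Proof.
by move=> [w [-> _]] Vv /(free_card_le Vv); rewrite card_ord.
Qed.

Lemma has_dim_unique V m n : has_dim V m -> has_dim V n -> m = n.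
Proof.
wlog mn : m n / (m <= n)%N => [W|] Vm Vn.
  by case: (leqP m n) => [/W|/ltnW/W/(_ Vn Vm)]; [apply|].
apply/eqP; rewrite eqn_leq mn; case: Vn => w [VE wf].
rewrite -[n]card_ord; apply: (free_card_has_dim Vm _ wf) => i.
by rewrite VE; apply: lspan_gen; exists i.
Qed.

Lemma dimv_natE V n : has_dim V n -> dimv_nat V = n.
Proof.
move=> Vn; rewrite /dimv_nat; case: xgetP => [m _ Vm|/(_ n)//].
exact: has_dim_unique Vm Vn.
Qed.

(** A maximal free family in the span is a basis, and free families are bounded by
the number of generators. *)
Lemma finite_dim_lspan V (S : finType) (w : S -> M) :
  V `<=` lspan (range w) -> finite_dim (lspan V).
Proof.
move=> Vw; pose P n := `[< exists v : 'I_n -> M,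
  (forall i, lspan V (v i)) /\ linearly_free v >].
have P0 : exists n, P n.
  exists 0%N; apply/asboolP; exists (fun=> 0); split; first by case.
  by move=> c _; case.
have Pb n : P n -> (n <= #|S|)%N.
  move=> /asboolP[v [vV vf]]; rewrite -[n]card_ord.
  apply: (@free_card_le _ _ v w) => // i; have := vV i.
  exact: lspan_subset.
case: (ex_maxnP P0 Pb) => n /asboolP[v [vV vf]] nmax.
exists n, v; split=> //; rewrite eqEsubset; split; last first.
  by apply: lspan_subset => _ [i _ <-].
apply: lspan_subset => x Vx; apply: contrapT => nx.
suff /nmax : P n.+1 by rewrite ltnn.
apply/asboolP; pose u (i : 'I_n.+1) := if unlift ord_max i is Some k then v k else x.
exists u; split=> [i|c].
  by rewrite /u; case: unliftP => [k _|_] //; exact: lspan_gen.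
rewrite big_ord_recr /= {2}/u unlift_none.
have -> : \sum_(i < n) c (widen_ord (leqnSn n) i) *: u (widen_ord (leqnSn n) i)
    = \sum_(i < n) c (lift ord_max i) *: v i.
  apply: eq_bigr => i _; have -> : widen_ord (leqnSn n) i = lift ord_max i.
    exact/val_inj/esym/lift_max.
  by rewrite /u liftK.
have [cx|cx] := eqVneq (c ord_max) 0.
  rewrite cx scale0r addr0 => /vf ci i.
  by case: (unliftP ord_max i) => [k ->|-> //]; exact: ci.
move=> /eqP; rewrite addrC addr_eq0 => /eqP /(congr1 (fun z => (c ord_max)^-1 *: z)).
rewrite scalerA mulVf // scale1r => xE; case: nx; rewrite xE.
apply: lspanZ; rewrite -scaleN1r; apply/lspanZ/lspan_sum => i.
by apply/lspanZ/lspan_gen; exists i.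
Qed.

End Span.

(** * Inner derivations as linear operators *)

Section AdjointAction.
Variables (K : closedFieldType) (A : algType K).
Implicit Types (a b x y : A) (k l m : K).

Lemma adD a : {morph ad a : x y / x + y}.
Proof. by move=> x y; rewrite /ad mulrDr mulrDl opprD addrACA. Qed.

Lemma adZ a k x : ad a (k *: x) = k *: ad a x.
Proof. by rewrite /ad -scalerAr -scalerAl scalerBr. Qed.

Lemma ad0 a : ad a 0 = 0.
Proof. by rewrite /ad mulr0 mul0r subrr. Qed.

Lemma adB a : {morph ad a : x y / x - y}.
Proof. by move=> x y; rewrite adD -scaleN1r adZ scaleN1r. Qed.

Lemma ad_linear a : linear (ad a).
Proof. by move=> k x y; rewrite adD adZ. Qed.

Lemma C_P a b : C_ a b <-> a * b = b * a.
Proof. by rewrite /C_ /= /ad; split=> [/subr0_eq|->] //; rewrite subrr. Qed.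

Lemma C_sub_D a : C_ a `<=` D_ a.
Proof. by move=> b ab; apply: lspan_gen; exists 0; rewrite ab scale0r. Qed.

Lemma C_sub_N a : C_ a `<=` N_ a.
Proof. by move=> b ab; exists 0%N. Qed.

Lemma C_lspan a V : V `<=` C_ a -> lspan V `<=` C_ a.
Proof.
move=> VC; apply: (@lspan_ind _ _ V (C_ a)) => [|x y|k x /VC].
- exact: ad0.
- by rewrite /C_ /= adD => -> ->; rewrite addr0.
- by rewrite /C_ /= adZ => ->; rewrite scaler0.
Qed.

Lemma eigenvector_of_D a : D_ a <> C_ a ->
  exists l y, [/\ l != 0, y != 0 & ad a y = l *: y].
Proof.
move=> DC; apply: contrapT => no; apply: DC; rewrite eqEsubset; split.
  apply: C_lspan => y [l yl]; rewrite /C_ /= yl.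
  have [->|y0] := eqVneq y 0; first by rewrite scaler0.
  have [->|l0] := eqVneq l 0; first by rewrite scale0r.
  by case: no; exists l, y.
exact: C_sub_D.
Qed.

Lemma nilpotent_of_N a : N_ a <> C_ a ->
  exists x, ad a x != 0 /\ ad a (ad a x) = 0.
Proof.
move=> NC; apply: contrapT => no; apply: NC; rewrite eqEsubset.
split; last exact: C_sub_N.
move=> b [i]; elim: i b => [//|i IH] b; rewrite iterSr => /IH bC.
apply/eqP; apply: contraT => b0; case: no; exists b; split=> //.
Qed.

Lemma D_sub_F a : D_ a `<=` F_ a.
Proof.
move=> b [n [c [v [ev bE]]]]; apply: (@finite_dim_lspan _ _ _ _ v).
move=> _ [i _ <-]; elim: i => [|i IH] /=; first by apply/lspan_rangeP; exists c.
move: IH; move: (iter i _ _) => {i}.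
apply: (@lspan_ind _ _ _ (fun x => lspan (range v) (ad a x))) => [|x y|k x].
- by rewrite ad0; exact: lspan0.
- by rewrite adD; exact: lspanD.
- move=> [i _ <-]; have [l vl] := ev i.
  by rewrite adZ vl; apply/lspanZ/lspanZ/lspan_gen; exists i.
Qed.

Definition ad_endo a : endo A := mk_endo (ad_linear a).

Lemma val_ad_endo_exp a i b : val (ad_endo a ^+ i) b = iter i (ad a) b.
Proof. by elim: i => [|i IH] //; rewrite exprS /= -IH. Qed.

Lemma val_prod_ad_endo a (r : seq K) b :
  val (\prod_(z <- r) (ad_endo a - z%:A)) b =
  foldr (fun z x => ad a x - z *: x) b r.
Proof. by elim: r => [|z r IH]; rewrite ?big_nil ?big_cons //= -IH. Qed.

(** Excluding Jordan blocks of size 2 for all eigenvalues m makes ad a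
diagonalisable wherever it is locally finite. *)
Definition ad_semisimple a : Prop :=
  forall m b, let b' := ad a b - m *: b in ad a b' = m *: b' -> b' = 0.

(** On a sum of eigenspaces d = d1 + (ad a - z) d2 with d1 of eigenvalue z. If
(ad a - z) b = d, then b - d2 is in the kernel of (ad a - z)^2, so in that of
ad a - z. *)
Lemma D_of_shift a z b : ad_semisimple a ->
  D_ a (ad a b - z *: b) -> D_ a b.
Proof.
move=> ss; suff dec d : D_ a d -> exists d1 d2,
    [/\ ad a d1 = z *: d1, D_ a d2 & d = d1 + (ad a d2 - z *: d2)].
  move=> /dec[d1 [d2 [d1z Dd2 dE]]].
  have E : ad a (b - d2) - z *: (b - d2) = d1.
    rewrite adB scalerBr; move: (ad a b) (ad a d2) dE => u v uE.
    by rewrite opprD addrACA -opprD uE addrK.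
  have E0 : ad a (b - d2) - z *: (b - d2) = 0 by apply: ss; rewrite E.
  rewrite -(subrK d2 b); apply: lspanD => //; apply: lspan_gen; exists z.
  by apply/subr0_eq.
move: d; apply: lspan_ind => [|d e [d1 [d2 [? ? ->]]] [e1 [e2 [? ? ->]]]|k x].
- by exists 0, 0; rewrite ad0 !scaler0 subr0 addr0; split=> //; exact: lspan0.
- exists (d1 + e1), (d2 + e2); split.
  + by rewrite adD scalerDr; congr (_ + _).
  + exact: lspanD.
  + rewrite adD scalerDr; move: (ad a d2) (ad a e2) => u v.
    by rewrite opprD [u + v + _]addrACA [LHS]addrACA.
- move=> [l xl]; have [lz|lz] := eqVneq l z.
    exists (k *: x), 0; rewrite ad0 scaler0 subr0 addr0; split=> //.
      by rewrite adZ xl lz !scalerA mulrC.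
    exact: lspan0.
  exists 0, ((k / (l - z)) *: x); rewrite ad0 scaler0 add0r adZ xl; split=> //.
    by apply/lspanZ/lspan_gen; exists l.
  by rewrite !scalerA -scalerBl [z * _]mulrC -mulrBr divfK ?subr_eq0.
Qed.

(** A polynomial in ad a kills b; it splits into linear factors, which are removed
one by one by [D_of_shift]. *)
Lemma F_sub_D a : ad_semisimple a -> F_ a `<=` D_ a.
Proof.
move=> ss b [n Vn]; pose v (i : 'I_n.+1) := iter i (ad a) b.
have : ~ linearly_free v.
  move=> vf; suff : (n.+1 <= n)%N by rewrite ltnn.
  rewrite -{1}[n.+1]card_ord; apply: (free_card_has_dim Vn _ vf) => i.
  by apply: lspan_gen; exists i.
move=> /existsNP[c /not_implyP[cv /existsNP[k ck]]].
pose p := \poly_(i < n.+1) (if insub i is Some j then c j else 0).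
have p0 : p != 0.
  apply/eqP => /(congr1 (fun q : {poly K} => q`_k)).
  by rewrite coef_poly ltn_ord valK coef0.
have pb : val (horner_alg (ad_endo a) p) b = 0.
  rewrite -[RHS]cv /p poly_def raddf_sum /=.
  rewrite (@big_morph _ _ (fun u : endo A => val u b) 0 +%R) //.
  apply: eq_bigr => i _; rewrite linearZ /= ?mulr_algl rmorphXn /= horner_algX.
  by rewrite valK /v -val_ad_endo_exp.
have [r pE] := closed_field_poly_normal p.
have : foldr (fun z x => ad a x - z *: x) b r = 0.
  move: pb; rewrite pE linearZ /= ?mulr_algl.
  have -> : horner_alg (ad_endo a) (\prod_(z <- r) ('X - z%:P)) =
      \prod_(z <- r) (ad_endo a - z%:A).
    rewrite rmorph_prod; apply: eq_bigr => z _.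
    by rewrite rmorphB /= horner_algX horner_algC.
  rewrite val_prod_ad_endo => E.
  have {E} : lead_coef p *: foldr (fun z x => ad a x - z *: x) b r = 0 by [].
  by move=> /eqP; rewrite scaler_eq0 lead_coef_eq0 (negbTE p0) => /eqP.
elim/last_ind: r {pE} b {v cv pb Vn} => [|r z IH] b.
  by move=> /= ->; exact: lspan0.
by rewrite foldr_rcons => /IH; exact: D_of_shift.
Qed.

End AdjointAction.

(** * The Dixmier types in an algebra embedded in a division ring *)

Section DixmierTypes.
Variables (K : fieldType) (A : algType K).
Implicit Types (a b : A) (X : set A).

Definition dixmier_type (n : nat) : set A :=
  match n with
  | 0 => @strongly_nilpotent K A
  | 1 => @weakly_nilpotent K A
  | 2 => @strongly_semisimple K A
  | 3 => @weakly_semisimple K A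
  | _ => @generic K A
  end%N.

Lemma C_neqT a : ~ centre a -> C_ a <> setT.
Proof.
move=> nca aT; apply: nca => b.
have : C_ a b by rewrite aT.
by rewrite /C_ /= /ad => /subr0_eq.
Qed.

(** The types are told apart by comparing N with C and D with C, and then the larger
of the two with the whole algebra. *)
Lemma dixmier_type_inj m n a : (m < 5)%N -> (n < 5)%N ->
  dixmier_type m a -> dixmier_type n a -> m = n.
Proof.
have inv k : dixmier_type k a -> [/\ C_ a <> setT &
    match k with
    | 0 => [/\ N_ a <> C_ a, N_ a = setT & True]
    | 1 => [/\ N_ a <> C_ a, N_ a <> setT & True]
    | 2 => [/\ N_ a = C_ a, D_ a <> C_ a & D_ a = setT]
    | 3 => [/\ N_ a = C_ a, D_ a <> C_ a & D_ a <> setT]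
    | _ => [/\ N_ a = C_ a, D_ a = C_ a & True]
    end%N].
  case: k => [|[|[|[|k]]]].
  - move=> [/C_neqT ca NT DC]; split=> //; split=> //; rewrite NT => /esym//.
  - by move=> [/C_neqT ca CN NT DC]; split=> //; split=> // /esym.
  - move=> [/C_neqT ca NC DT]; split=> //; split=> //; rewrite DT => /esym//.
  - move=> [/C_neqT ca NC CD DF FT]; split=> //; split=> //; first exact/nesym.
    by rewrite DF.
  - by move=> [/C_neqT ca ND DC]; split=> //; split=> //; rewrite ND DC.
move=> m5 n5 /inv[_ hm] /inv[_ hn].
by move: m n m5 n5 hm hn => [|[|[|[|[|m]]]]] [|[|[|[|[|n]]]]] //= _ _;
  move=> [h1 h2 h3] [h4 h5 h6]; congruence.
Qed.

Lemma centralizer_kind_type X (i : 'I_5) : X !=set0 -> centralizer_kind X i ->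
  (exists2 b, X b & dixmier_type i b) /\
  (forall b, X b -> dixmier_type i b \/ generic b).
Proof.
move=> [a Xa]; case: i => -[|[|[|[|[|i]]]]] //= i5; rewrite /centralizer_kind /=.
- by move=> XT; split=> [|b /XT]; [exists a => //; exact: XT | left].
- by move=> XT; split=> [|b /XT]; [exists a => //; exact: XT | left].
- move=> [b [Tb cX cT XG]]; split.
    exists b => //; apply: cX; exists 1, 0.
    split; rewrite ?oner_neq0 ?scale1r ?addr0 // => c.
    by rewrite mul0r mulr0.
  move=> c Xc; have [/cT|nc] := pselect (scaled_coset b c); first by left.
  by right; apply: XG.
- move=> [b [Tb cX cT XG]]; split.
    exists b => //; apply: cX; exists 1, 0.
    split; rewrite ?oner_neq0 ?scale1r ?addr0 // => c.
    by rewrite mul0r mulr0.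
  move=> c Xc; have [/cT|nc] := pselect (scaled_coset b c); first by left.
  by right; apply: XG.
- by move=> XT; split=> [|b /XT]; [exists a => //; exact: XT | left].
Qed.

(** Each kind provides an element of its own type, all other elements being of that
type or generic; two different kinds would give an element of two types. *)
Lemma centralizer_kind_unique X (i k : 'I_5) : X !=set0 ->
  centralizer_kind X i -> centralizer_kind X k -> i = k.
Proof.
move=> X0 /(centralizer_kind_type X0)[[b Xb bi] Xi].
move=> /(centralizer_kind_type X0)[[c Xc ck] Xk]; apply: val_inj.
have inj m n d : (m < 5)%N -> (n < 5)%N -> dixmier_type m d ->
    dixmier_type n d -> m = n by move=> *; exact: (@dixmier_type_inj m n d).
have [bk|bg] := Xk b Xb; first exact: (inj _ _ b (ltn_ord i) (ltn_ord k)).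
have [ci|cg] := Xi c Xc; first exact: (inj _ _ c (ltn_ord i) (ltn_ord k)).
apply: etrans (inj i 4%N b (ltn_ord i) isT bi bg) _.
exact/esym/(inj k 4%N c (ltn_ord k) isT ck cg).
Qed.

End DixmierTypes.

Section EmbeddedInDivisionRing.
Variables (K : closedFieldType) (G : unitAlgType K).
Hypothesis Gdiv : forall x : G, x != 0 -> x \is a GRing.unit.
Hypothesis charK : [pchar K] =i pred0.
Hypothesis GC : commutative_centralizers G.
Variables (A : algType K) (j : {lrmorphism A -> G}).
Hypothesis jinj : injective j.
Hypothesis Acub : small_growth A.
Hypothesis Anc : noncommutative A.
Implicit Types a b c x y : A.

Lemma is_scalar_image a : is_scalar (j a) -> is_scalar a.
Proof. by move=> [k ak]; exists k; apply: jinj; rewrite ak rmorph_alg. Qed.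

Lemma subalg_commutative_centralizers : commutative_centralizers A.
Proof.
move=> a na b c ab ac; apply: jinj; rewrite !rmorphM.
have nja : ~ is_scalar (j a) by move/is_scalar_image.
by apply: (GC nja); rewrite -!rmorphM ?ab ?ac.
Qed.

Let AC := subalg_commutative_centralizers.

(** A non-scalar central element would have the whole of A as its centralizer, which
is commutative. *)
Lemma centreP a : centre a <-> is_scalar a.
Proof.
split=> [ca|[k ->] b]; last by rewrite -scalerAl -scalerAr mul1r mulr1.
by apply: contrapT => na; apply: Anc => b c; apply: (AC na).
Qed.

Lemma nscalar_image a : ~ centre a -> ~ is_scalar (j a).
Proof. by move=> na /is_scalar_image/centreP. Qed.

Lemma D_eq_C_of_N a : ~ centre a -> N_ a <> C_ a -> D_ a = C_ a.
Proof.
move=> na /nilpotent_of_N[x [x0 xx]]; apply: contrapT.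
move=> /eigenvector_of_D[l [y [l0 y0 ay]]].
apply: (@no_jordan_block _ _ Gdiv charK GC _ j jinj Acub a x y 0 l) => //.
- exact: nscalar_image.
- by rewrite scale0r subr0.
- by rewrite scale0r subr0 scale0r.
Qed.

Lemma F_eq_D a : ~ centre a -> D_ a <> C_ a -> D_ a = F_ a.
Proof.
move=> na /eigenvector_of_D[l [y [l0 y0 ay]]]; rewrite eqEsubset.
split; first exact: D_sub_F.
apply: F_sub_D => m b b' ab'; apply/eqP; apply: contraT => b'0; exfalso.
apply: (@no_jordan_block _ _ Gdiv charK GC _ j jinj Acub a b y m l) => //.
exact: nscalar_image.
Qed.

Lemma strongly_nilpotentI a : ~ centre a -> N_ a = setT -> strongly_nilpotent a.
Proof.
move=> na NT; split=> //; apply: D_eq_C_of_N => //; rewrite NT => /esym.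
exact: C_neqT.
Qed.

Lemma weakly_nilpotentI a : ~ centre a -> N_ a <> C_ a -> N_ a <> setT ->
  weakly_nilpotent a.
Proof. by move=> na NC NT; split=> //; [exact/nesym | exact: D_eq_C_of_N]. Qed.

Lemma N_eq_C_of_D a : ~ centre a -> D_ a <> C_ a -> N_ a = C_ a.
Proof. by move=> na DC; apply: contrapT => /(D_eq_C_of_N na). Qed.

Lemma strongly_semisimpleI a : ~ centre a -> D_ a = setT ->
  strongly_semisimple a.
Proof.
move=> na DT; split=> //; apply: N_eq_C_of_D => //; rewrite DT => /esym.
exact: C_neqT.
Qed.

Lemma weakly_semisimpleI a : ~ centre a -> D_ a <> C_ a -> D_ a <> setT ->
  weakly_semisimple a.
Proof.
move=> na DC DT; split=> //; [exact: N_eq_C_of_D|exact/nesym|exact: F_eq_D|].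
by rewrite -F_eq_D.
Qed.

Lemma genericI a : ~ centre a -> N_ a = C_ a -> D_ a = C_ a -> generic a.
Proof. by move=> na NC DC; split=> //; rewrite NC DC. Qed.

Lemma subalg_dixmier_partition : dixmier_partition A.
Proof.
rewrite /dixmier_partition eqEsubset; split; last first.
  by move=> a [[[[[]|[]]|[]]|[]]|[]].
move=> a na; have [NC|NC] := pselect (N_ a = C_ a); last first.
  have [NT|NT] := pselect (N_ a = setT).
    by do 4 left; exact: strongly_nilpotentI.
  by do 3 left; right; exact: weakly_nilpotentI.
have [DC|DC] := pselect (D_ a = C_ a); first by right; exact: genericI.
have [DT|DT] := pselect (D_ a = setT).
  by do 2 left; right; exact: strongly_semisimpleI.
by left; right; exact: weakly_semisimpleI.
Qed.

Lemma subalg_commutative_centralizer_condition :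
  commutative_centralizer_condition A.
Proof.
split=> // a na b c /C_P ab /C_P ac; apply: (AC _ ab ac).
by move/centreP.
Qed.

Lemma C_eq a b : ~ centre a -> ~ centre b -> C_ a b -> C_ b = C_ a.
Proof.
move=> na nb /C_P ab; rewrite eqEsubset; split=> c /C_P bc; apply/C_P.
- by apply: (AC (x := b)) => //; move/centreP.
- by apply: (AC (x := a)) => //; move/centreP.
Qed.

Lemma ad_comm a b x : a * b = b * a -> ad a (ad b x) = ad b (ad a x).
Proof.
move=> ab; rewrite /ad !mulrBr !mulrBl !mulrA ab -!mulrA ab !opprB.
by rewrite addrACA [RHS]addrACA [in RHS](addrC (- _)).
Qed.

Lemma iter_ad_comm a b n x : a * b = b * a ->
  ad a (iter n (ad b) x) = iter n (ad b) (ad a x).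
Proof. by move=> ab; elim: n => //= n <-; rewrite ad_comm. Qed.

(** Take x with ad a x nonzero in C(a) = C(b). As ad a (ad b x) = ad b (ad a x) = 0,
ad b x lies in C(a) = C(b), so x would be in N(b) = C(b) = C(a). *)
Lemma N_neq_C_transfer a b : ~ centre a -> ~ centre b -> C_ a b ->
  N_ a <> C_ a -> N_ b <> C_ b.
Proof.
move=> na nb ab /nilpotent_of_N[x [x0 xx]] NbC.
have CE := C_eq na nb ab; move/eqP: x0; apply.
have bx : ad b x = 0.
  suff : N_ b x by rewrite NbC.
  exists 1%N; suff : C_ b (ad b x) by [].
  rewrite CE /C_ /= ad_comm; last exact/C_P.
  by suff : C_ b (ad a x) by []; rewrite CE.
by suff : C_ a x by []; rewrite -CE.
Qed.

(** If ad c^(i+1) x = 0, induction applied to ad c x gives ad d^i (ad c x) = 0, that is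
ad c (ad d^i x) = 0, and C(c) = C(d). *)
Lemma N_eq a b : ~ centre a -> ~ centre b -> C_ a b -> N_ b = N_ a.
Proof.
have sub c d : ~ centre c -> ~ centre d -> C_ c d -> N_ c `<=` N_ d.
  move=> nc nd cd x [i xi]; exists i; have CE := C_eq nc nd cd.
  elim: i x xi => [x xi|i IH x].
    by suff : C_ d x by []; rewrite CE.
  rewrite iterSr => /IH; rewrite -iter_ad_comm; last exact/C_P.
  rewrite [in X in _ -> X]iterS => xi.
  by suff : C_ d (iter i.+1 (ad d) x) by []; rewrite CE.
move=> na nb ab; rewrite eqEsubset; split; apply: sub => //.
by apply/C_P/esym/C_P.
Qed.

Lemma ad_scaled_coset a b : scaled_coset a b ->
  exists2 k, k != 0 & ad b =1 fun x => k *: ad a x.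
Proof.
move=> [k [z [k0 cz ->]]]; exists k => // x.
rewrite /ad mulrDl mulrDr cz -scalerAl -scalerAr scalerBr opprD.
by rewrite addrACA subrr addr0.
Qed.

Lemma C_scaled_coset a b : scaled_coset a b -> C_ b = C_ a.
Proof.
move=> /ad_scaled_coset[k k0 ba]; rewrite eqEsubset; split=> x;
  rewrite /C_ /= ba; last by move=> ->; rewrite scaler0.
by move/eqP; rewrite scaler_eq0 (negbTE k0) => /eqP.
Qed.

Lemma D_scaled_coset a b : scaled_coset a b -> D_ b = D_ a.
Proof.
move=> /ad_scaled_coset[k k0 ba]; congr lspan; rewrite eqEsubset.
split=> x [l]; [rewrite ba => xl; exists (k^-1 * l) | move=> xl; exists (k * l)].
  by rewrite -scalerA -xl scalerA mulVf // scale1r.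
by rewrite ba xl scalerA.
Qed.

Lemma scaled_coset_centralizer a b : ~ centre a -> scaled_coset a b ->
  ~ centre b /\ C_ a b.
Proof.
move=> na ab; have CE := C_scaled_coset ab; split.
  move=> cb; apply: (C_neqT na); rewrite -CE eqEsubset; split=> // x _.
  by apply/C_P.
by rewrite -CE; apply/C_P.
Qed.

Lemma D_neq_C_scaled_coset a b : ~ centre a -> ~ centre b -> C_ a b ->
  D_ a <> C_ a -> D_ b <> C_ b -> scaled_coset a b.
Proof.
move=> na nb /C_P ab /eigenvector_of_D[l [y [l0 y0 ay]]].
move=> /eigenvector_of_D[m [w [m0 w0 bw]]].
have adE (u v : A) (n : K) : ad u v = n *: v -> u * v = v * u + n *: v.
  by move=> <-; rewrite /ad addrC subrK.
have [k [c [k0 ->]]] := @commuting_semisimple_affine _ _ Gdiv charK GC _ j jinj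
  Acub a b y w l m (nscalar_image na) (nscalar_image nb) ab y0 w0 l0 m0
  (adE _ _ _ ay) (adE _ _ _ bw).
by exists k, c%:A; split=> //; apply/centreP; exists c.
Qed.

Lemma generic_except_centralizer (T : set A) a : ~ centre a ->
  T a -> scaled_coset a `<=` T -> N_ a = C_ a -> D_ a <> C_ a ->
  generic_except T (C_ a `\` @centre K A).
Proof.
move=> na Ta cT NC DC; exists a; split=> //.
  by move=> b /(scaled_coset_centralizer na)[].
move=> b [[ab nb] ncoset]; apply: genericI => //.
  apply: contrapT => /(N_neq_C_transfer nb na); apply=> //.
  by apply/C_P/esym/C_P.
by apply: contrapT => /(D_neq_C_scaled_coset na nb ab DC).
Qed.

Lemma subalg_homogeneous_centralizer_condition :
  homogeneous_centralizer_condition A.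
Proof.
split=> //; first exact: subalg_dixmier_partition.
move=> a na; suff [i ki] : exists i, centralizer_kind (C_ a `\` @centre K A) i.
  exists i; split=> // k; apply: centralizer_kind_unique ki.
  by exists a; split=> //; apply/C_P.
have [NC|NC] := pselect (N_ a = C_ a); last first.
  have [NT|NT] := pselect (N_ a = setT).
    exists (@Ordinal 5 0 isT) => b [ab nb]; apply: strongly_nilpotentI => //.
    by rewrite (N_eq na nb ab).
  exists (@Ordinal 5 1 isT) => b [ab nb]; apply: weakly_nilpotentI => //.
    exact: N_neq_C_transfer ab NC.
  by rewrite (N_eq na nb ab).
have [[b [ab nb Db]]|noD] :=
    pselect (exists b, [/\ C_ a b, ~ centre b & D_ b <> C_ b]); last first.
  exists (@Ordinal 5 4 isT) => b [ab nb]; apply: genericI => //.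
    apply: contrapT => /(N_neq_C_transfer nb na); apply=> //.
    by apply/C_P/esym/C_P.
  by apply: contrapT => Db; apply: noD; exists b.
have Nb := N_eq_C_of_D nb Db; rewrite -(C_eq na nb ab).
have coset c : scaled_coset b c -> [/\ ~ centre c, C_ c = C_ b & D_ c = D_ b].
  move=> bc; have [nc _] := scaled_coset_centralizer nb bc.
  by rewrite (C_scaled_coset bc) (D_scaled_coset bc).
have [DT|DT] := pselect (D_ b = setT).
  exists (@Ordinal 5 2 isT).
  apply: (@generic_except_centralizer (@strongly_semisimple K A) b nb _ _ Nb Db).
    exact: strongly_semisimpleI.
  by move=> c /coset[nc _ Dc]; apply: strongly_semisimpleI; rewrite ?Dc.
exists (@Ordinal 5 3 isT).
apply: (@generic_except_centralizer (@weakly_semisimple K A) b nb _ _ Nb Db).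
  exact: weakly_semisimpleI.
by move=> c /coset[nc Cc Dc]; apply: weakly_semisimpleI; rewrite ?Dc ?Cc.
Qed.

End EmbeddedInDivisionRing.

(** * Gelfand-Kirillov dimension below three *)

Section FiniteSpan.
Variables (K : fieldType) (A : algType K).
Implicit Types V W : set A.

Definition finitely_spanned V : Prop :=
  exists (S : finType) (w : S -> A), V `<=` lspan (range w).

Lemma finitely_spanned_dim V : finitely_spanned V -> finite_dim (lspan V).
Proof. by move=> [S [w /finite_dim_lspan]]. Qed.

Lemma finitely_spanned_lspan V : finitely_spanned V -> finitely_spanned (lspan V).
Proof. by move=> [S [w Vw]]; exists S, w; exact: lspan_subset. Qed.

Lemma finitely_spanned_mul V W : finitely_spanned V -> finitely_spanned W ->
  finitely_spanned [set x | exists v w, [/\ V v, W w & x = v * w]].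
Proof.
move=> [S [v Vv]] [T [w Ww]]; exists (S * T)%type, (fun p => v p.1 * w p.2).
move=> _ [x [y [/Vv + /Ww + ->]]] => /lspan_rangeP[c ->] /lspan_rangeP[d ->].
rewrite mulr_suml; apply: lspan_sum => s; rewrite mulr_sumr.
apply: lspan_sum => t; rewrite -scalerAl -scalerAr.
by apply/lspanZ/lspanZ/lspan_gen; exists (s, t).
Qed.

Lemma finitely_spanned_bigcup n (V : nat -> set A) :
  (forall i, finitely_spanned (V i)) ->
  finitely_spanned (\bigcup_(i < n) V i).
Proof.
move=> fV; elim: n => [|n [S [w Vw]]].
  by exists 'I_0, (fun=> 0) => x [i].
have [T [u Vu]] := fV n.
exists (S + T)%type, (fun i => match i with inl s => w s | inr t => u t end).
move=> x [i /= iltn Vix]; have [ilt|ige] := ltnP i n.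
  have : (\bigcup_(i < n) V i) x by exists i.
  move=> /Vw; apply: lspan_subset => _ [s _ <-].
  by apply: lspan_gen; exists (inl s).
have {iltn ige} iE : i = n by lia.
rewrite iE in Vix; move/Vu: Vix; apply: lspan_subset => _ [t _ <-].
by apply: lspan_gen; exists (inr t).
Qed.

Lemma finitely_spanned_power V n :
  finitely_spanned V -> finitely_spanned (power_space V n).
Proof.
move=> fV; elim: n => [|n IH] /=; apply: finitely_spanned_lspan.
  by exists unit, (fun=> 1) => _ ->; apply: lspan_gen; exists tt.
exact: finitely_spanned_mul.
Qed.

Lemma finite_dim_power_sum V n :
  finitely_spanned V -> finite_dim (power_sum V n).
Proof.
move=> fV; apply: finitely_spanned_dim; apply: finitely_spanned_bigcup => i.
exact: finitely_spanned_power.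
Qed.

Lemma power_sum_word V (s : seq A) n :
  (forall x, x \in s -> V x) -> (size s <= n)%N ->
  power_sum V n (\prod_(x <- s) x).
Proof.
move=> sV sn; apply: lspan_gen; exists (size s); rewrite /= ?ltnS //.
elim: s sV {sn} => [|x s IH] sV; rewrite ?big_nil ?big_cons /=.
  exact: lspan_gen.
apply: lspan_gen; exists x, (\prod_(y <- s) y); split=> //.
  by apply: sV; rewrite mem_head.
by apply: IH => y ys; apply: sV; rewrite inE ys orbT.
Qed.

End FiniteSpan.

Section GelfandKirillov.
Variables (R : realType) (K : fieldType) (A : algType K).

(** The lower bound gives 3 ln n <= r (ln n + ln 3) for large n, while r < 3. The
maximum of r and 0 serves to multiply inequalities. *)
Lemma ln_growth_absurd (r : R) (u : nat -> nat) N : r < 3 ->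
  (forall n, (n ^ 3 <= u (3 * n))%N) ->
  (forall n, (N <= n)%N -> ln (u n)%:R / ln n%:R <= r) -> False.
Proof.
move=> r3 ulow uup.
pose r' : R := Num.max r 0.
have [n [nN n2 nl]] : exists n : nat, [/\ (N <= n)%N, (2 <= n)%N &
    r' * ln 3 < (3 - r') * ln (n%:R : R)].
  have r'3 : 0 < 3 - r' by rewrite /r' subr_gt0 gt_max r3 /=; lra.
  pose e := expR (r' * ln 3 / (3 - r')).
  have [n en] : exists n : nat, e < n%:R.
    exists (Num.bound e); exact: archi_boundP (expR_ge0 _).
  exists (maxn (maxn N 2) n.+1); split.
  - by rewrite -maxnA leq_maxl.
  - by rewrite -maxnA maxnCA leq_maxl.
  rewrite [ltRHS]mulrC -ltr_pdivrMr // -ltr_expR lnK.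
    apply: lt_le_trans en _; rewrite ler_nat.
    by apply: leq_trans (leq_maxr _ _); exact: leqnSn.
  by rewrite posrE ltr0n; apply: leq_trans (leq_maxr _ _).
have := uup (3 * n)%N; rewrite (leq_trans nN) ?leq_pmull // => /(_ isT).
have l3n : 0 < ln (3 * n)%:R :> R by rewrite ln_gt0 // ltr1n; lia.
rewrite ler_pdivrMr // => h.
have : ln (n ^ 3)%:R <= r' * ln (3 * n)%:R :> R.
  apply: le_trans (_ : r * ln (3 * n)%:R <= _).
    apply: le_trans h; rewrite ler_ln ?posrE ?ltr0n ?ler_nat ?ulow //.
      by rewrite expn_gt0; lia.
    by apply: leq_trans (ulow n); rewrite expn_gt0; lia.
  by rewrite ler_pM2r // /r' le_max lexx.
have n0 : 0 < (n%:R : R) by rewrite ltr0n; lia.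
rewrite natrX lnXn // natrM lnM ?posrE // mulrDr -[_ *+ 3]mulr_natl.
by move: nl; rewrite mulrBl; lra.
Qed.

(** Cubic growth on W bounds the dimension of the 3n-th power sum of span W below
by n^3, so the upper limit is at least 3. *)
Lemma GKdim_lt3_small_growth : (GKdim A R < 3%:E)%E -> small_growth A.
Proof.
move=> gk; apply: contrapT => /existsNP[W /forallNP WH].
pose V := lspan [set x : A | x \in W].
have fW : finitely_spanned [set x : A | x \in W].
  exists 'I_(size W), (fun i : 'I__ => nth 0 W i) => x /= xW.
  apply: lspan_gen; move: (xW); rewrite -index_mem => iW.
  by exists (Ordinal iW) => //=; rewrite nth_index.
have fV : finitely_spanned V := finitely_spanned_lspan fW.
pose u n := dimv_nat (power_sum V n).
have ulow n : (n ^ 3 <= u (3 * n))%N.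
  have /existsNP[f /not_implyP[fW3 nof]] := WH n.
  have [d Vd] := finite_dim_power_sum (3 * n) fV.
  rewrite /u (dimv_natE Vd).
  have -> : (n ^ 3 = #|{: 'I_n * 'I_n * 'I_n}|)%N.
    by rewrite !card_prod !card_ord expnSr expnS expn1.
  apply: (free_card_has_dim (v := fun s => \prod_(x <- f s) x) Vd).
    move=> s; have [sW s3] := fW3 s; apply: power_sum_word s3 => x /sW xW.
    exact: lspan_gen.
  move=> c c0 s; apply: contrapT => /eqP cs; apply: nof.
  by exists c; split=> //; exists s.
have : (limn_esup (fun n => (ln (u n)%:R / ln n%:R : R)%:E) < 3%:E)%E.
  apply: le_lt_trans gk; apply: ereal_sup_ubound; exists V => //.
  exact: finitely_spanned_dim.
move=> /ereal_inf_lt[_ [B [N _ NB] <-] sB].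
have [r r3 Br] : exists2 r : R, r < 3 & forall n, (N <= n)%N ->
    ln (u n)%:R / ln n%:R <= r.
  have Bu n : (N <= n)%N -> ((ln (u n)%:R / ln n%:R : R)%:E <=
      ereal_sup [set (ln (u n)%:R / ln n%:R : R)%:E | n in B])%E.
    by move=> nN; apply: ereal_sup_ubound; exists n => //; apply: NB.
  move: sB Bu; case: (ereal_sup _) => [r||].
  - by rewrite lte_fin => r3 Bu; exists r => // n /Bu; rewrite lee_fin.
  - by rewrite ltNge leey.
  - by move=> _ /(_ N (leqnn N)); rewrite leNgt ltNyr.
exact: (@ln_growth_absurd r u N).
Qed.

End GelfandKirillov.

(** * Rings generated inside a field *)

Section SubringTypes.
Variable E : fieldType.

Section Subring.
Variable S : subringClosed E.
Definition subring_of : predArgType := {x : E | x \in S}.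
HB.instance Definition _ := SubChoice.on subring_of.
HB.instance Definition _ := [SubChoice_isSubComNzRing of subring_of by <:].

Definition frac_pred : {pred E} :=
  fun x => `[< exists a b, [/\ a \in S, b \in S & x = a / b] >].

Lemma frac_divring : divring_closed frac_pred.
Proof.
split; first by apply/asboolP; exists 1, 1; rewrite rpred1 divr1.
  move=> _ _ /asboolP[a [b [aS bS ->]]] /asboolP[c [d [cS dS ->]]].
  apply/asboolP.
  have [->|b0] := eqVneq b 0.
    by exists (- c), d; rewrite invr0 mulr0 sub0r -mulNr rpredN.
  have [->|d0] := eqVneq d 0.
    by exists a, b; rewrite invr0 mulr0 subr0.
  exists (a * d - c * b), (b * d); split; rewrite ?rpredB ?rpredM //.
  by rewrite -[- (c / d)]mulNr addf_div // mulNr.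
move=> _ _ /asboolP[a [b [aS bS ->]]] /asboolP[c [d [cS dS ->]]].
apply/asboolP; exists (a * d), (b * c); split; rewrite ?rpredM //.
by rewrite invf_div mulf_div.
Qed.

HB.instance Definition _ := GRing.isDivringClosed.Build E frac_pred frac_divring.

Lemma sub_frac x : x \in S -> x \in frac_pred.
Proof. by move=> xS; apply/asboolP; exists x, 1; rewrite rpred1 divr1. Qed.

End Subring.

Section Subfield.
Variable S : divringClosed E.
Definition subfield_of : predArgType := {x : E | x \in S}.
HB.instance Definition _ := SubChoice.on subfield_of.
HB.instance Definition _ := [SubChoice_isSubIntegralDomain of subfield_of by <:].
HB.instance Definition _ := [SubIntegralDomain_isSubField of subfield_of by <:].
End Subfield.

Section Adjoin.
Variables (S : subringClosed E) (x : E).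
Definition adjoin_pred : {pred E} :=
  fun y => `[< exists2 p, p \is a polyOver S & y = p.[x] >].

Lemma adjoin_subring : subring_closed adjoin_pred.
Proof.
split; first by apply/asboolP; exists 1; rewrite ?hornerC ?rpred1.
  move=> _ _ /asboolP[p pS ->] /asboolP[q qS ->]; apply/asboolP.
  by exists (p - q); rewrite ?rpredB ?hornerE.
move=> _ _ /asboolP[p pS ->] /asboolP[q qS ->]; apply/asboolP.
by exists (p * q); rewrite ?rpredM ?hornerM.
Qed.

HB.instance Definition _ :=
  GRing.isSubringClosed.Build E adjoin_pred adjoin_subring.

Definition adjoin : subringClosed E := adjoin_pred.

Lemma sub_adjoin y : y \in S -> y \in adjoin.
Proof. by move=> yS; apply/asboolP; exists y%:P; rewrite ?polyOverC ?hornerC. Qed.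

Lemma adjoin_gen : x \in adjoin.
Proof. by apply/asboolP; exists 'X; rewrite ?polyOverX ?hornerX. Qed.

End Adjoin.

Definition subfrac (S : subringClosed E) : divringClosed E := frac_pred S.

(** Algebraic over the field of fractions of S: the leading coefficient is any
nonzero element of S. *)
Definition algebraic (S : subringClosed E) (x : E) : Prop :=
  exists p, [/\ p \is a polyOver S, p != 0 & root p x].

Definition integral (S : subringClosed E) (x : E) : Prop :=
  exists p, [/\ p \is a polyOver S, p \is monic & root p x].

End SubringTypes.

Section Algebraic.
Variable E : fieldType.
Implicit Types (S R : subringClosed E) (k : divringClosed E) (x y : E).

(** This moves between subrings given by predicates and ring types, for which the
closure properties of integral elements are known. *)
Lemma integral_imageP S (T : comNzRingType) (f : {rmorphism T -> E}) x :
  injective f -> (forall y, y \in S <-> exists t, y = f t) ->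
  integral S x <-> integralOver f x.
Proof.
move=> finj fS; split=> [[p [pS /monicP pm px]]|[q mq qx]].
  have /choice[g gp] : forall i, exists t, p`_i = f t.
    by move=> i; apply/fS; move/polyOverP: pS.
  have pE : p = map_poly f (\poly_(i < size p) g i).
    apply/polyP => i; rewrite coef_map coef_poly; case: ltnP => [_|pi] //=.
    by rewrite rmorph0 nth_default.
  exists (\poly_(i < size p) g i); last by rewrite -pE.
  apply/monicP/finj; rewrite rmorph1 -pm [in RHS]pE.
  by rewrite (lead_coef_map_inj finj) ?rmorph0.
exists (map_poly f q); split=> //; last exact: monic_map.
by apply/polyOverP => i; rewrite coef_map; apply/fS; exists q`_i.
Qed.

Lemma integralP S x : integral S x <-> integralOver (val : subring_of S -> E) x.
Proof.
apply: integral_imageP; first exact: val_inj.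
by move=> y; split=> [yS|[z ->]]; [exists (Sub y yS)|exact: valP].
Qed.

Lemma integral_fieldP k x : integral k x <-> integralOver (val : subfield_of k -> E) x.
Proof.
apply: integral_imageP; first exact: val_inj.
by move=> y; split=> [yS|[z ->]]; [exists (Sub y yS)|exact: valP].
Qed.

Lemma integral_sub_ring S x : x \in S -> integral S x.
Proof.
move=> xS; apply/integralP; exact: (integral_id _ (Sub x xS : subring_of S)).
Qed.

Lemma integralD S x y : integral S x -> integral S y -> integral S (x + y).
Proof. by move=> /integralP xi /integralP yi; apply/integralP/integral_add. Qed.

Lemma integralM S x y : integral S x -> integral S y -> integral S (x * y).
Proof. by move=> /integralP xi /integralP yi; apply/integralP/integral_mul. Qed.

Lemma integralX S x n : integral S x -> integral S (x ^+ n).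
Proof.
move=> xi; elim: n => [|n IH]; last by rewrite exprS; exact: integralM.
by rewrite expr0; apply: integral_sub_ring; exact: rpred1.
Qed.

Lemma integral_polyOver S (p : {poly E}) x :
  p \is a polyOver S -> integral S x -> integral S p.[x].
Proof.
move=> /polyOverP pS xi; rewrite horner_coef; elim/big_rec: _ => [|i y _].
  by apply: integral_sub_ring; exact: rpred0.
by apply: integralD; apply: integralM; [exact: integral_sub_ring|exact: integralX].
Qed.

Lemma algebraic_integral_field k x : algebraic k x -> integral k x.
Proof.
move=> [p [pk p0 px]]; exists ((lead_coef p)^-1 *: p); split.
- apply/polyOverP => i; rewrite coefZ rpredM ?rpredV //.
    by apply/polyOverP.
  by move/polyOverP: pk.
- by rewrite monicE lead_coefZ mulVf ?lead_coef_eq0.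
- by rewrite rootE hornerZ (rootP px) mulr0.
Qed.

Lemma common_denominator S (p : {poly E}) : p \is a polyOver (subfrac S) ->
  exists2 d, d \in S & d != 0 /\ d *: p \is a polyOver S.
Proof.
elim/poly_ind: p => [|p c IH] pS.
  by exists 1; rewrite ?rpred1 // oner_neq0 scaler0 rpred0.
have pE i : p`_i = (p * 'X + c%:P)`_i.+1 by rewrite coefD coefMX coefC addr0.
have cE : c = (p * 'X + c%:P)`_0 by rewrite coefD coefMX coefC add0r.
have [d dS [d0 dp]] : exists2 d, d \in S & d != 0 /\ d *: p \is a polyOver S.
  by apply: IH; apply/polyOverP => i; rewrite pE; move/polyOverP: pS.
have /asboolP[a [b [aS bS cab]]] : c \in frac_pred S.
  by rewrite cE; move/polyOverP: pS; apply.
have [b0|b0] := eqVneq b 0.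
  exists d => //; split=> //; move: cab; rewrite b0 invr0 mulr0 => ->.
  by rewrite addr0 scalerAl rpredM ?polyOverX.
exists (d * b); rewrite ?rpredM //; split; first by rewrite mulf_neq0.
rewrite scalerDr scalerAl rpredD //.
  rewrite rpredM ?polyOverX // mulrC -scalerA; apply/polyOverP => i.
  by rewrite coefZ rpredM //; move/polyOverP: dp.
by rewrite -mul_polyC -polyCM polyOverC cab mulrA [d * b * a]mulrAC mulfK // rpredM.
Qed.

Lemma algebraicP S x : algebraic S x <-> integral (subfrac S) x.
Proof.
split=> [[p [pS p0 px]]|[p [pS pm px]]].
  apply: algebraic_integral_field; exists p; split=> //.
  by apply: polyOverS pS => y; exact: sub_frac.
have [d dS [d0 dp]] := common_denominator pS; exists (d *: p); split=> //.
  by rewrite scaler_eq0 negb_or d0 monic_neq0.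
by rewrite rootE hornerZ (rootP px) mulr0.
Qed.

Lemma algebraicV S x : algebraic S x -> algebraic S x^-1.
Proof.
move=> /algebraicP/integral_fieldP/integral_inv xi.
exact/algebraicP/integral_fieldP.
Qed.

Lemma algebraicM S x y : algebraic S x -> algebraic S y -> algebraic S (x * y).
Proof.
by move=> /algebraicP xi /algebraicP yi; apply/algebraicP; exact: integralM.
Qed.

Lemma algebraicD S x y : algebraic S x -> algebraic S y -> algebraic S (x + y).
Proof.
by move=> /algebraicP xi /algebraicP yi; apply/algebraicP; exact: integralD.
Qed.

Lemma algebraic_sub_ring S x : x \in S -> algebraic S x.
Proof.
by move=> xS; apply/algebraicP/integral_sub_ring/asboolP; exists x, 1;
  rewrite rpred1 divr1.
Qed.

Lemma algebraicS S R x : {subset S <= R} -> algebraic S x -> algebraic R x.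
Proof.
by move=> SR [p [pS p0 px]]; exists p; split=> //; apply: polyOverS pS.
Qed.

Lemma algebraic_horner S (p : {poly E}) x :
  p \is a polyOver S -> algebraic S x -> algebraic S p.[x].
Proof.
move=> pS /algebraicP xi; apply/algebraicP/integral_polyOver => //.
by apply: polyOverS pS => y; exact: sub_frac.
Qed.

Lemma algebraic_trans S x y :
  algebraic S x -> algebraic (adjoin S x) y -> algebraic S y.
Proof.
move=> xa [p [pS p0 py]]; apply/algebraicP/integral_fieldP.
apply: (integral_root p0 py) => _ /(nthP 0)[i _ <-].
have /polyOverP/(_ i)/asboolP[q qS ->] := pS.
exact/integral_fieldP/algebraicP/algebraic_horner.
Qed.

(** R is a Goldman domain, that is, its field of fractions is R[1/f]. *)
Definition goldman R : Prop :=
  exists2 f, f \in R & f != 0 /\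
  forall c, c \in R -> c != 0 -> exists N y, y \in R /\ f ^+ N = c * y.

(** If x were transcendental, R[x] would be a polynomial ring in which some power of g
is divisible by 1 + X g, a polynomial coprime to g. *)
Lemma goldman_algebraic R x : goldman (adjoin R x) -> algebraic R x.
Proof.
move=> [_ /asboolP[g gR ->] [g0 H]]; apply: contrapT => nalg.
have root0 p : p \is a polyOver R -> p.[x] = 0 -> p = 0.
  move=> pR px; apply/eqP; apply: contrapT => /negP p0; apply: nalg.
  by exists p; split=> //; apply/rootP.
have gN : g != 0 by apply: contraNneq g0 => ->; rewrite horner0.
pose w := 1 + 'X * g.
have wR : w \is a polyOver R by rewrite rpredD ?rpred1 ?rpredM ?polyOverX.
have sw : (1 < size w)%N.
  have sX : size ('X * g) = (size g).+1 by rewrite mulrC size_mulX.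
  by rewrite /w addrC size_polyDl sX ?size_poly1 ltnS lt0n size_poly_eq0.
have w0 : w.[x] != 0.
  by apply/eqP => /(root0 _ wR) w0; move: sw; rewrite w0 size_poly0.
have [|N [_ [/asboolP[h hR ->] E0]]] := H w.[x] _ w0.
  by apply/asboolP; exists w.
have gw : g ^+ N = w * h.
  apply/subr0_eq/root0; first by rewrite rpredB ?rpredX ?rpredM.
  by rewrite hornerD hornerN hornerM horner_exp E0 subrr.
have : coprimep w (g ^+ N).
  apply: coprimep_expr; apply/Bezout_coprimepP; exists (1, - 'X) => /=.
  by rewrite mul1r mulNr /w addrK eqpxx.
by rewrite gw coprimepMr coprimepp => /andP[/eqP sw1 _]; rewrite sw1 in sw.
Qed.

(** With r and s the leading coefficients of algebraic equations of x and 1/f, the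
elements x and 1/f are integral over R' = R[1/(r s)]. For nonzero c in R, c^-1 is
y / f^N with y in R[x], so it is integral over R', and then it lies in R'
because c does. Hence r s witnesses that R is a Goldman domain. *)
Lemma goldman_descent R x : goldman (adjoin R x) -> algebraic R x -> goldman R.
Proof.
move=> [f fR [f0 H]] xa.
have fa : algebraic R f^-1.
  by apply: algebraicV; move/asboolP: fR => [p pR ->]; exact: algebraic_horner.
move: xa (fa) => [p [pR p0 px]] [q [qR q0 qf]].
have rR : lead_coef p \in R by rewrite lead_coefE; move/polyOverP: pR.
have sR : lead_coef q \in R by rewrite lead_coefE; move/polyOverP: qR.
have r0 : lead_coef p != 0 by rewrite lead_coef_eq0.
have s0 : lead_coef q != 0 by rewrite lead_coef_eq0.
pose g := lead_coef p * lead_coef q.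
have g0 : g != 0 by rewrite mulf_neq0.
exists g; first by rewrite rpredM.
split=> // c cR c0; pose R' := adjoin R g^-1.
have RR' : {subset R <= R'} by move=> y; exact: sub_adjoin.
have invR' d e : e \in R -> g = d * e -> d^-1 \in R'.
  move=> eR gE; have d0 : d != 0 by apply: contraNneq g0 => d0; rewrite gE d0 mul0r.
  have e0 : e != 0 by apply: contraNneq g0 => e0; rewrite gE e0 mulr0.
  have -> : d^-1 = e * g^-1 by rewrite gE invfM mulrCA mulfV // mulr1.
  by apply: rpredM; [exact: RR' | exact: adjoin_gen].
have monic_int u z : u \is a polyOver R -> u != 0 -> root u z ->
    (lead_coef u)^-1 \in R' -> integral R' z.
  move=> uR u0 uz lu; exists ((lead_coef u)^-1 *: u); split.
  - apply/polyOverP => i; rewrite coefZ rpredM // RR' //.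
    by move/polyOverP: uR.
  - by rewrite monicE lead_coefZ mulVf ?lead_coef_eq0.
  - by rewrite rootE hornerZ (rootP uz) mulr0.
have xi : integral R' x.
  by apply: (monic_int p) => //; exact: (invR' _ (lead_coef q)).
have fi : integral R' f^-1.
  by apply: (monic_int q) => //; apply: (invR' _ (lead_coef p)); rewrite // mulrC.
have [N [y [/asboolP[h hR yh] fE]]] := H c (sub_adjoin x cR) c0.
have ci : integral R' c^-1.
  have -> : c^-1 = y * f^-1 ^+ N.
    rewrite exprVn fE invfM mulrCA mulfV ?mulr1 //.
    by apply: contraNneq (expf_neq0 N f0) => y0; rewrite fE y0 mulr0.
  apply: integralM (integralX _ fi); rewrite yh; apply: integral_polyOver => //.
  by apply: polyOverS hR.
have : c^-1 \in R'.
  move: ci => [u [uR' um uc]].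
  have : u.[c^-1] = 0 by apply/rootP.
  have su : (1 < size u)%N by exact: root_size_gt1 (monic_neq0 um) uc.
  have [n usz] : exists n, size u = n.+2.
    by case: (size u) su => [|[|n]] // _; exists n.
  rewrite horner_coef usz big_ord_recr /=.
  have -> : u`_n.+1 = 1.
    by move/monicP: um; rewrite /lead_coef usz.
  rewrite mul1r => /eqP; rewrite addrC addr_eq0 => /eqP.
  move=> /(congr1 (fun z => z * c ^+ n)).
  rewrite exprS -mulrA exprVn mulVf ?expf_neq0 // mulr1 => ->.
  rewrite mulNr rpredN mulr_suml rpred_sum // => i _.
  rewrite exprVn -mulrA rpredM //; first by move/polyOverP: uR'.
  apply: RR'; have il : (i <= n)%N by rewrite -ltnS.
  have -> : c ^+ n = c ^+ (n - i) * c ^+ i by rewrite -exprD subnK.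
  by rewrite mulrCA mulVf ?expf_neq0 // mulr1 rpredX.
move=> /asboolP[v vR cv]; exists (size v).
exists (\sum_(i < size v) v`_i * g ^+ (size v - i)); split.
  rewrite rpred_sum // => i _; rewrite rpredM ?rpredX ?rpredM //.
  by move/polyOverP: vR.
apply: (mulfI (invr_neq0 c0)); rewrite mulKf // cv horner_coef mulr_suml.
apply: eq_bigr => i _; rewrite -mulrA; congr (_ * _); rewrite exprVn.
have -> : g ^+ size v = g ^+ (size v - i) * g ^+ i.
  by rewrite -exprD subnK // ltnW.
by rewrite mulrCA mulVf ?expf_neq0 ?mulr1.
Qed.

Definition adjoins R (s : seq E) : subringClosed E := foldl (@adjoin E) R s.

(** Zariski's lemma in the form of Goldman: if R[s] is a Goldman domain, the property
descends along the generators, each of which is algebraic. *)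
Lemma zariski R (s : seq E) : goldman (adjoins R s) ->
  forall x, x \in s -> algebraic R x.
Proof.
move=> gs; suff [_ H] : goldman R /\ {in s, forall x, algebraic R x} by [].
elim: s R gs => [|x s IH] R gs; first by split.
have [gx sx] := IH _ gs; have xa := goldman_algebraic gx.
split; first exact: goldman_descent xa.
move=> y; rewrite inE => /orP[/eqP -> //|/sx]; exact: algebraic_trans.
Qed.

Lemma adjoins_base R s : {subset R <= adjoins R s}.
Proof.
elim: s R => [|y s IH] R z zR //=; apply: IH; exact: sub_adjoin.
Qed.

Lemma adjoins_gen R s : {subset s <= adjoins R s}.
Proof.
elim: s R => [|y s IH] R z //=; rewrite inE => /orP[/eqP ->|/IH //].
by apply: adjoins_base; exact: adjoin_gen.
Qed.

Lemma adjoins_min R s (B : subringClosed E) :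
  {subset R <= B} -> {subset s <= B} -> {subset adjoins R s <= B}.
Proof.
elim: s R => [|y s IH] R RB sB //=; apply: IH; last first.
  by move=> z zs; apply: sB; rewrite inE zs orbT.
move=> _ /asboolP[p pR ->]; rewrite horner_coef rpred_sum // => i _.
apply: rpredM; first by apply: RB; move/polyOverP: pR.
by apply/rpredX/sB/mem_head.
Qed.

End Algebraic.

(** * Prime ideals and residue fields *)

Section PrimeAvoidance.
Variable R : comNzRingType.

Definition is_ideal (J : set R) : Prop :=
  [/\ J 0, forall x y, J x -> J y -> J (x + y) & forall a x, J x -> J (a * x)].

Section PrimeOf.
Variables (J : set R) (Jid : is_ideal J) (J1 : ~ J 1)
  (Jprime : forall x y, J (x * y) -> J x \/ J y).

Definition set_pred : {pred R} := fun x => `[< J x >].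

Lemma set_pred_ideal : idealr_closed set_pred.
Proof.
have [J0 JD JM] := Jid; split; first exact/asboolP.
  by apply/negP => /asboolP.
by move=> a u v /asboolP uJ /asboolP vJ; apply/asboolP/JD => //; exact: JM.
Qed.

Lemma set_pred_prime : prime_idealr_closed set_pred.
Proof.
by move=> x y /asboolP/Jprime[] h; apply/orP; [left|right]; exact/asboolP.
Qed.

Let f : {pred R} := set_pred.
HB.instance Definition _ := isIdealr.Build R f set_pred_ideal.
HB.instance Definition _ := isPrimeIdealrClosed.Build R f set_pred_prime.
Definition prime_of : prime_idealr R := f.

Lemma in_prime_of x : x \in prime_of <-> J x.
Proof. by split=> [/asboolP|Jx] //; apply/asboolP. Qed.
End PrimeOf.

(** An ideal maximal among those containing I and disjoint from the multiplicative
set S is prime. *)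
Lemma prime_avoiding (I S : set R) : is_ideal I -> S 1 ->
  (forall x y, S x -> S y -> S (x * y)) -> (forall x, I x -> ~ S x) ->
  exists p : prime_idealr R,
    (forall x, I x -> x \in p) /\ (forall x, S x -> x \notin p).
Proof.
move=> Iid S1 SM IS.
pose good (J : set R) := [/\ is_ideal J, I `<=` J & forall x, J x -> ~ S x].
(* The empty set is admitted as the union of the empty chain. *)
have [|A [Agood Amax]] := @Zorn_bigcup R (fun J => J = set0 \/ good J).
  move=> F FP Ftot.
  have [[X0 [FX0 X0g]]|noX] := pselect (exists X, F X /\ good X); last first.
    left; rewrite -subset0 => x [X FX Xx]; have [X0|Xg] := FP X FX.
      by rewrite X0 in Xx.
    by case: noX; exists X.
  have [[X00 X0D X0M] IX0 X0S] := X0g.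
  have Fgood X x : F X -> X x -> good X.
    by move=> FX Xx; have [X0E|] := FP X FX; first by rewrite X0E in Xx.
  right; split.
  - split; first by exists X0.
      move=> x y [X FX Xx] [Y FY Yy].
      have [[_ XD _] _ _] := Fgood X x FX Xx.
      have [[_ YD _] _ _] := Fgood Y y FY Yy.
      have [XY|YX] := Ftot X Y FX FY.
        by exists Y => //; apply: YD => //; exact: XY.
      by exists X => //; apply: XD => //; exact: YX.
    move=> a x [X FX Xx]; exists X => //.
    by have [[_ _ XM] _ _] := Fgood X x FX Xx; exact: XM.
  - by move=> x /IX0 X0x; exists X0.
  - by move=> x [X FX Xx]; have [_ _] := Fgood X x FX Xx; apply.
have I0 : I 0 by case: Iid.
have {Agood}[Aid IA AS] : good A.
  case: Agood => // A0; exfalso; apply: (Amax I); last by right; split.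
  by rewrite A0; split=> // /(_ 0 I0).
have [A0 AD AM] := Aid.
have ext x : ~ A x -> exists a s, [/\ A a, S s & exists b, s = a + b * x].
  move=> nAx; apply: contrapT => no.
  pose B := [set y | exists a b, A a /\ y = a + b * x].
  apply: (Amax B); last first.
    right; split.
    - split; first by exists 0, 0; rewrite mul0r addr0.
        move=> _ _ [a [b [Aa ->]]] [c [d [Ac ->]]].
        by exists (a + c), (b + d); rewrite mulrDl addrACA; split=> //; exact: AD.
      move=> e _ [a [b [Aa ->]]]; exists (e * a), (e * b).
      by rewrite mulrDr mulrA; split=> //; exact: AM.
    - by move=> y /IA Ay; exists y, 0; rewrite mul0r addr0.
    - by move=> y [a [b [Aa yE]]] Sy; apply: no; exists a, y; split=> //; exists b.
  split; first by move=> y Ay; exists y, 0; rewrite mul0r addr0.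
  by move=> BA; apply/nAx/BA; exists 0, 1; rewrite add0r mul1r.
have A1 : ~ A 1 by move=> /AS.
have Aprime x y : A (x * y) -> A x \/ A y.
  move=> Axy; apply: contrapT => /not_orP[/ext[a [s [Aa Ss [b sE]]]]].
  move=> /ext[c [u [Ac Su [d uE]]]]; apply: (AS _ _ (SM _ _ Ss Su)).
  rewrite sE uE mulrDl !mulrDr; apply: (AD); apply: (AD).
  - exact: AM.
  - by rewrite mulrC; exact: AM.
  - exact: AM.
  - by rewrite mulrACA; exact: AM.
exists (prime_of Aid A1 Aprime); split=> x.
  by move=> /IA Ax; exact/in_prime_of.
by move=> Sx; apply/negP => /in_prime_of /AS.
Qed.

(** Indexing the quotient by the proof that p is maximal lets its field structure be
inferred. *)
Definition quotient_by (p : prime_idealr R)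
    (inv : forall y : R, y \notin p -> exists z, 1 - z * y \in p) : Type :=
  {ideal_quot p}.

Section QuotientField.
Variables (p : prime_idealr R)
  (inv : forall y : R, y \notin p -> exists z, 1 - z * y \in p).
Local Notation Q := (quotient_by inv).
Local Open Scope quotient_scope.
HB.instance Definition _ := GRing.ComNzRing.on Q.

Lemma quotient_inverse : exists i : Q -> Q,
  (forall x, x != 0 -> i x * x = 1) /\ i 0 = 0.
Proof.
have H (x : Q) : exists y : Q, (x != 0 -> y * x = 1) /\ (x = 0 -> y = 0).
  have [->|x0] := eqVneq x 0; first by exists 0.
  have : repr x \notin p.
    apply: contra x0 => xp; rewrite -[x]reprK.
    by rewrite piE Quotient.equivE subr0.
  move=> /inv[z zx]; exists (\pi_{ideal_quot p} z); split=> [_|x00]; last by rewrite x00 eqxx in x0.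
  rewrite -{1}[x]reprK; apply/eqP; rewrite eq_sym !piE Quotient.equivE.
  exact: zx.
have [i iP] := choice H; exists i; split; first by move=> x; have [] := iP x.
by have [_] := iP 0; apply.
Qed.

Definition quotient_inv : Q -> Q := projT1 (cid quotient_inverse).
Lemma quotient_mulVf x : x != 0 -> quotient_inv x * x = 1.
Proof. exact: (projT2 (cid quotient_inverse)).1. Qed.
Lemma quotient_inv0 : quotient_inv 0 = 0.
Proof. exact: (projT2 (cid quotient_inverse)).2. Qed.
HB.instance Definition _ :=
  GRing.ComNzRing_isField.Build Q quotient_mulVf quotient_inv0.

Definition quotient_field : fieldType := Q.

Definition quotient_map (x : R) : quotient_field := \pi_{ideal_quot p} x.

Lemma quotient_map_zmod : zmod_morphism quotient_map.
Proof. exact: (rmorphB (\pi_{ideal_quot p})). Qed.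

Lemma quotient_map_monoid : monoid_morphism quotient_map.
Proof.
by split; [exact: (rmorph1 (\pi_{ideal_quot p}))|exact: (rmorphM (\pi_{ideal_quot p}))].
Qed.

HB.instance Definition _ :=
  GRing.isZmodMorphism.Build R quotient_field quotient_map quotient_map_zmod.
HB.instance Definition _ :=
  GRing.isMonoidMorphism.Build R quotient_field quotient_map quotient_map_monoid.

Lemma quotient_map_eq0 x : quotient_map x = 0 <-> x \in p.
Proof.
have pi0 : \pi_{ideal_quot p} 0 = 0 :> {ideal_quot p} by exact: rmorph0.
rewrite -[x in x \in p]subr0 Quotient.idealrBE; split=> [h|/eqP h].
  by apply/eqP; rewrite pi0.
by rewrite -[RHS]pi0.
Qed.

Lemma quotient_map_surj (y : quotient_field) : exists x, y = quotient_map x.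
Proof. by exists (repr y); rewrite /quotient_map reprK. Qed.

End QuotientField.
End PrimeAvoidance.

(** * Algebraic functions on a curve *)

Section ImageField.
Variables (K E : fieldType) (f : {rmorphism K -> E}).

Definition image_pred : {pred E} := fun x => `[< exists k, x = f k >].

Lemma image_divring : divring_closed image_pred.
Proof.
split; first by apply/asboolP; exists 1; rewrite rmorph1.
  move=> _ _ /asboolP[k ->] /asboolP[l ->]; apply/asboolP; exists (k - l).
  by rewrite rmorphB.
move=> _ _ /asboolP[k ->] /asboolP[l ->]; apply/asboolP; exists (k / l).
by rewrite fmorph_div.
Qed.

HB.instance Definition _ := GRing.isDivringClosed.Build E image_pred image_divring.

Definition image_field : divringClosed E := image_pred.

Lemma image_fieldP x : x \in image_field <-> exists k, x = f k.
Proof. by split=> [/asboolP|h] //; apply/asboolP. Qed.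

Lemma polyOver_imageP (p : {poly E}) :
  p \is a polyOver image_field <-> exists q : {poly K}, p = map_poly f q.
Proof.
split=> [/polyOverP pK|[q ->]]; last first.
  by apply/polyOverP => i; rewrite coef_map; apply/image_fieldP; exists q`_i.
have /choice[g gp] : forall i, exists k, p`_i = f k.
  by move=> i; apply/image_fieldP.
exists (\poly_(i < size p) g i); apply/polyP => i; rewrite coef_map coef_poly.
by case: ltnP => [_|pi] //=; rewrite rmorph0 nth_default.
Qed.

Lemma adjoin_imageP x y : y \in adjoin image_field x <->
  exists p : {poly K}, y = (map_poly f p).[x].
Proof.
split=> [/asboolP[p /polyOver_imageP[q ->] ->]|[p ->]]; first by exists q.
by apply/asboolP; exists (map_poly f p) => //; apply/polyOver_imageP; exists p.
Qed.

End ImageField.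

(** The equation has coefficients in the image of an algebraically closed field, so it
splits there. *)
Lemma algebraic_over_closed (K : closedFieldType) (E : fieldType)
    (f : {rmorphism K -> E}) x :
  algebraic (image_field f) x -> exists k, x = f k.
Proof.
move=> [_ [/polyOver_imageP[p ->]]]; rewrite map_poly_eq0 => p0.
have [r pE] := closed_field_poly_normal p.
rewrite pE linearZ /= rootZ ?fmorph_eq0 ?lead_coef_eq0 //.
elim: r {pE} => [|z r IH].
  by rewrite big_nil rmorph1 rootE hornerC oner_eq0.
rewrite big_cons rmorphM rootM /= => /orP[|/IH //].
by rewrite rmorphB /= map_polyX map_polyC /= root_XsubC => /eqP ->; exists z.
Qed.

Section Generators.
Variables (K : fieldType) (O : algType K) (P : O -> Prop).
Hypotheses (P1 : P 1) (Plin : forall k x y, P x -> P y -> P (k *: x + y)).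
Hypothesis Pmul : forall x y, P x -> P y -> P (x * y).

Definition holds_pred : {pred O} := fun x => `[< P x >].

Lemma holds_subalg : subalg_closed holds_pred.
Proof.
split; first exact/asboolP.
  by move=> k x y /asboolP xP /asboolP yP; apply/asboolP/Plin.
by move=> x y /asboolP xP /asboolP yP; apply/asboolP/Pmul.
Qed.

Let Q : {pred O} := holds_pred.
HB.instance Definition _ := GRing.isSubalgClosed.Build K O Q
  (GRing.subalg_closed_semi holds_subalg).

(** Induction on generators: the elements with property P form a subalgebra. *)
Lemma subalg_holds n (g : 'I_n -> O) :
  (forall S : subalgClosed O, (forall i, g i \in S) -> forall x, x \in S) ->
  (forall i, P (g i)) -> forall x, P x.
Proof.
by move=> gen gP x; apply/asboolP; apply: (gen Q) => i; apply/asboolP.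
Qed.
End Generators.

Lemma invf_clear (E : fieldType) (a c d : E) :
  a != 0 -> c != 0 -> d != 0 -> c^-1 = d * a * (d * c * a)^-1.
Proof. by move=> a0 c0 d0; field; rewrite a0 c0 d0. Qed.

(** The function field is an arbitrary field F with an embedding phi of O; every
computation with fractions takes place in F. *)
Section CurveDimension.
Variables (K : closedFieldType) (O : idomainAlgType K).
Hypothesis fgO : finitely_generated O.
Variables (F : fieldType) (phi : {rmorphism O -> F}).
Hypothesis phi_inj : injective phi.

Definition frac_scalar : {rmorphism K -> F} := phi \o in_alg O.

Lemma phi_eq0 x : (phi x == 0) = (x == 0).
Proof. by rewrite -(inj_eq phi_inj) rmorph0. Qed.

Lemma phi_horner_alg (t : O) (p : {poly K}) :
  phi (horner_alg t p) = (map_poly frac_scalar p).[phi t].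
Proof.
elim/poly_ind: p => [|p c IH]; first by rewrite !rmorph0 horner0.
rewrite !rmorphD !rmorphM /= horner_algX horner_algC map_polyX map_polyC.
by rewrite !hornerE -IH.
Qed.

Definition curve_subring (t : O) : subringClosed F :=
  adjoin (image_field frac_scalar) (phi t).

Lemma curve_subringP (t : O) y :
  y \in curve_subring t <-> exists p, y = phi (horner_alg t p).
Proof.
split=> [/adjoin_imageP[p ->]|[p ->]]; last apply/adjoin_imageP; exists p;
  by rewrite phi_horner_alg.
Qed.

(** Weak Nullstellensatz: the residue field is a finitely generated algebra, hence
algebraic over K by [zariski], hence equal to K. *)
Lemma field_quotient_scalar (p : prime_idealr O) :
  (forall y : O, y \notin p -> exists z, 1 - z * y \in p) ->
  forall x : O, exists k : K, x - k%:A \in p.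
Proof.
move=> inv x; pose q : {rmorphism O -> quotient_field inv} := quotient_map inv.
pose f : {rmorphism K -> quotient_field inv} := q \o in_alg O.
have [n [g gen]] := fgO; pose s := [seq q (g i) | i <- enum 'I_n].
have inA y : q y \in adjoins (image_field f) s.
  apply: (@subalg_holds K O (fun y => q y \in adjoins (image_field f) s) _ _ _ n g gen).
  - by rewrite rmorph1 rpred1.
  - move=> k u v uA vA; rewrite -[k *: u]mulr_algl rmorphD rmorphM rpredD //.
    rewrite rpredM //; apply: adjoins_base; apply/image_fieldP.
    by exists k.
  - by move=> u v uA vA; rewrite rmorphM rpredM.
  - by move=> i; apply/adjoins_gen/mapP; exists i; rewrite ?mem_enum.
have gs : goldman (adjoins (image_field f) s).
  exists 1; first exact: rpred1.
  split=> [|c _ c0]; first exact: oner_neq0.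
  have [y yE] := quotient_map_surj (c^-1).
  by exists 1%N, c^-1; rewrite expr1n mulfV // yE; split=> //; exact: inA.
have qx y : exists k, q y = f k.
  apply: (@subalg_holds K O (fun y => exists k, q y = f k) _ _ _ n g gen).
  - by exists 1; rewrite !rmorph1.
  - move=> k u v [a ua] [b vb]; exists (k * a + b).
    by rewrite -[k *: u]mulr_algl !rmorphD !rmorphM /= -/q ua vb.
  - by move=> u v [a ua] [b vb]; exists (a * b); rewrite !rmorphM ua vb.
  - move=> i; apply/algebraic_over_closed/(zariski gs)/mapP.
    by exists i; rewrite ?mem_enum.
have [k xk] := qx x; exists k; apply/(quotient_map_eq0 inv).
suff : q (x - k%:A) = 0 by [].
by rewrite rmorphB xk subrr.
Qed.

(** Elements with a denominator in K[t]. *)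
Definition cleared_pred (t : O) : {pred F} := fun x =>
  `[< exists d y, [/\ d \in curve_subring t, d != 0 & d * x = phi y] >].

Lemma cleared_subring t : subring_closed (cleared_pred t).
Proof.
have tK d : d \in curve_subring t -> exists z, d = phi z.
  by move=> /curve_subringP[p ->]; exists (horner_alg t p).
split.
- apply/asboolP; exists 1, 1; rewrite rpred1 oner_neq0 mulr1 rmorph1.
  by split.
- move=> u v /asboolP[d [y [dR d0 dy]]] /asboolP[e [z [eR e0 ez]]].
  have [[d' dE] [e' eE]] := (tK d dR, tK e eR).
  apply/asboolP; exists (d * e), (e' * y - d' * z).
  split; [exact: rpredM | exact: mulf_neq0 |].
  rewrite rmorphB !rmorphM -dy -ez -dE -eE; ring.
- move=> u v /asboolP[d [y [dR d0 dy]]] /asboolP[e [z [eR e0 ez]]].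
  apply/asboolP; exists (d * e), (y * z).
  split; [exact: rpredM | exact: mulf_neq0 |].
  by rewrite rmorphM -dy -ez; ring.
Qed.

HB.instance Definition _ t :=
  GRing.isSubringClosed.Build F (cleared_pred t) (cleared_subring t).

(** If every nonzero c in O divides a nonzero element of K[t], then O over K(t) is
already a field: it is closed under inverses. Zariski's lemma then makes its
generators algebraic over K(t). *)
Lemma algebraic_of_divisors (t : O) :
  (forall c : O, c != 0 -> exists a p, c * a = horner_alg t p /\ c * a != 0) ->
  forall x : O, algebraic (curve_subring t) (phi x).
Proof.
move=> div; pose R := curve_subring t; pose k := subfrac R.
have [n [g gen]] := fgO; pose s := [seq phi (g i) | i <- enum 'I_n].
pose S := adjoins k s.
have kS : {subset k <= S} by exact: adjoins_base.
have RS : {subset R <= S}.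
  by move=> y yR; apply/kS/asboolP; exists y, 1; rewrite rpred1 divr1.
have inS y : phi y \in S.
  apply: (@subalg_holds K O (fun y => phi y \in S) _ _ _ n g gen).
  - by rewrite rmorph1 rpred1.
  - move=> a u v uA vA; rewrite -[a *: u]mulr_algl rmorphD rmorphM rpredD //.
    rewrite rpredM //; apply: RS; apply/curve_subringP; exists a%:P.
    by rewrite horner_algC.
  - by move=> u v uA vA; rewrite rmorphM rpredM.
  - by move=> i; apply/adjoins_gen/mapP; exists i; rewrite ?mem_enum.
have SB : {subset S <= (cleared_pred t : subringClosed F)}.
  apply: adjoins_min.
    move=> _ /asboolP[a [b [aR bR ->]]]; apply/asboolP.
    have [->|b0] := eqVneq b 0.
      by exists 1, 0; rewrite rpred1 oner_neq0 invr0 !mulr0 rmorph0.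
    move/curve_subringP: (aR) => [p aE].
    exists b, (horner_alg t p); rewrite bR b0 -aE; split=> //.
    by rewrite mulrCA mulfV // mulr1.
  move=> _ /mapP[i _ ->]; apply/asboolP; exists 1, (g i).
  by rewrite rpred1 oner_neq0 mul1r.
have gs : goldman S.
  exists 1; first exact: rpred1.
  split=> [|c cS c0]; first exact: oner_neq0.
  exists 1%N, c^-1; rewrite expr1n mulfV //; split=> //.
  have /asboolP[d [y [dR d0 dy]]] := SB c cS.
  have y0 : y != 0 by rewrite -phi_eq0 -dy mulf_neq0.
  have [a [p [ap ap0]]] := div y y0.
  have -> : c^-1 = d * phi a * (phi (y * a))^-1.
    rewrite rmorphM -dy; have a0 : phi a != 0.
      by rewrite phi_eq0; apply: contraNneq ap0 => ->; rewrite mulr0.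
    exact: invf_clear.
  apply: rpredM; first by apply: rpredM; [exact: RS | exact: inS].
  apply/kS/asboolP.
  exists 1, (phi (y * a)); rewrite rpred1 div1r; split=> //.
  by apply/curve_subringP; exists p; rewrite ap.
have xa y : algebraic R (phi y).
  apply: (@subalg_holds K O (fun y => algebraic R (phi y)) _ _ _ n g gen).
  - by apply: algebraic_sub_ring; rewrite rmorph1 rpred1.
  - move=> a u v uA vA; rewrite -[a *: u]mulr_algl rmorphD rmorphM.
    apply: algebraicD vA; apply: algebraicM uA; apply: algebraic_sub_ring.
    by apply/curve_subringP; exists a%:P; rewrite horner_algC.
  - by move=> u v uA vA; rewrite rmorphM; exact: algebraicM.
  - move=> i; have /(zariski gs)/algebraic_integral_field : phi (g i) \in s.
      by apply/mapP; exists i; rewrite ?mem_enum.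
    by move=> gi; apply/algebraicP.
exact: xa.
Qed.

(** Let t be non-scalar. If some c <> 0 divided no nonzero element of K[t],
there would be a prime p1 containing c and meeting K[t] in 0. In O / p1 the
class of t is transcendental, so O / p1 is not a field, and p1 lies strictly
inside a prime p2: the chain 0, p1, p2 is too long for a curve. *)
Lemma curve_algebraic : krull_dim O 1 ->
  exists t : O, ~ is_scalar t /\ forall x, algebraic (curve_subring t) (phi x).
Proof.
move=> [[p pchain] nochain].
have [p01 np10] : {subset p ord0 <= p ord_max} /\ ~ {subset p ord_max <= p ord0}.
  by apply: pchain.
have [t nt] : exists t : O, ~ is_scalar t.
  apply: contrapT => allS; apply: np10 => x xp.
  have [k xk] : is_scalar x by apply: contrapT => nx; apply: allS; exists x.
  have [k0|k0] := eqVneq k 0; first by rewrite xk k0 scale0r idealr0.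
  have := idealMr (k^-1)%:A xp; rewrite xk mulr_algl scalerA mulVf // scale1r.
  by rewrite idealr1.
exists t; split=> // x; apply: algebraic_of_divisors => c c0.
apply: contrapT => noc; apply: nochain.
have hneq0 : forall q : {poly K}, q != 0 -> horner_alg t q != 0.
  by move=> q; apply: (horner_alg_neq0 _ nt) => u v; exact: mulf_neq0.
have [||||p1 [p1c p1S]] := @prime_avoiding O [set y | exists a, y = c * a]
    [set y | exists2 q : {poly K}, q != 0 & y = horner_alg t q].
- split; first by exists 0; rewrite mulr0.
    by move=> _ _ [a ->] [b ->]; exists (a + b); rewrite mulrDr.
  by move=> d _ [a ->]; exists (d * a); rewrite mulrCA.
- by exists 1; rewrite ?oner_neq0 ?rmorph1.
- by move=> _ _ [u u0 ->] [v v0 ->]; exists (u * v); rewrite ?mulf_neq0 ?rmorphM.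
- move=> _ [a ->] [q q0 qE]; apply: noc; exists a, q; rewrite qE; split=> //.
  exact: hneq0.
have [y [yp1 ny]] : exists y, y \notin p1 /\ forall z, 1 - z * y \notin p1.
  apply: contrapT => noy.
  have inv : forall y : O, y \notin p1 -> exists z, 1 - z * y \in p1.
    move=> y yp; apply: contrapT => noz; apply: noy; exists y; split=> // z.
    by apply/negP => h; apply: noz; exists z.
  have [k tk] := field_quotient_scalar inv t.
  have : t - k%:A \notin p1.
    apply: p1S; exists ('X - k%:P); first by rewrite polyXsubC_eq0.
    by rewrite rmorphB /= horner_algX horner_algC.
  by rewrite tk.
have [||||p2 [p2I p2S]] := @prime_avoiding O
    [set u | exists a b, a \in p1 /\ u = a + b * y] [set 1].
- split; first by exists 0, 0; rewrite idealr0 mul0r addr0.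
    move=> _ _ [a [b [ap ->]]] [d [e [dp ->]]]; exists (a + d), (b + e).
    by rewrite rpredD // mulrDl addrACA.
  move=> d _ [a [b [ap ->]]]; exists (d * a), (d * b).
  by rewrite idealMr // mulrDr mulrA.
- by [].
- by move=> _ _ -> ->; rewrite mulr1.
- move=> u [a [b [ap uE]]] u1; move/negP: (ny b); apply.
  by rewrite -u1 uE addrK.
have zero_id : is_ideal [set u : O | u = 0].
  by split=> // [u v -> ->|a u ->]; rewrite ?addr0 ?mulr0.
have zero_prime (u v : O) : [set u : O | u = 0] (u * v) ->
    [set u : O | u = 0] u \/ [set u : O | u = 0] v.
  by move=> /eqP; rewrite mulf_eq0 => /orP[]/eqP ->; [left|right].
pose p0 := prime_of zero_id (elimN eqP (oner_neq0 O)) zero_prime.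
exists (fun i : 'I_3 => nth p0 [:: p0; p1; p2] i).
have s01 : {subset p0 <= p1} by move=> u /in_prime_of ->; exact: idealr0.
have n10 : ~ {subset p1 <= p0}.
  move=> H; have : c \in p0 by apply/H/p1c; exists 1; rewrite mulr1.
  by move=> /in_prime_of /= c00; rewrite c00 eqxx in c0.
have s12 : {subset p1 <= p2}.
  by move=> u up; apply: p2I; exists u, 0; rewrite mul0r addr0.
have n21 : ~ {subset p2 <= p1}.
  move=> H; have : y \in p1.
    by apply/H/p2I; exists 0, 1; rewrite idealr0 mul1r add0r.
  by rewrite (negbTE yp1).
move=> [[|[|[|i]]] i3] [[|[|[|k]]] k3] //= _; split=> //.
  by move=> u /s01/s12.
by move=> s20; apply: n10 => u /s12/s20.
Qed.

End CurveDimension.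

(** * Derivations of fields *)

Section Derivations.
Variable F : fieldType.
Hypothesis charF : [pchar F] =i pred0.
Implicit Types (B S : subringClosed F) (D : F -> F) (x y : F) (p q : {poly F}).

Definition derivation_on (B : {pred F}) D : Prop :=
  {in B &, {morph D : x y / x + y}} /\
  {in B &, forall x y, D (x * y) = D x * y + x * D y}.

Section On.
Variables (B : subringClosed F) (D : F -> F).
Hypothesis dD : derivation_on B D.

Lemma derivation0 : D 0 = 0.
Proof.
have [DD _] := dD; apply: (addrI (D 0)); rewrite -DD ?rpred0 //.
by rewrite !addr0.
Qed.

Lemma derivation1 : D 1 = 0.
Proof.
have [_ DM] := dD; apply: (addrI (D 1)); rewrite addr0.
by have := DM 1 1 (rpred1 _) (rpred1 _); rewrite !mulr1 mul1r => /esym.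
Qed.

Lemma derivationN x : x \in B -> D (- x) = - D x.
Proof.
move=> xB; have [DD _] := dD; apply/eqP; rewrite -addr_eq0.
by rewrite -DD ?rpredN // addNr derivation0.
Qed.

Lemma derivation_map_poly_coef p i : (map_poly D p)`_i = D p`_i.
Proof. exact: coef_map_id0 derivation0. Qed.

Lemma derivation_map_polyD p q : p \is a polyOver B -> q \is a polyOver B ->
  map_poly D (p + q) = map_poly D p + map_poly D q.
Proof.
have [DD _] := dD; move=> /polyOverP pB /polyOverP qB; apply/polyP => i.
by rewrite coefD !derivation_map_poly_coef coefD DD.
Qed.

Lemma derivation_sum I (r : seq I) (G : I -> F) : (forall i, G i \in B) ->
  D (\sum_(i <- r) G i) = \sum_(i <- r) D (G i).
Proof.
have [DD _] := dD; move=> GB; elim: r => [|i r IH].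
  by rewrite !big_nil derivation0.
by rewrite !big_cons DD ?rpred_sum // IH.
Qed.

Lemma derivation_map_polyM p q : p \is a polyOver B -> q \is a polyOver B ->
  map_poly D (p * q) = map_poly D p * q + p * map_poly D q.
Proof.
have [DD DM] := dD; move=> /polyOverP pB /polyOverP qB; apply/polyP => i.
rewrite coefD !derivation_map_poly_coef !coefM derivation_sum; last first.
  by move=> k; rewrite rpredM.
rewrite -big_split /=; apply: eq_bigr => k _.
by rewrite DM // !derivation_map_poly_coef.
Qed.

Lemma derivation_map_polyC c : map_poly D c%:P = (D c)%:P.
Proof.
by apply/polyP => i; rewrite derivation_map_poly_coef !coefC; case: eqP => // _;
  exact: derivation0.
Qed.

Lemma derivation_map_polyX : map_poly D 'X = 0.
Proof.
apply/polyP => i; rewrite derivation_map_poly_coef coefX coef0.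
by case: eqP => _; rewrite ?derivation0 // derivation1.
Qed.

(** The value at x of the derivation of B[X] extending D and mapping X to z. *)
Definition total_derivative (x z : F) p := (map_poly D p).[x] + p^`().[x] * z.

Lemma total_derivativeM x z p q : p \is a polyOver B -> q \is a polyOver B ->
  total_derivative x z (p * q) =
  total_derivative x z p * q.[x] + p.[x] * total_derivative x z q.
Proof.
move=> pB qB; rewrite /total_derivative derivation_map_polyM // derivM.
by rewrite !hornerD !hornerM; ring.
Qed.

Lemma total_derivativeD x z p q : p \is a polyOver B -> q \is a polyOver B ->
  total_derivative x z (p + q) = total_derivative x z p + total_derivative x z q.
Proof.
move=> pB qB; rewrite /total_derivative derivation_map_polyD // derivD.
by rewrite !hornerD; ring.
Qed.

Lemma total_derivativeC x z c : total_derivative x z c%:P = D c.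
Proof.
by rewrite /total_derivative derivation_map_polyC derivC horner0 hornerC mul0r addr0.
Qed.

Lemma total_derivativeX x z : total_derivative x z 'X = z.
Proof. by rewrite /total_derivative derivation_map_polyX derivX horner0 hornerC mul1r add0r. Qed.

Lemma derivation_horner p x : p \is a polyOver B -> x \in B ->
  D p.[x] = total_derivative x (D x) p.
Proof.
move=> pB xB; have [DD DM] := dD; elim/poly_ind: p pB => [|p c IH] pB.
  by rewrite horner0 derivation0 total_derivativeC derivation0.
have pE i : p`_i = (p * 'X + c%:P)`_i.+1 by rewrite coefD coefMX coefC addr0.
have cE : c = (p * 'X + c%:P)`_0 by rewrite coefD coefMX coefC add0r.
have pB' : p \is a polyOver B.
  by apply/polyOverP => i; rewrite pE; move/polyOverP: pB.
have cB : c \in B by rewrite cE; move/polyOverP: pB.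
have pxB : p.[x] \in B by rewrite rpred_horner.
rewrite total_derivativeD ?rpredM ?polyOverX ?polyOverC // total_derivativeC.
rewrite total_derivativeM ?polyOverX // total_derivativeX -IH //.
by rewrite !hornerE DD ?rpredM // DM.
Qed.

End On.

(** In characteristic zero a polynomial of minimal degree killing x is separable at x,
since its derivative has lower degree. *)
Lemma minimal_polynomial B x : algebraic B x ->
  exists m, [/\ m \is a polyOver B, m != 0, root m x, m^`().[x] != 0 &
    forall q, q \is a polyOver B -> root q x -> (size q < size m)%N -> q = 0].
Proof.
move=> [p0 [p0B p00 p0x]].
have ex : exists n, `[< exists p, [/\ p \is a polyOver B, p != 0, root p x & size p = n] >].
  by exists (size p0); apply/asboolP; exists p0.
case: (ex_minnP ex) => n /asboolP[m [mB m0 mx sm]] nmin.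
have min q : q \is a polyOver B -> root q x -> (size q < size m)%N -> q = 0.
  move=> qB qx qm; apply/eqP; apply: contraT => q0.
  have : (n <= size q)%N by apply: nmin; apply/asboolP; exists q.
  by rewrite -sm leqNgt qm.
exists m; split=> //; apply/negP => /rootP m'x.
have sm1 : (1 < size m)%N by exact: root_size_gt1 m0 mx.
have m'0 : m^`() = 0.
  apply: min; [exact: polyOver_deriv | exact/rootP | exact: lt_size_deriv].
have := congr1 (fun q : {poly F} => q`_(size m).-2) m'0.
have szm : (size m).-2.+1 = (size m).-1 by case: (size m) sm1 => [|[|]].
rewrite coef_deriv coef0 szm -mulr_natr => /eqP; rewrite mulf_eq0.
rewrite -lead_coefE lead_coef_eq0 (negbTE m0) /=.
rewrite -szm (proj1 (pcharf0P F)) //.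
Qed.

(** Differentiating the minimal equation m(x) = 0 gives m'(x) D x = 0. *)
Lemma derivation_vanish S B D x : derivation_on B D -> {subset S <= B} ->
  {in S, forall y, D y = 0} -> x \in B -> algebraic S x -> D x = 0.
Proof.
move=> dD SB S0 xB /minimal_polynomial[m [mS m0 mx m'x _]].
have mB : m \is a polyOver B by apply: polyOverS mS.
have := derivation_horner dD mB xB.
rewrite (rootP mx) (derivation0 dD) /total_derivative.
have -> : map_poly D m = 0.
  apply/polyP => i; rewrite (derivation_map_poly_coef dD) coef0 S0 //.
  by move/polyOverP: mS.
rewrite horner0 add0r => /esym/eqP; rewrite mulf_eq0 (negbTE m'x) /=.
by move/eqP.
Qed.

(** The formula D'(p(x)) = (D p)(x) + p'(x) z depends on p only through p(x) exactly
when it vanishes on polynomials killing x. *)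
Lemma derivation_extend B D x z : derivation_on B D ->
  (forall p, p \is a polyOver B -> p.[x] = 0 -> total_derivative D x z p = 0) ->
  exists D', [/\ derivation_on (adjoin B x) D', {in B, D' =1 D} & D' x = z].
Proof.
move=> dD ker; pose e := total_derivative D x z.
have /choice[D' D'P] : forall y, exists d, y \in adjoin B x ->
    exists p, [/\ p \is a polyOver B, y = p.[x] & d = e p].
  move=> y; have [/asboolP[p pB yE]|] := boolP (y \in adjoin B x).
    by exists (e p) => _; exists p.
  by exists 0.
have D'E p : p \is a polyOver B -> D' p.[x] = e p.
  move=> pB; have [|q [qB pq ->]] := D'P p.[x]; first by apply/asboolP; exists p.
  apply/eqP; rewrite -subr_eq0; apply/eqP.
  have NB : (-1)%:P \is a polyOver B by rewrite polyOverC rpredN1.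
  have -> : e q - e p = e (q + (-1)%:P * p).
    rewrite /e (total_derivativeD dD) ?rpredM // (total_derivativeM dD) //.
    rewrite (total_derivativeC dD) (derivationN dD) ?rpred1 // (derivation1 dD).
    by rewrite oppr0 mul0r add0r hornerC mulN1r.
  apply: ker; first by rewrite rpredD ?rpredM.
  by rewrite !hornerE -pq mulN1r subrr.
exists D'; split.
- split=> _ _ /asboolP[p pB ->] /asboolP[q qB ->].
    by rewrite -hornerD !D'E ?rpredD // /e (total_derivativeD dD).
  by rewrite -hornerM !D'E ?rpredM // /e (total_derivativeM dD).
- move=> b bB; rewrite -[b in LHS](hornerC b x) D'E ?polyOverC //.
  exact: total_derivativeC dD _ _ _.
- by rewrite -[x in LHS]hornerX D'E ?polyOverX // /e (total_derivativeX dD).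
Qed.

(** The value z is forced by the minimal polynomial m. For the condition of
[derivation_extend], a polynomial killing x is reduced modulo m by
pseudo-division, as B need not be a field. *)
Lemma derivation_extend_algebraic B D x : derivation_on B D -> algebraic B x ->
  exists D', derivation_on (adjoin B x) D' /\ {in B, D' =1 D}.
Proof.
move=> dD /minimal_polynomial[m [mB m0 mx m'x mmin]].
pose z := - ((map_poly D m).[x] / m^`().[x]).
have em : total_derivative D x z m = 0.
  by rewrite /total_derivative /z mulrN mulrC divfK // subrr.
have [|D' [dD' D'B _]] := @derivation_extend B D x z dD; last by exists D'.
move=> p; have [n] := ubnP (size p); elim: n p => // n IH p sp pB px.
have [sm|sm] := ltnP (size p) (size m).
  rewrite (mmin p pB _ sm); last exact/rootP.
  by rewrite -[X in total_derivative _ _ _ X]polyC0 (total_derivativeC dD) (derivation0 dD).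
have c0 : lead_coef m != 0 by rewrite lead_coef_eq0.
have cB : lead_coef m \in B by rewrite lead_coefE; move/polyOverP: mB.
have dB : - lead_coef p \in B by rewrite rpredN lead_coefE; move/polyOverP: pB.
pose u := (- lead_coef p)%:P * 'X^(size p - size m).
have uB : u \is a polyOver B by rewrite rpredM ?polyOverC ?rpredX ?polyOverX.
pose q := (lead_coef m)%:P * p + u * m.
have qB : q \is a polyOver B by apply: rpredD; apply: rpredM => //; rewrite polyOverC.
have qx : q.[x] = 0 by rewrite !hornerE px (rootP mx) !mulr0 addr0.
have sq : (size q < size p)%N.
  have sm0 : (0 < size m)%N by rewrite size_poly_gt0.
  have p0 : (0 < size p)%N by exact: leq_trans sm.
  rewrite -(prednK p0) ltnS; apply/leq_sizeP => i ip.
  rewrite /q /u coefD coefCM -mulrA coefCM coefXnM ltnNge.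
  have -> : (size p - size m <= i)%N by lia.
  have [ip1|ip1] := eqVneq i (size p).-1.
    have -> : (i - (size p - size m))%N = (size m).-1.
      by lia.
    by rewrite /= ip1 -!lead_coefE; ring.
  have [pi mi] : (size p <= i)%N /\ (size m <= i - (size p - size m))%N by lia.
  by rewrite /= !nth_default // !mulr0 addr0.
have : total_derivative D x z q = 0 by exact: (IH q (leq_trans sq sp) qB qx).
have cP : (lead_coef m)%:P \is a polyOver B by rewrite polyOverC.
rewrite /q (total_derivativeD dD _ _ (rpredM cP pB) (rpredM uB mB)).
rewrite (total_derivativeM dD _ _ cP pB).
rewrite (total_derivativeM dD _ _ uB mB) px (rootP mx) em !mulr0 !add0r addr0.
by rewrite hornerC => /eqP; rewrite mulf_eq0 (negbTE c0) => /eqP.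
Qed.

Lemma derivation_extend_adjoins B D (s : seq F) : derivation_on B D ->
  {in s, forall x, algebraic B x} ->
  exists D', derivation_on (adjoins B s) D' /\ {in B, D' =1 D}.
Proof.
elim: s B D => [|x s IH] B D dD sa; first by exists D.
have [D1 [dD1 D1E]] := derivation_extend_algebraic dD (sa x (mem_head _ _)).
have [|D2 [dD2 D2E]] := IH _ _ dD1.
  move=> y ys; apply: algebraicS (sa y _); last by rewrite inE ys orbT.
  by move=> b; exact: sub_adjoin.
exists D2; split=> // b bB; rewrite D2E ?D1E //; exact: sub_adjoin.
Qed.

(** The quotient rule is independent of the fraction chosen. *)
Lemma derivation_extend_frac B D : derivation_on B D ->
  (forall x, exists a b, [/\ a \in B, b \in B, b != 0 & x = a / b]) ->
  exists D', derivation_on predT D' /\ {in B, D' =1 D}.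
Proof.
move=> dD fracB; have [DD DM] := dD.
pose quot a b := (D a * b - a * D b) / b ^+ 2.
have /choice[D' D'P] : forall x, exists d, exists a b,
    [/\ a \in B, b \in B, b != 0, x = a / b & d = quot a b].
  by move=> x; have [a [b [aB bB b0 xE]]] := fracB x; exists (quot a b), a, b.
have D'E a b : a \in B -> b \in B -> b != 0 -> D' (a / b) = quot a b.
  move=> aB bB b0; have [c [d [cB dB d0 abE ->]]] := D'P (a / b).
  have cross : a * d = c * b by move/eqP: abE; rewrite eqr_div // => /eqP.
  have := congr1 D cross; rewrite !DM // => crossD.
  have aE : a = c * b / d by rewrite -cross mulfK.
  have DaE : D a = (D c * b + c * D b - a * D d) / d.
    by rewrite -crossD addrK mulfK.
  by rewrite /quot DaE aE; field; rewrite b0 d0.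
exists D'; split; last first.
  move=> b bB; rewrite -[b in LHS]divr1 D'E ?rpred1 ?oner_neq0 // /quot.
  by rewrite (derivation1 dD) mulr0 subr0 mulr1 expr1n divr1.
split=> x y _ _; have [a [b [aB bB b0 ->]]] := fracB x;
  have [c [d [cB dB d0 ->]]] := fracB y.
  rewrite addf_div // !D'E ?rpredD ?rpredM ?mulf_neq0 // /quot DD ?rpredM //.
  by rewrite !DM //; field; rewrite b0 d0.
rewrite mulf_div !D'E ?rpredM ?mulf_neq0 // /quot !DM //.
by field; rewrite b0 d0.
Qed.

End Derivations.

(** * The derivation of the function field *)

(** Read the equation of z over k[x], a polynomial in two variables, as an equation
of x over k[z]; it is nonzero because z satisfies no equation over k. *)
Lemma algebraic_exchange (E : fieldType) (k : divringClosed E) (x z : E) :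
  algebraic (adjoin k x) z -> ~ algebraic k z -> algebraic (adjoin k z) x.
Proof.
move=> [p [/polyOverP pk p0 pz]] nz.
have /choice[q qP] : forall i, exists q, q \is a polyOver k /\ p`_i = q.[x].
  by move=> i; have /asboolP[q qk qE] := pk i; exists q.
pose N := (\max_(i < size p) size (q i))%N.
pose u j := \poly_(i < size p) (q i)`_j.
have uk j : u j \is a polyOver k.
  apply/polyOverP => i; rewrite coef_poly; case: ifP => _; last exact: rpred0.
  by have [/polyOverP] := qP i.
exists (\poly_(j < N) (u j).[z]); split.
- apply/polyOverP => j; rewrite coef_poly; case: ifP => _; last exact: rpred0.
  by apply/asboolP; exists (u j).
- have [i pi] : exists i : 'I_(size p), p`_i != 0.
    have sp : (0 < size p)%N by rewrite size_poly_gt0.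
    have lt : ((size p).-1 < size p)%N by rewrite prednK.
    by exists (Ordinal lt); rewrite -lead_coefE lead_coef_eq0.
  have qi0 : q i != 0.
    by apply: contraNneq pi => qi; have [_ ->] := qP i; rewrite qi horner0.
  pose j := (size (q i)).-1.
  have sq : (0 < size (q i))%N by rewrite size_poly_gt0.
  have jN : (j < N)%N.
    rewrite prednK //; exact: (leq_bigmax (F := fun i : 'I__ => size (q i)) i).
  apply/eqP => /(congr1 (fun r : {poly E} => r`_j)); rewrite coef_poly jN coef0.
  move=> uz; apply: nz; exists (u j); split=> //; last exact/rootP.
  apply/eqP => /(congr1 (fun r : {poly E} => r`_i)).
  rewrite coef_poly ltn_ord coef0 -lead_coefE => /eqP.
  by rewrite lead_coef_eq0 (negbTE qi0).
- rewrite rootE -(rootP pz) horner_poly [in eqbRHS]horner_coef.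
  under eq_bigr do rewrite horner_poly mulr_suml.
  rewrite exchange_big /=; apply/eqP/eq_bigr => i _.
  have [_ ->] := qP i.
  rewrite (@horner_coef_wide _ N); last first.
    exact: (leq_bigmax (F := fun i : 'I__ => size (q i)) i).
  by rewrite mulr_suml; apply: eq_bigr => j _; rewrite mulrAC.
Qed.

Section ImageRing.
Variables (R : comNzRingType) (E : fieldType) (f : {rmorphism R -> E}).

Definition image_ring_pred : {pred E} := fun x => `[< exists k, x = f k >].

Lemma image_ring_closed : subring_closed image_ring_pred.
Proof.
split; first by apply/asboolP; exists 1; rewrite rmorph1.
  move=> _ _ /asboolP[k ->] /asboolP[l ->]; apply/asboolP; exists (k - l).
  by rewrite rmorphB.
move=> _ _ /asboolP[k ->] /asboolP[l ->]; apply/asboolP; exists (k * l).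
by rewrite rmorphM.
Qed.

HB.instance Definition _ :=
  GRing.isSubringClosed.Build E image_ring_pred image_ring_closed.

Definition image_ring : subringClosed E := image_ring_pred.
End ImageRing.

Section CurveDerivation.
Variables (K : closedFieldType) (charK : [pchar K] =i pred0).
Variables (O : idomainAlgType K) (F : fieldType) (phi : {rmorphism O -> F}).
Hypothesis phi_inj : injective phi.
Hypothesis phi_frac : forall x, exists a b, b != 0 /\ x = phi a / phi b.
Hypothesis fgO : finitely_generated O.
Local Notation kF := (frac_scalar phi).

Lemma charF : [pchar F] =i pred0.
Proof. by move=> p; rewrite (fmorph_pchar kF). Qed.

Variable t : O.
Hypothesis nt : ~ is_scalar t.
Hypothesis talg : forall x, algebraic (curve_subring phi t) (phi x).

Lemma horner_alg_eq0 (p : {poly K}) : horner_alg t p = 0 -> p = 0.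
Proof.
move=> pt; apply/eqP; apply: contraT => /(horner_alg_neq0 _ nt).
by rewrite pt eqxx; apply=> x y; exact: mulf_neq0.
Qed.

Lemma algebraic_function x : algebraic (curve_subring phi t) x.
Proof.
have [a [b [_ ->]]] := phi_frac x; apply: algebraicM => //.
exact: algebraicV.
Qed.

(** A derivation along phi that kills K and t kills K[t], and therefore every element
algebraic over it. *)
Lemma vanishing_derivation (d : O -> F) :
  {morph d : x y / x + y} -> (forall x y, d (x * y) = d x * phi y + phi x * d y) ->
  (forall k, d k%:A = 0) -> d t = 0 -> forall x, d x = 0.
Proof.
move=> dD dM dK dt x.
(* Transport d to the image of phi in F. *)
have /choice[pre preP] : forall y, exists x, (exists x', y = phi x') -> y = phi x.
  move=> y; have [[x' ->]|no] := pselect (exists x', y = phi x'); first by exists x'.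
  by exists 0.
have preE z : pre (phi z) = z by apply: phi_inj; rewrite -preP //; exists z.
have dD' : derivation_on (image_ring phi) (d \o pre).
  split=> _ _ /asboolP[u ->] /asboolP[v ->] /=.
    by rewrite -rmorphD !preE dD.
  by rewrite -rmorphM !preE dM.
have dp (p : {poly K}) : d (horner_alg t p) = 0.
  elim/poly_ind: p => [|p c IH]; first by rewrite rmorph0 -(scale0r 1) dK.
  rewrite rmorphD rmorphM /= horner_algX horner_algC dD dM IH dt dK.
  by rewrite mul0r mulr0 !addr0.
have := @derivation_vanish F charF (curve_subring phi t) (image_ring phi)
  (d \o pre) (phi x) dD' _ _ _ (talg x).
rewrite /= preE; apply.
- move=> y /curve_subringP[p ->]; apply/asboolP; by exists (horner_alg t p).
- by move=> y /curve_subringP[p ->] /=; rewrite preE dp.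
- by apply/asboolP; exists x.
Qed.

(** Zero on K, extended first to K[t] with value 1 at t, then to the algebraic
generators of O, then to fractions. *)
Lemma curve_derivation : exists D : F -> F,
  [/\ derivation_on predT D, forall k, D (kF k) = 0 & D (phi t) = 1].
Proof.
have d0 : derivation_on (image_field kF) (fun=> 0).
  by split=> x y _ _; rewrite ?mul0r ?mulr0 addr0.
have [|D1 [dD1 D1K D1t]] := @derivation_extend F _ _ (phi t) 1 d0.
  move=> p /polyOver_imageP[q ->]; rewrite -phi_horner_alg => /eqP.
  rewrite (phi_eq0 phi_inj) => /eqP/horner_alg_eq0 ->; rewrite rmorph0.
  by rewrite -[X in total_derivative _ _ _ X]polyC0 (total_derivativeC d0).
have [n [g gen]] := fgO; pose s := [seq phi (g i) | i <- enum 'I_n].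
have [|D2 [dD2 D2E]] := @derivation_extend_adjoins F charF _ _ s dD1.
  by move=> _ /mapP[i _ ->].
pose B := adjoins (curve_subring phi t) s.
have inB x : phi x \in B.
  apply: (@subalg_holds K O (fun y => phi y \in B) _ _ _ n g gen).
  - by rewrite rmorph1 rpred1.
  - move=> k u v uB vB; rewrite -[k *: u]mulr_algl rmorphD rmorphM rpredD //.
    rewrite rpredM //; apply: adjoins_base; apply/curve_subringP.
    by exists k%:P; rewrite horner_algC.
  - by move=> u v uB vB; rewrite rmorphM rpredM.
  - by move=> i; apply/adjoins_gen/mapP; exists i; rewrite ?mem_enum.
have [|D [dD DE]] := @derivation_extend_frac F _ _ dD2.
  move=> x; have [a [b [b0 ->]]] := phi_frac x.
  by exists (phi a), (phi b); rewrite !inB (phi_eq0 phi_inj).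
have D1E x : x \in curve_subring phi t -> D x = D1 x.
  by move=> xt; rewrite DE ?D2E //; exact: adjoins_base.
have Kt k : kF k \in image_field kF by apply/image_fieldP; exists k.
exists D; split=> //.
  by move=> k; rewrite D1E ?D1K //; exact: sub_adjoin.
by rewrite D1E ?D1t //; exact: adjoin_gen.
Qed.

Variable D : F -> F.
Hypotheses (dD : derivation_on predT D) (DK : forall k, D (kF k) = 0).
Hypothesis Dt : D (phi t) = 1.

Lemma derivation_on_sub (B : {pred F}) : derivation_on B D.
Proof. by have [DD DM] := dD; split=> x y _ _; [exact: DD | exact: DM]. Qed.

(** A non-scalar constant z is transcendental over K, so by exchange t is algebraic
over K(z), on which D vanishes; but D t = 1. *)
Lemma constants_scalar z : D z = 0 -> exists k, z = kF k.
Proof.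
move=> Dz; apply: (@algebraic_over_closed K F kF); apply: contrapT => nz.
have ta := algebraic_exchange (algebraic_function z) nz.
pose S := adjoin (image_field kF) z; pose B := adjoin S (phi t).
have : D (phi t) = 0.
  apply: (derivation_vanish charF (derivation_on_sub B) _ _ _ ta).
  - by move=> y; exact: sub_adjoin.
  - move=> _ /asboolP[p pK ->].
    rewrite (@derivation_horner F S D (derivation_on_sub S) p z); last 2 first.
    + by apply: polyOverS pK => y; exact: sub_adjoin.
    + exact: adjoin_gen.
    rewrite /total_derivative Dz mulr0 addr0.
    suff -> : map_poly D p = 0 by rewrite horner0.
    apply/polyP => i; rewrite (derivation_map_poly_coef (derivation_on_sub S)) coef0.
    by move/polyOverP: pK => /(_ i)/image_fieldP[k ->]; rewrite DK.
  - exact: adjoin_gen.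
by move/eqP; rewrite Dt oner_eq0.
Qed.

(** It is enough that s be a common denominator of the D (g i) for generators g i. *)
Lemma derivation_clear_denominators : exists s : O, s != 0 /\
  forall x, exists y, phi s * D (phi x) = phi y.
Proof.
have [DD DM] := dD; have [n [g gen]] := fgO.
have /choice[a /choice[b abP]] : forall i : 'I_n, exists a b, b != 0 /\
    D (phi (g i)) = phi a / phi b by move=> i; exact: phi_frac.
exists (\prod_i b i); split.
  by apply/prodf_neq0 => i _; have [] := abP i.
set s := \prod_i b i.
apply: (@subalg_holds K O (fun x => exists y, phi s * D (phi x) = phi y)
  _ _ _ n g gen).
- by exists 0; rewrite rmorph1 (derivation1 (derivation_on_sub (image_field kF)))
    mulr0 rmorph0.
- move=> k u v [u' uE] [v' vE]; exists (k *: u' + v').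
  rewrite -[k *: u]mulr_algl -[k *: u']mulr_algl !rmorphD !rmorphM.
  rewrite DD // DM // (DK k) mul0r add0r mulrDr vE -uE; congr (_ + _).
  by rewrite mulrCA.
- move=> u v [u' uE] [v' vE]; exists (u' * v + u * v').
  by rewrite !rmorphD !rmorphM DM // mulrDr mulrA uE mulrCA vE.
- move=> i; have [b0 ->] := abP i.
  exists (a i * \prod_(k | k != i) b k); rewrite /s (bigD1 i) //= !rmorphM.
  rewrite [phi (b i) * _]mulrC -mulrA [phi (b i) * _]mulrC.
  by rewrite divfK ?(phi_eq0 phi_inj) // mulrC.
Qed.

End CurveDerivation.

(** * Commutators with functions *)

Section Commutators.
Variables (O : comNzRingType) (A : nzRingType) (m : {rmorphism O -> A}).
Implicit Types (r s : O) (u : A).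

(** The sign is that of [u, r], so that commutation with t acts on symbols as a
derivative in the dual variable, without alternating signs. *)
Definition commutator_with r u := u * m r - m r * u.

Lemma commutator_with_comm r s u :
  commutator_with r (commutator_with s u) = commutator_with s (commutator_with r u).
Proof.
have c : m r * m s = m s * m r by rewrite -!rmorphM mulrC.
rewrite /commutator_with !mulrBl !mulrBr !mulrA -[u * m s * m r]mulrA -c mulrA.
by rewrite !opprB addrACA [RHS]addrACA [in RHS](addrC (- _)).
Qed.

Lemma commutator_withMl r s u :
  commutator_with (r * s) u =
  commutator_with r u * m s + m r * commutator_with s u.
Proof. by rewrite /commutator_with rmorphM mulrBl mulrBr !mulrA addrA subrK. Qed.

Lemma commutator_withDl r s u :
  commutator_with (r + s) u = commutator_with r u + commutator_with s u.
Proof. by rewrite /commutator_with rmorphD mulrDl mulrDr opprD addrACA. Qed.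

Lemma commutator_with0 r : commutator_with r 0 = 0.
Proof. by rewrite /commutator_with mulr0 mul0r subrr. Qed.

Lemma commutator_withD r : {morph commutator_with r : u v / u + v}.
Proof. by move=> u v; rewrite /commutator_with mulrDl mulrDr opprD addrACA. Qed.

Lemma commutator_withM r u v :
  commutator_with r (u * v) = commutator_with r u * v + u * commutator_with r v.
Proof. by rewrite /commutator_with mulrBl mulrBr !mulrA [RHS]addrC addrA subrK. Qed.

Lemma commutator_with_image r s : commutator_with r (m s) = 0.
Proof. by rewrite /commutator_with -!rmorphM mulrC subrr. Qed.

End Commutators.

Section DiffopBasics.
Variables (K : fieldType) (O : comAlgType K).
Implicit Types (r : O) (u v : diffop O).

Lemma endoD (u : endo O) x y : val u (x + y) = val u x + val u y.
Proof. by have := endoP u 1 x y; rewrite !scale1r. Qed.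

Lemma endo0 (u : endo O) : val u 0 = 0.
Proof. by apply: (addrI (val u 0)); rewrite -endoD !addr0. Qed.

Lemma endoZ (u : endo O) k x : val u (k *: x) = k *: val u x.
Proof. by have := endoP u k x 0; rewrite endo0 !addr0. Qed.

Lemma mul_endo_diffop r : mul_endo r \in @diffop_pred K O.
Proof.
by apply/asboolP; exists 0%N => s; rewrite mul_endoC subrr.
Qed.

Definition mul_diffop r : diffop O := Sub (mul_endo r) (mul_endo_diffop r).

Lemma mul_diffop_zmod : zmod_morphism mul_diffop.
Proof.
by move=> x y; apply/val_inj/endo_ext => z /=; rewrite mulrBl.
Qed.

Lemma mul_diffop_monoid : monoid_morphism mul_diffop.
Proof.
split; first by apply/val_inj/endo_ext => z /=; rewrite mul1r.
by move=> x y; apply/val_inj/endo_ext => z /=; rewrite mulrA.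
Qed.

HB.instance Definition _ :=
  GRing.isZmodMorphism.Build O (diffop O) mul_diffop mul_diffop_zmod.
HB.instance Definition _ :=
  GRing.isMonoidMorphism.Build O (diffop O) mul_diffop mul_diffop_monoid.

Lemma mul_diffop_scalar k : mul_diffop k%:A = k%:A.
Proof.
by apply/val_inj/endo_ext => z /=; rewrite -scalerAl mul1r.
Qed.

Definition ev u : O := val (val u) 1.

Lemma ev_mul_diffop r : ev (mul_diffop r) = r.
Proof. by rewrite /ev /= mulr1. Qed.

Lemma evD u v : ev (u + v) = ev u + ev v.
Proof. by rewrite /ev rmorphD. Qed.

Lemma ev0 : ev 0 = 0.
Proof. by rewrite /ev rmorph0. Qed.

Lemma evM u v : ev (u * v) = val (val u) (ev v).
Proof. by rewrite /ev rmorphM. Qed.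

Lemma ev_mul_diffop_l r u : ev (mul_diffop r * u) = r * ev u.
Proof. by rewrite evM. Qed.

Lemma mul_diffop_inj : injective mul_diffop.
Proof. by move=> x y xy; rewrite -[x]ev_mul_diffop xy ev_mul_diffop. Qed.

Local Notation bracket_with := (commutator_with mul_diffop).

Lemma val_commutator r u :
  val (bracket_with r u) = val u * mul_endo r - mul_endo r * val u.
Proof. by rewrite /commutator_with rmorphB !rmorphM. Qed.

Lemma val_commutator_with r u x :
  val (val (bracket_with r u)) x = val (val u) (r * x) - r * val (val u) x.
Proof. by rewrite val_commutator. Qed.

(** If u commutes with multiplications, then u x = u (x 1) = x (u 1). *)
Lemma multiplication_of_commuting u : (forall r, bracket_with r u = 0) ->
  u = mul_diffop (ev u).
Proof.
move=> uC; apply/val_inj/endo_ext => x /=.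
have := congr1 (fun v => val (val v) 1) (uC x); rewrite val_commutator_with mulr1.
by move=> /subr0_eq ->; rewrite mulrC.
Qed.

Lemma commutator_with_scalar k u : bracket_with k%:A u = 0.
Proof.
rewrite /commutator_with /= mul_diffop_scalar -scalerAl -scalerAr.
by rewrite mul1r mulr1 subrr.
Qed.

Lemma order_commutator_with i r u : diffop_order i.+1 (val u) ->
  diffop_order i (val (bracket_with r u)).
Proof. by move=> ui; rewrite val_commutator; exact: ui. Qed.

Lemma diffop_has_order u : exists i, diffop_order i (val u).
Proof. by have /asboolP := valP u. Qed.

Lemma order0_commutator_with u : diffop_order 0 (val u) ->
  forall r, bracket_with r u = 0.
Proof.
by move=> u0 r; apply: val_inj; rewrite val_commutator u0 rmorph0.
Qed.

Lemma iter_commutator_with_order t i u : diffop_order i (val u) ->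
  iter i.+1 (bracket_with t) u = 0.
Proof.
elim: i u => [|i IH] u ui; first exact: order0_commutator_with.
by rewrite iterSr; apply/IH/order_commutator_with.
Qed.

Lemma diffop_nilpotent t u : exists n, iter n.+1 (bracket_with t) u = 0.
Proof.
by have [i ui] := diffop_has_order u; exists i; exact: iter_commutator_with_order.
Qed.

End DiffopBasics.

Section CurveDiffop.
Variables (K : closedFieldType) (charK : [pchar K] =i pred0).
Variables (O : idomainAlgType K) (F : fieldType) (phi : {rmorphism O -> F}).
Hypothesis phi_inj : injective phi.
Variable t : O.
Hypothesis talg : forall x, algebraic (curve_subring phi t) (phi x).
Local Notation mulD := (@mul_diffop K O).
Local Notation bracket_with := (commutator_with mulD).
Local Notation delta := (bracket_with t).
Implicit Types u v w : diffop O.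

(** Let u commute with t. By induction on its order the commutators [u, r] are
functions; r |-> [u, r] is then a derivation of O killing t, so it is zero by
[vanishing_derivation]. *)
Lemma ker_delta u : delta u = 0 -> u = mulD (ev u).
Proof.
move=> ut; apply: multiplication_of_commuting.
have [i] := diffop_has_order u; elim: i u ut => [|i IH] u ut ui.
  exact: order0_commutator_with.
have wE r : bracket_with r u = mulD (ev (bracket_with r u)).
  apply: multiplication_of_commuting; apply: IH; last exact: order_commutator_with.
  by rewrite commutator_with_comm ut commutator_with0.
pose d r := phi (ev (bracket_with r u)).
suff d0 r : d r = 0.
  move=> r; rewrite wE; have -> : ev (bracket_with r u) = 0.
    by apply: phi_inj; rewrite rmorph0; exact: d0.
  exact: rmorph0.
apply: (vanishing_derivation charK phi_inj talg).
- by move=> x y; rewrite /d commutator_withDl evD rmorphD.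
- move=> x y; rewrite /d commutator_withMl evD rmorphD ev_mul_diffop_l rmorphM.
  by rewrite [in LHS]wE evM ev_mul_diffop /= rmorphM.
- by move=> k; rewrite /d commutator_with_scalar ev0 rmorph0.
- by rewrite /d ut ev0 rmorph0.
Qed.

Variable D : F -> F.
Hypotheses (dD : derivation_on predT D) (DK : forall k, D (frac_scalar phi k) = 0).
Hypothesis Dt : D (phi t) = 1.

(** If [w, t] = f is a function, then r |-> [w, r] is a derivation with values in
functions, and it agrees with f D at t. *)
Lemma first_order_bracket w f g : delta w = mulD f ->
  exists h, bracket_with g w = mulD h /\ phi h = phi f * D (phi g).
Proof.
move=> wf; exists (ev (bracket_with g w)).
have [DD DM] := dD.
have wE r : bracket_with r w = mulD (ev (bracket_with r w)).
  apply: ker_delta; rewrite commutator_with_comm wf; exact: commutator_with_image.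
split=> //; apply/eqP; rewrite -subr_eq0; apply/eqP.
pose d r := phi (ev (bracket_with r w)) - phi f * D (phi r).
rewrite -/(d g); apply: (vanishing_derivation charK phi_inj talg).
- have key (a b c p q : F) : a + b - c * (p + q) = a - c * p + (b - c * q).
    by ring.
  move=> x y; rewrite /d commutator_withDl evD (rmorphD phi (ev _)).
  by rewrite (rmorphD phi x) DD //; exact: key.
- have key (a b c p q x y : F) :
    a * y + x * b - c * (p * y + x * q) = (a - c * p) * y + x * (b - c * q).
    by ring.
  move=> x y; rewrite /d commutator_withMl evD (rmorphD phi (ev _)).
  have -> : ev (bracket_with x w * mulD y) = ev (bracket_with x w) * y.
    by rewrite [in LHS]wE evM ev_mul_diffop.
  by rewrite ev_mul_diffop_l (rmorphM phi (ev _)) !(rmorphM phi x) DM //.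
- move=> k; rewrite /d commutator_with_scalar ev0 rmorph0.
  by rewrite (DK k) mulr0 subrr.
- by rewrite /d wf ev_mul_diffop Dt mulr1 subrr.
Qed.

(** The multiple s D of the derivation maps O to itself, and is a differential operator
of order one. *)
Lemma derivation_diffop (s : O) :
  (forall x, exists y, phi s * D (phi x) = phi y) ->
  exists E : diffop O, delta E = mulD s.
Proof.
move=> sD; have [DD DM] := dD.
have [e eE] := choice sD.
have elin : linear e.
  move=> k x y; apply: phi_inj; rewrite -eE.
  rewrite -[k *: x]mulr_algl -[k *: e x]mulr_algl !rmorphD !rmorphM -!eE.
  rewrite DD // DM // (DK k); ring.
have com r : mk_endo elin * mul_endo r - mul_endo r * mk_endo elin = mul_endo (e r).
  apply: endo_ext => x /=; apply: phi_inj.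
  rewrite rmorphB !rmorphM -!eE rmorphM DM //; ring.
have eP : mk_endo elin \in @diffop_pred K O.
  apply/asboolP; exists 1%N => r; rewrite com => r'.
  by rewrite mul_endoC subrr.
exists (Sub (mk_endo elin) eP); apply: val_inj; rewrite val_commutator /= com.
by have -> : e t = s by apply: phi_inj; rewrite -eE Dt mulr1.
Qed.

End CurveDiffop.

(** * Symbols with respect to one function *)

(** The differential operators enter only through their commutators with functions,
so A is an arbitrary algebra with an embedding mu of O, in which commutation
with t is locally nilpotent with kernel O. *)
Section Symbols.
Variables (K : closedFieldType) (O : idomainAlgType K) (F : fieldType).
Variable phi : {rmorphism O -> F}.
Hypothesis phi_inj : injective phi.
Hypothesis charF : [pchar F] =i pred0.
Variables (A : algType K) (mu : {rmorphism O -> A}).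
Hypothesis mu_inj : injective mu.
Hypothesis mu_scalar : forall k, mu k%:A = k%:A.
Variable t : O.
Local Notation delta := (commutator_with mu t).
Hypothesis delta_nil : forall u, exists n, iter n.+1 delta u = 0.
Hypothesis delta_ker : forall u, delta u = 0 -> exists f, u = mu f.

(** If [..[u, t].., t] with n commutators is the function g, the symbol is g / n!; the
factorial makes symbols multiplicative. A symbol 0 means order less than n. *)
Definition symbol (n : nat) (u : A) (f : F) : Prop :=
  iter n.+1 delta u = 0 /\
  exists g, iter n delta u = mu g /\ phi g = n`!%:R * f.

Let fact_neq0 n : (n`!%:R : F) != 0.
Proof. by rewrite (proj1 (pcharf0P F) charF) -lt0n fact_gt0. Qed.

Lemma iter_delta0 n : iter n delta 0 = 0.
Proof. by elim: n => //= n ->; exact: commutator_with0. Qed.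

Lemma iter_deltaD n u v : iter n delta (u + v) = iter n delta u + iter n delta v.
Proof. by elim: n => //= n ->; exact: commutator_withD. Qed.

Lemma deltaN u : delta (- u) = - delta u.
Proof. by rewrite /commutator_with mulNr mulrN opprB opprK addrC. Qed.

Lemma iter_deltaN n u : iter n delta (- u) = - iter n delta u.
Proof. by elim: n => //= n ->; exact: deltaN. Qed.

Lemma symbol_exists n u : iter n.+1 delta u = 0 -> exists f, symbol n u f.
Proof.
move=> un; have [g gE] := delta_ker un; exists (phi g / n`!%:R); split=> //.
by exists g; rewrite mulrC divfK.
Qed.

Lemma symbol_unique n u f g : symbol n u f -> symbol n u g -> f = g.
Proof.
move=> [_ [a [ua af]]] [_ [b [ub bg]]].
have ab : a = b by apply: mu_inj; rewrite -ua -ub.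
by apply: (mulfI (fact_neq0 n)); rewrite -af -bg ab.
Qed.

Lemma symbol0 n : symbol n 0 0.
Proof.
by split; [exact: iter_delta0 | exists 0; rewrite iter_delta0 !rmorph0 mulr0].
Qed.

Lemma symbolD n u v f g : symbol n u f -> symbol n v g -> symbol n (u + v) (f + g).
Proof.
move=> [un [a [ua af]]] [vn [b [vb bg]]]; split.
  by rewrite iter_deltaD un vn addr0.
by exists (a + b); rewrite iter_deltaD ua vb !rmorphD mulrDr -af -bg.
Qed.

Lemma symbolN n u f : symbol n u f -> symbol n (- u) (- f).
Proof.
move=> [un [a [ua af]]]; split; first by rewrite iter_deltaN un oppr0.
by exists (- a); rewrite iter_deltaN ua !rmorphN mulrN -af.
Qed.

Lemma symbol_mu g : symbol 0 (mu g) (phi g).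
Proof.
by split; [exact: commutator_with_image | exists g; rewrite mul1r].
Qed.

Lemma symbolM m n u v f g : symbol m u f -> symbol n v g ->
  symbol (m + n) (u * v) (f * g).
Proof.
move=> [um [a [ua af]]] [vn [b [vb bg]]].
have d0 : delta 0 = 0 by exact: commutator_with0.
have dM := @commutator_withM _ _ mu t; have dD := @commutator_withD _ _ mu t.
split; first exact: (iter_leibniz_vanish dD dM um vn d0 d0).
exists ((a * b) *+ 'C(m + n, m)).
rewrite (iter_leibniz_top dD dM um vn d0 d0) ua vb -rmorphM -rmorphMn.
split=> //; rewrite rmorphMn rmorphM af bg -mulr_natl.
have <- : ('C(m + n, m) * (m`! * n`!))%N = (m + n)`!.
  by rewrite -(bin_fact (leq_addr n m)) addKn.
rewrite !natrM; ring.
Qed.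

Lemma symbolS n u f : symbol n u f -> symbol n.+1 u 0.
Proof.
move=> [un _]; split; first by rewrite iterS un; exact: commutator_with0.
by exists 0; rewrite un !rmorph0 mulr0.
Qed.

Lemma symbol_lt m n u f : (m < n)%N -> symbol m u f -> symbol n u 0.
Proof.
elim: n => // n IH; rewrite ltnS leq_eqVlt => /orP[/eqP -> /symbolS //|mn uf].
exact: symbolS (IH mn uf).
Qed.

Lemma symbol_pred n u : symbol n.+1 u 0 -> exists f, symbol n u f.
Proof.
move=> [un [g [gE]]]; rewrite mulr0 => /eqP; rewrite -(rmorph0 phi) (inj_eq phi_inj).
by move=> /eqP g0; apply: symbol_exists; rewrite gE g0 rmorph0.
Qed.

Lemma symbol_zero_order u : symbol 0 u 0 -> u = 0.
Proof.
move=> [_ [g [/= -> ]]]; rewrite mulr0 => /eqP.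
by rewrite -(rmorph0 phi) (inj_eq phi_inj) => /eqP ->; rewrite rmorph0.
Qed.

Lemma symbol_exact u : u != 0 -> exists n f, f != 0 /\ symbol n u f.
Proof.
move=> u0; have [n] := delta_nil u; elim: n => [|n IH] un.
  have [f uf] := symbol_exists un; exists 0%N, f; split=> //.
  by apply: contraNneq u0 => f0; rewrite f0 in uf; apply/eqP/symbol_zero_order.
have [f uf] := symbol_exists un; have [f0|f0] := eqVneq f 0; last by exists n.+1, f.
by rewrite f0 in uf; have [g [ug _]] := symbol_pred uf; exact: IH.
Qed.

Lemma symbol_neq0 n u f : symbol n u f -> f != 0 -> u != 0.
Proof.
move=> uf; apply: contraNneq => u0; rewrite u0 in uf.
exact/eqP/(symbol_unique uf)/symbol0.
Qed.

Lemma symbol_order_unique m n u f g : symbol m u f -> f != 0 ->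
  symbol n u g -> g != 0 -> m = n.
Proof.
wlog mn : m n f g / (m <= n)%N => [W|] uf f0 ug g0.
  case: (leqP m n) => [/W|/ltnW/W nm]; first by apply; eassumption.
  exact/esym/(nm _ _ ug g0 uf f0).
move: mn; rewrite leq_eqVlt => /orP[/eqP //|/symbol_lt/(_ uf)/symbol_unique/(_ ug)].
by move=> g00; rewrite -g00 eqxx in g0.
Qed.

(** If s and s b have their orders, so has b, by multiplicativity of nonzero symbols. *)
Lemma symbol_divide q l s b e w : symbol q s e -> e != 0 ->
  symbol (q + l) (s * b) w -> symbol l b (w / e).
Proof.
move=> se e0 sb; have [b0|b0] := eqVneq b 0.
  rewrite b0 mulr0 in sb *; rewrite (symbol_unique sb (symbol0 _)) mul0r.
  exact: symbol0.
have [k [g [g0 bg]]] := symbol_exact b0; have sbg := symbolM se bg.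
have eg0 : e * g != 0 by rewrite mulf_neq0.
have [lk|kl|lk] := ltngtP l k.
- have := symbol_lt (_ : q + l < q + k)%N sb; rewrite ltn_add2l => /(_ lk).
  by move=> /(symbol_unique sbg) eg; rewrite eg eqxx in eg0.
- have := symbol_lt (_ : q + k < q + l)%N sbg; rewrite ltn_add2l => /(_ kl).
  by move=> /(symbol_unique sb) ->; rewrite mul0r; exact: symbol_lt bg.
- rewrite -lk in sbg bg; rewrite (symbol_unique sb sbg) mulrC mulKf //.
Qed.

Variable D : F -> F.
Hypothesis dD : derivation_on predT D.
Hypothesis first_order : forall w f g, delta w = mu f ->
  exists h, commutator_with mu g w = mu h /\ phi h = phi f * D (phi g).

Lemma delta_bracket u v :
  delta (u * v - v * u) = (delta u * v - v * delta u) + (u * delta v - delta v * u).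
Proof.
rewrite commutator_withD deltaN !commutator_withM opprD [RHS]addrACA.
by congr (_ + _); rewrite addrC.
Qed.

Lemma symbol_delta n u f : symbol n.+1 u f -> symbol n (delta u) (n.+1%:R * f).
Proof.
move=> [un [g [ug gf]]]; split; first by rewrite -iterSr.
exists g; rewrite -iterSr; split=> //.
by rewrite gf factS natrM; ring.
Qed.

Lemma symbol_of_delta n w f : symbol n (delta w) (n.+1%:R * f) -> symbol n.+1 w f.
Proof.
move=> [wn [g [wg gf]]]; split; first by rewrite iterSr.
exists g; rewrite iterSr; split=> //.
by rewrite gf factS natrM; ring.
Qed.

(** The Poisson bracket formula. Commutation with t is a derivation, and it turns
the symbol f of order m into m f of order m - 1, so the formula for [u, v]
follows from those for [[u, t], v] and [u, [v, t]] by induction on m + n. *)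
Lemma symbol_bracket N m n u v f g : (m + n = N.+1)%N ->
  symbol m u f -> symbol n v g ->
  symbol N (u * v - v * u) (m%:R * f * D g - n%:R * g * D f).
Proof.
have [DD DM] := dD.
have D0 : D 0 = 0 by apply: (addrI (D 0)); rewrite -DD // !addr0.
have Dn k x : D (k%:R * x) = k%:R * D x.
  elim: k => [|k IH]; first by rewrite !mul0r D0.
  by rewrite !mulrSr !mulrDl DD // IH !mul1r.
elim: N m n u v f g => [|N IH] m n u v f g.
  case: m n => [|[|m]] [|[|n]] // _ [un [a [/= ua af]]] [vn [b [/= vb bg]]].
    have [h [hE hF]] := first_order a vb.
    have -> : u * v - v * u = mu (- h).
      by rewrite rmorphN -hE /commutator_with -ua opprB.
    have -> : 0%:R * f * D g - 1%:R * g * D f = phi (- h).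
      by rewrite rmorphN hF bg af fact0 factS fact0 muln1 !mul1r !mul0r sub0r.
    exact: symbol_mu.
  have [h [hE hF]] := first_order b ua.
  have -> : u * v - v * u = mu h by rewrite -hE /commutator_with -vb.
  have -> : 1%:R * f * D g - 0%:R * g * D f = phi h.
    by rewrite hF bg af fact0 factS fact0 muln1 !mul1r !mul0r subr0.
  exact: symbol_mu.
move=> mn uf vg; apply: symbol_of_delta; rewrite delta_bracket.
have [x [xE xu]] : exists x, x = m%:R * (m%:R - 1) * f * D g - m%:R * n%:R * g * D f /\
    symbol N (delta u * v - v * delta u) x.
  exists (m%:R * (m%:R - 1) * f * D g - m%:R * n%:R * g * D f); split=> //.
  case: m mn uf => [|m] mn uf.
    have -> : delta u = 0 by case: uf.
    by rewrite mul0r mulr0 subr0 !mul0r subr0; exact: symbol0.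
  have [mn'] : (m + n = N.+1)%N by case: mn.
  have := IH m n (delta u) v _ g mn' (symbol_delta uf) vg.
  rewrite Dn mulrSr addrK; congr symbol; ring.
have [y [yE yv]] : exists y, y = n%:R * m%:R * f * D g - n%:R * (n%:R - 1) * g * D f /\
    symbol N (u * delta v - delta v * u) y.
  exists (n%:R * m%:R * f * D g - n%:R * (n%:R - 1) * g * D f); split=> //.
  case: n mn {xE xu} vg => [|n] mn vg.
    have -> : delta v = 0 by case: vg.
    by rewrite mul0r mulr0 subr0 !mul0r subr0; exact: symbol0.
  have mn' : (m + n = N.+1)%N by lia.
  have := IH m n u (delta v) f _ mn' uf (symbol_delta vg).
  rewrite Dn mulrSr addrK; congr symbol; ring.
have := symbolD xu yv; rewrite xE yE; congr symbol.
have -> : N.+1%:R = m%:R + n%:R - 1 :> F.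
  by rewrite -natrD mn [N.+2%:R]mulrSr addrK.
by ring.
Qed.

(** * Symbols on the division ring of fractions *)

Section Fractions.
Local Notation kF := (frac_scalar phi).
Hypothesis constD : forall z, D z = 0 -> exists k, z = kF k.
Variables (w1 : A) (f1 : O).
Hypotheses (f1_neq0 : f1 != 0) (w1_bracket : delta w1 = mu f1).
Variable G : unitAlgType K.
Hypothesis Gdiv : forall x : G, x != 0 -> x \is a GRing.unit.
Variable iota : {lrmorphism A -> G}.
Hypothesis iota_inj : injective iota.
Hypothesis iota_right : forall x : G, exists (a s : A), s != 0 /\ x = iota a * (iota s)^-1.
Implicit Types (x y z : G) (f g h : F) (n : int).

Let derivD f g : D (f * g) = D f * g + f * D g.
Proof. by have [_ ->] := dD. Qed.

Lemma symbol_scalar k : symbol 0 k%:A (kF k).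
Proof. by rewrite -mu_scalar; exact: symbol_mu. Qed.

Lemma symbol_order0_comm u v f g : symbol 0 u f -> symbol 0 v g -> u * v = v * u.
Proof.
move=> [/delta_ker[x ->] _] [/delta_ker[y ->] _].
by rewrite -!rmorphM mulrC.
Qed.

Lemma symbol_order1 : symbol 1 w1 (phi f1).
Proof.
split; first by rewrite /= w1_bracket; exact: commutator_with_image.
by exists f1; rewrite mul1r.
Qed.

Let iota_unit (s : A) : s != 0 -> iota s \is a GRing.unit.
Proof. by move=> s0; apply: Gdiv; rewrite -(inj_eq iota_inj) raddf0 in s0. Qed.

(** Symbols of fractions: orders become integers. *)
Definition top x (n : int) f : Prop := exists a s p q h e,
  [/\ symbol p a h, symbol q s e, e != 0, x = iota a * (iota s)^-1 &
      n = p%:Z - q%:Z /\ f = h / e].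

(** The Ore condition, read off a right fraction equal to the left fraction s^-1 r. *)
Lemma ore (s r : A) : s != 0 -> r != 0 ->
  exists c d, [/\ c != 0, d != 0 & s * c = r * d].
Proof.
move=> s0 r0; have [c [d [d0 E]]] := iota_right ((iota s)^-1 * iota r).
have sc : s * c = r * d.
  apply: iota_inj; rewrite !rmorphM.
  move/(congr1 (fun z => iota s * z * iota d)): E.
  by rewrite mulVKr ?iota_unit // -!mulrA mulVr ?iota_unit // mulr1 => ->.
exists c, d; split=> //; apply/eqP => c0.
have : iota r * iota d != 0.
  by apply: (div_mulf_neq0 Gdiv); rewrite -(raddf0 iota) (inj_eq iota_inj).
by rewrite -rmorphM -sc c0 mulr0 raddf0 eqxx.
Qed.

Lemma expand_fraction (a s c : A) : s != 0 -> c != 0 ->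
  iota a * (iota s)^-1 = iota (a * c) * (iota (s * c))^-1.
Proof.
move=> s0 c0; rewrite !rmorphM invrM ?iota_unit // -[RHS]mulrA.
by rewrite mulVKr ?iota_unit // mulrA mulrK ?iota_unit.
Qed.

(** Two fractions with their symbols can be written over one denominator; by
uniqueness of symbols the two expansions agree on it. *)
Lemma top_common x y n n' f g : top x n f -> top y n' g ->
  exists a b s p p' q h h' e, [/\ symbol p a h, symbol p' b h',
    symbol q s e /\ e != 0, x = iota a * (iota s)^-1 /\ y = iota b * (iota s)^-1 &
    [/\ n = p%:Z - q%:Z, f = h / e, n' = p'%:Z - q%:Z & g = h' / e]].
Proof.
move=> [a [s [p [q [h [e [ap sq e0 -> [-> ->]]]]]]]].
move=> [b [r [p' [q' [h' [e' [bp rq e'0 -> [-> ->]]]]]]]].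
have s0 := symbol_neq0 sq e0; have r0 := symbol_neq0 rq e'0.
have [c [d [c0 d0 sc]]] := ore s0 r0.
have [k [u [u0 cu]]] := symbol_exact c0; have [l [v [v0 dv]]] := symbol_exact d0.
have eu : e * u != 0 by rewrite mulf_neq0.
have e'v : e' * v != 0 by rewrite mulf_neq0.
have rd := symbolM rq dv; rewrite -sc in rd.
have kl := symbol_order_unique (symbolM sq cu) eu rd e'v.
have uv : e * u = e' * v by apply: symbol_unique rd; rewrite -kl; exact: symbolM.
exists (a * c), (b * d), (s * c), (p + k)%N, (p' + l)%N, (q + k)%N.
exists (h * u), (h' * v), (e * u); split; [exact: symbolM|exact: symbolM| | |split].
- by split=> //; exact: symbolM.
- by rewrite {2}sc -!expand_fraction.
- lia.
- by rewrite -mulf_div divff // mulr1.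
- lia.
- by rewrite uv -mulf_div divff // mulr1.
Qed.

Lemma top_fraction a s p q h e : symbol p a h -> symbol q s e -> e != 0 ->
  top (iota a * (iota s)^-1) (p%:Z - q%:Z) (h / e).
Proof. by move=> ap sq e0; exists a, s, p, q, h, e. Qed.

Lemma top_unique x n f g : top x n f -> top x n g -> f = g.
Proof.
move=> xf xg; have [a [b [s [p [p' [q [h [h' [e]]]]]]]]] := top_common xf xg.
move=> [ap bp [sq e0] [xa xb] [np -> np' ->]].
have ab : a = b.
  apply: iota_inj; apply: (mulIr (x := (iota s)^-1)).
    by rewrite unitrV iota_unit // (symbol_neq0 sq).
  by rewrite -xa -xb.
have pp : p = p' by lia.
by rewrite -pp -ab in bp; rewrite (symbol_unique ap bp).
Qed.

Lemma topD x y n f g : top x n f -> top y n g -> top (x + y) n (f + g).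
Proof.
move=> xf yg; have [a [b [s [p [p' [q [h [h' [e]]]]]]]]] := top_common xf yg.
move=> [ap bp [sq e0] [-> ->] [np -> np' ->]].
have pp : p = p' by lia.
rewrite -pp in bp; rewrite -!mulrDl -rmorphD np; apply: top_fraction => //.
exact: symbolD.
Qed.

Lemma topN x n f : top x n f -> top (- x) n (- f).
Proof.
move=> [a [s [p [q [h [e [ap sq e0 -> [-> ->]]]]]]]].
by rewrite -!mulNr -rmorphN; apply: top_fraction => //; exact: symbolN.
Qed.

Lemma topB x y n f g : top x n f -> top y n g -> top (x - y) n (f - g).
Proof. by move=> xf yg; apply: topD => //; exact: topN. Qed.

Lemma top_iota a p h : symbol p a h -> top (iota a) p%:Z h.
Proof.
move=> ap; have s1 := symbol_scalar 1; rewrite scale1r rmorph1 in s1.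
have := top_fraction ap s1 (oner_neq0 F).
by rewrite rmorph1 !divr1 subr0.
Qed.

Lemma top_scalar k : top k%:A 0 (kF k).
Proof. by have := top_iota (symbol_scalar k); rewrite rmorph_alg. Qed.

Lemma symbol_order_power : forall q : nat, exists s e, e != 0 /\ symbol q s e.
Proof.
elim=> [|q [s [u [u0 su]]]].
  by exists 1, 1; rewrite oner_neq0; split=> //; have := symbol_scalar 1;
    rewrite scale1r rmorph1.
have e0 : phi f1 != 0 by rewrite -(rmorph0 phi) (inj_eq phi_inj).
exists (w1 * s), (phi f1 * u); rewrite mulf_neq0 //; split=> //.
by rewrite -add1n; exact: symbolM symbol_order1 su.
Qed.

Lemma top0 n : top 0 n 0.
Proof.
have [p [q ->]] : exists p q : nat, n = p%:Z - q%:Z.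
  case: n => k; first by exists k, 0%N; rewrite subr0.
  by exists 0%N, k.+1; rewrite NegzE sub0r.
have [s [e [e0 sq]]] := symbol_order_power q.
by have := top_fraction (symbol0 p) sq e0; rewrite raddf0 !mul0r.
Qed.

(** To multiply a s^-1 and b r^-1, write s^-1 b = c d^-1; the symbol of c comes from
b d = s c by division. As orders in A are natural numbers, d is first multiplied
by an element of the order of s. *)
Lemma topM x y n n' f g : top x n f -> top y n' g -> top (x * y) (n + n') (f * g).
Proof.
move=> [a [s [p [q [h [e [ap sq e0 -> [-> ->]]]]]]]].
move=> [b [r [p' [q' [h' [e' [bp rq e'0 -> [-> ->]]]]]]]].
have s0 := symbol_neq0 sq e0; have r0 := symbol_neq0 rq e'0.
have [c [d [d0 E]]] := iota_right ((iota s)^-1 * iota b).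
have bd : b * d = s * c.
  apply: iota_inj; rewrite !rmorphM.
  move/(congr1 (fun z => iota s * z * iota d)): E.
  by rewrite mulVKr ?iota_unit // -!mulrA mulVr ?iota_unit // mulr1.
have [w [v [v0 wq]]] := symbol_order_power q.
have w0 := symbol_neq0 wq v0.
have [k [u [u0 du]]] := symbol_exact d0.
have dw := symbolM du wq; have uv : u * v != 0 by rewrite mulf_neq0.
have bdw := symbolM bp dw; rewrite mulrA bd -mulrA in bdw.
have l : (p' + (k + q) = q + (p' + k))%N by lia.
rewrite l in bdw; have cw := symbol_divide sq e0 bdw.
have -> : iota a * (iota s)^-1 * (iota b * (iota r)^-1) =
    iota (a * (c * w)) * (iota (r * (d * w)))^-1.
  have dw0 := symbol_neq0 dw uv.
  rewrite -mulrA [(iota s)^-1 * _]mulrA E mulrA (expand_fraction c d0 w0).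
  rewrite !rmorphM -!mulrA; congr (_ * (_ * (_ * _))).
  by rewrite -!rmorphM [in RHS]rmorphM invrM ?iota_unit.
have := top_fraction (symbolM ap cw) (symbolM rq dw) (mulf_neq0 e'0 uv).
congr top; first by lia.
by field; rewrite e0 e'0 u0 v0.
Qed.

Lemma top_lt x m n f : m < n -> top x m f -> top x n 0.
Proof.
move=> mn [a [s [p [q [h [e [ap sq e0 -> [mE _]]]]]]]].
have [k kE] : exists k : nat, n = (p + k.+1)%N%:Z - q%:Z.
  by exists (`|n - m|%N.-1); lia.
have := top_fraction (symbol_lt (_ : (p < p + k.+1)%N) ap) sq e0.
by rewrite mul0r -kE; apply; rewrite addnS ltnS leq_addr.
Qed.

Lemma top_pred x n : top x n 0 -> exists g, top x (n - 1) g.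
Proof.
move=> [a [s [[|p] [q [h [e [ap sq e0 -> [nE]]]]]]]] /esym/eqP;
  rewrite mulf_eq0 invr_eq0 (negbTE e0) orbF => /eqP h0; rewrite h0 in ap.
  exists 0; rewrite (symbol_zero_order ap) raddf0 mul0r; exact: top0.
have [g ag] := symbol_pred ap; exists (g / e).
have -> : n - 1 = p%:Z - q%:Z by lia.
exact: top_fraction.
Qed.

Lemma top_exact x : x != 0 -> exists n f, f != 0 /\ top x n f.
Proof.
move=> x0; have [a [s [s0 xE]]] := iota_right x.
have a0 : a != 0 by apply: contraNneq x0 => a0; rewrite xE a0 raddf0 mul0r.
have [p [h [h0 ap]]] := symbol_exact a0; have [q [e [e0 sq]]] := symbol_exact s0.
exists (p%:Z - q%:Z), (h / e); rewrite mulf_neq0 ?invr_eq0 //; split=> //.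
by rewrite xE; exact: top_fraction.
Qed.

Lemma top_neq0 x n f : top x n f -> f != 0 -> x != 0.
Proof.
move=> xf; apply: contraNneq => x0; rewrite x0 in xf.
exact/eqP/(top_unique xf)/top0.
Qed.

Lemma top_order_unique x m n f g : top x m f -> f != 0 -> top x n g -> g != 0 ->
  m = n.
Proof.
move=> xf f0 xg g0; have [mn|nm|//] := ltgtP m n.
  by rewrite (top_unique xg (top_lt mn xf)) eqxx in g0.
by rewrite (top_unique xf (top_lt nm xg)) eqxx in f0.
Qed.

Lemma topV x n f : top x n f -> f != 0 -> top x^-1 (- n) f^-1.
Proof.
move=> [a [s [p [q [h [e [ap sq e0 -> [-> ->]]]]]]]] he0.
have h0 : h != 0 by apply: contraNneq he0 => ->; rewrite mul0r.
rewrite invrM ?unitrV ?iota_unit ?(symbol_neq0 sq) ?(symbol_neq0 ap) // invrK.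
by rewrite opprB invf_div; exact: top_fraction.
Qed.

Lemma topX x n f k : top x n f -> top (x ^+ k) (n *+ k) (f ^+ k).
Proof.
move=> xf; elim: k => [|k IH].
  by rewrite !expr0 mulr0n; have := top_scalar 1; rewrite scale1r rmorph1.
by rewrite !exprS mulrS; exact: topM.
Qed.

Lemma topXz x n f (k : int) : top x n f -> f != 0 ->
  exists g, g != 0 /\ top (x ^ k) (n * k) g.
Proof.
move=> xf f0; case: k => k.
  exists (f ^+ k); rewrite expf_neq0 //; split=> //.
  have := topX k xf; congr top; by rewrite -mulr_natr natz.
exists (f ^+ k.+1)^-1; rewrite invr_eq0 expf_neq0 //; split=> //.
have := topV (topX k.+1 xf) (expf_neq0 _ f0); congr top.
by rewrite NegzE -mulr_natr natz mulrN.
Qed.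

(** The Poisson bracket formula at the exact orders of x and y, a form that passes
to products and inverses. *)
Definition leading_bracket x y : Prop := exists n f n' g,
  [/\ top x n f, f != 0, top y n' g, g != 0 &
      top (x * y - y * x) (n + n' - 1) (n%:~R * f * D g - n'%:~R * g * D f)].

Lemma leading_bracket_iota (u v : A) : u != 0 -> v != 0 ->
  leading_bracket (iota u) (iota v).
Proof.
move=> u0 v0; have [m [f [f0 uf]]] := symbol_exact u0.
have [n [g [g0 vg]]] := symbol_exact v0.
exists m%:Z, f, n%:Z, g; split=> //; try exact: top_iota.
rewrite -!rmorphM -rmorphB; case mn: (m + n)%N => [|N].
  have [m0 n0] : m = 0%N /\ n = 0%N by lia.
  rewrite m0 n0 in uf vg *; rewrite (symbol_order0_comm uf vg) subrr raddf0 !mulr0z !mul0r !subr0.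
  exact: top0.
have := top_iota (symbol_bracket mn uf vg); congr top; lia.
Qed.

Lemma leading_bracketC x y : leading_bracket x y -> leading_bracket y x.
Proof.
move=> [n [f [n' [g [xf f0 yg g0 /topN]]]]]; rewrite !opprB => xy.
by exists n', g, n, f; split=> //; rewrite [n' + n]addrC.
Qed.

Lemma leading_bracketM x y z : leading_bracket x z -> leading_bracket y z ->
  leading_bracket (x * y) z.
Proof.
move=> [m [f [n [h [xf f0 zh h0 xz]]]]] [m' [g [n' [h' [yg g0 zh' h'0 yz]]]]].
have nn := top_order_unique zh h0 zh' h'0; rewrite -nn in zh' yz.
have hh := top_unique zh zh'; rewrite -hh in yz.
exists (m + m'), (f * g), n, h; split=> //; rewrite ?mulf_neq0 //.
  exact: topM.
have -> : x * y * z - z * (x * y) = x * (y * z - z * y) + (x * z - z * x) * y.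
  by rewrite mulrBr mulrBl !mulrA addrA subrK.
have e1 : m + (m' + n - 1) = m + m' + n - 1 by lia.
have e2 : m + n - 1 + m' = m + m' + n - 1 by lia.
have := topM xf yz; rewrite e1 => t1; have := topM xz yg; rewrite e2 => t2.
have := topD t1 t2; congr top; rewrite derivD rmorphD /=; ring.
Qed.

Lemma leading_bracketV x y : leading_bracket x y -> leading_bracket x^-1 y.
Proof.
move=> [m [f [n [g [xf f0 yg g0 xy]]]]].
have ux : x \is a GRing.unit by apply/Gdiv/(top_neq0 xf).
exists (- m), f^-1, n, g; split=> //; rewrite ?invr_eq0 //; first exact: topV.
have -> : x^-1 * y - y * x^-1 = - (x^-1 * (x * y - y * x) * x^-1).
  by rewrite mulrBr mulrBl mulKr // [x^-1 * (y * x)]mulrA mulrK // opprB.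
have xV := topV xf f0; have := topN (topM (topM xV xy) xV).
have e1 : - m + (m + n - 1) + - m = - m + n - 1 by lia.
rewrite e1; congr top.
have D0 : D 1 = 0.
  by apply: (addrI (D 1)); have := derivD 1 1; rewrite !mulr1 mul1r addr0.
have DV : D f^-1 = - D f / f ^+ 2.
  apply: (mulfI f0); apply: (addrI (D f / f)).
  have := derivD f f^-1; rewrite divff // D0 => <-; field.
  exact: f0.
by rewrite DV rmorphN /=; field; rewrite f0.
Qed.

Lemma leading_bracket_all x y : x != 0 -> y != 0 -> leading_bracket x y.
Proof.
have step (u : A) y0 : u != 0 -> y0 != 0 -> leading_bracket (iota u) y0.
  move=> u0 y00; have [b [r [r0 yE]]] := iota_right y0.
  have b0 : b != 0 by apply: contraNneq y00 => b0; rewrite yE b0 raddf0 mul0r.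
  rewrite yE; apply/leading_bracketC/leading_bracketM.
    exact: leading_bracket_iota.
  exact/leading_bracketV/leading_bracket_iota.
move=> x0 y0; have [a [s [s0 xE]]] := iota_right x.
have a0 : a != 0 by apply: contraNneq x0 => a0; rewrite xE a0 raddf0 mul0r.
rewrite xE; apply: leading_bracketM; first exact: step.
exact/leading_bracketV/step.
Qed.

Lemma intF_neq0 n : n != 0 -> (n%:~R : F) != 0.
Proof.
case: n => [[|k]|k] //= _; rewrite ?NegzE ?rmorphN ?oppr_eq0 /=;
  by rewrite -pmulrn (proj1 (pcharf0P F) charF).
Qed.

(** For commuting x of order 0 and y of order n the bracket formula reads n g D f = 0,
so f is a constant of D. *)
Lemma commuting_symbol_scalar x y f n g : x * y = y * x ->
  top x 0 f -> f != 0 -> top y n g -> g != 0 -> n != 0 -> exists k, f = kF k.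
Proof.
move=> xy xf f0 yg g0 n0.
have [m [f' [n' [g' [xf' f'0 yg' g'0]]]]] :=
  leading_bracket_all (top_neq0 xf f0) (top_neq0 yg g0).
have m0 := top_order_unique xf f0 xf' f'0; rewrite -m0 in xf' *.
have nn := top_order_unique yg g0 yg' g'0; rewrite -nn in yg' *.
rewrite -(top_unique xf xf') -(top_unique yg yg') xy subrr => h.
apply: constD; have := top_unique h (top0 _).
rewrite mul0r mul0r sub0r => /eqP; rewrite oppr_eq0 !mulf_eq0.
by rewrite (negbTE (intF_neq0 n0)) (negbTE g0) /= => /eqP.
Qed.

(** A nonzero element has an order, so it cannot have arbitrarily small order. *)
Lemma top_separated x n0 : (forall N : nat, exists g, top x (n0 - N%:Z) g) -> x = 0.
Proof.
move=> H; apply/eqP; apply: contraT => x0.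
have [n [f [f0 xf]]] := top_exact x0.
have [g xg] := H `|n0 - n|.+1%N.
have lt : n0 - (`|n0 - n|.+1)%N%:Z < n by lia.
by rewrite (top_unique xf (top_lt lt xg)) eqxx in f0.
Qed.

(** Let p in C(a) have the least positive order d. For x in C(a), an element x p^-q
has order in [0, d), so order 0, and its symbol is a scalar k by
[commuting_symbol_scalar]; thus x - k p^q has smaller order. Repeating this,
x is approximated to any order by Laurent polynomials in p. These commute with p,
so x commutes with p; then commutators within C(a) have arbitrarily small order,
so they vanish. *)
Lemma commuting_positive_order_commutative a m f b c :
  top a m f -> f != 0 -> m != 0 -> a * b = b * a -> a * c = c * a ->
  b * c = c * b.
Proof.
move=> am f0 m0 ab ac.
have ua : a \is a GRing.unit by apply/Gdiv/(top_neq0 am).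
pose P (n : nat) := (0 < n)%N /\ exists p g, [/\ a * p = p * a, g != 0 & top p n%:Z g].
have exP : exists k : nat, `[< P k >].
  exists `|m|%N; apply/asboolP; split; first by rewrite absz_gt0.
  have [mpos|mneg] := leP 0 m.
    by exists a, f; rewrite gez0_abs.
  exists a^-1, f^-1; rewrite mulrV // mulVr // invr_eq0 f0; split=> //.
  by have := topV am f0; congr top; lia.
case: (ex_minnP exP) => d /asboolP[d0 [p [g [ap g0 pd]]]] dmin.
have up : p \is a GRing.unit by apply/Gdiv/(top_neq0 pd).
have apz k : a * p ^ k = p ^ k * a by apply: commrXz.
(* Subtracting a multiple of a power of p lowers the order. *)
have div x n h : a * x = x * a -> top x n h -> h != 0 ->
    exists k : K, exists z : int, exists g', top (x - k *: p ^ z) (n - 1) g'.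
  move=> ax xn h0; pose q := (n %/ d%:Z)%Z; pose r := (n %% d%:Z)%Z.
  have nE : n = q * d%:Z + r by exact: divz_eq.
  have d0' : d%:Z != 0 by lia.
  have rpos : 0 <= r by exact: modz_ge0.
  have rlt : r < d%:Z by apply: ltz_pmod; lia.
  have [u [u0 pu]] := topXz (- q) pd g0.
  have [w [w0 pw]] := topXz q pd g0.
  have y0 := topM xn pu.
  have e1 : n + d%:Z * (- q) = r by rewrite nE; ring.
  rewrite e1 in y0.
  have ay : a * (x * p ^ (- q)) = x * p ^ (- q) * a.
    by rewrite mulrA ax -mulrA apz mulrA.
  have hu : h * u != 0 by rewrite mulf_neq0.
  have r0 : r = 0.
    apply/eqP; apply: contraT => rn0.
    have : (d <= `|r|)%N.
      apply: dmin; apply/asboolP; split; first by rewrite absz_gt0.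
      by exists (x * p ^ (- q)), (h * u); rewrite gez0_abs.
    by lia.
  rewrite r0 in y0.
  have [k kE] := commuting_symbol_scalar (esym ay) y0 hu am f0 m0.
  exists k, q.
  have uw : u * w = 1.
    have := topM pu pw; rewrite -exprzDr // addNr expr0z.
    have -> : d%:Z * - q + d%:Z * q = 0 by ring.
    move=> h1; have := top_scalar 1; rewrite scale1r rmorph1.
    by move=> /(top_unique h1).
  have kp : top (k *: p ^ q) n h.
    have := topM (top_scalar k) pw; rewrite mulr_algl -kE -mulrA uw mulr1.
    by congr top; rewrite nE r0; ring.
  have := topB xn kp; rewrite subrr; exact: top_pred.
have approx x n h (N : nat) : a * x = x * a -> top x n h -> exists y,
    [/\ a * y = y * a, forall z, p * z = z * p -> y * z = z * y &
     exists g', top (x - y) (n - N%:Z) g'].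
  move=> ax xn; elim: N => [|N [y [ay yp [g' xy]]]].
    exists 0; rewrite mulr0 mul0r subr0; split=> //.
      by move=> z _; rewrite mulr0 mul0r.
    by exists h; rewrite subr0.
  have NE : n - N.+1%:Z = n - N%:Z - 1 by lia.
  rewrite NE; have [g'0|g'0] := eqVneq g' 0.
    by exists y; split=> //; apply: top_pred; rewrite -g'0.
  have axy : a * (x - y) = (x - y) * a by rewrite mulrBr mulrBl ax ay.
  have [k [z [g2 tz]]] := div _ _ _ axy xy g'0.
  exists (y + k *: p ^ z); split.
  - by rewrite mulrDr mulrDl ay -scalerAl -scalerAr apz.
  - move=> v pv; rewrite mulrDr mulrDl yp // -scalerAl -scalerAr.
    by congr (_ + _ *: _); apply/esym/commrXz.
  - by exists g2; rewrite opprD addrA.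
have top_any x : exists n h, top x n h.
  have [->|x0] := eqVneq x 0; first by exists 0, 0; exact: top0.
  by have [n [h [_ xn]]] := top_exact x0; exists n, h.
have commp x : a * x = x * a -> p * x = x * p.
  move=> ax; have [n [h xn]] := top_any x; apply/subr0_eq.
  apply: (@top_separated _ (d%:Z + n)) => N.
  have [y [_ yp [g' xy]]] := approx x n h N ax xn.
  have -> : p * x - x * p = p * (x - y) - (x - y) * p.
    by rewrite mulrBr mulrBl -(yp p erefl) opprB addrA subrK.
  have t2 := topM xy pd; have e2 : n - N%:Z + d%:Z = d%:Z + (n - N%:Z).
    by rewrite addrC.
  rewrite e2 in t2; have := topB (topM pd xy) t2.
  have -> : d%:Z + n - N%:Z = d%:Z + (n - N%:Z) by rewrite addrA.
  by eexists; eassumption.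
have [n [h bn]] := top_any b; have [n' [h' cn]] := top_any c.
apply/subr0_eq/(@top_separated _ (n + n')) => N.
have [y [_ yp [g' by_]]] := approx b n h N ab bn.
have -> : b * c - c * b = (b - y) * c - c * (b - y).
  by rewrite mulrBr mulrBl (yp c (commp c ac)) opprB addrA subrK.
have t2 := topM cn by_; have e2 : n' + (n - N%:Z) = n - N%:Z + n'.
  by rewrite addrC.
rewrite e2 in t2; have := topB (topM by_ cn) t2.
have -> : n + n' - N%:Z = n - N%:Z + n' by rewrite addrAC.
by eexists; eassumption.
Qed.

(** Let a be non-scalar. If a, or a minus a scalar, has nonzero order, the previous
lemma applies. Otherwise the symbol of a is a non-constant function, so every
nonzero element of C(a) has order 0. The commutator of two of them is in C(a)
and has symbol f g - g f = 0 in order 0, so it vanishes. *)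
Theorem ore_commutative_centralizers : commutative_centralizers G.
Proof.
move=> a na b c ab ac.
have a0 : a != 0 by apply/eqP => a0; apply: na; exists 0; rewrite scale0r.
have [m [f [f0 am]]] := top_exact a0.
have [m0|m0] := eqVneq m 0; last first.
  exact: commuting_positive_order_commutative am f0 m0 ab ac.
rewrite m0 in am; have [[k fk]|nk] := pselect (exists k, f = kF k).
  have ak0 : a - k%:A != 0.
    by apply/eqP => /subr0_eq ak; apply: na; exists k.
  have [m' [f' [f'0 am']]] := top_exact ak0.
  have t0 : top (a - k%:A) 0 0.
    by have := topB am (top_scalar k); rewrite -fk subrr.
  have m'0 : m' != 0.
    apply: contraNneq f'0 => m'0; rewrite m'0 in am'.
    by apply/eqP; exact: top_unique am' t0.
  apply: (commuting_positive_order_commutative am' f'0 m'0).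
    by rewrite mulrBl mulrBr ab -scalerAl -scalerAr mul1r mulr1.
  by rewrite mulrBl mulrBr ac -scalerAl -scalerAr mul1r mulr1.
have ord0 x n g : a * x = x * a -> top x n g -> g != 0 -> n = 0.
  move=> ax xn g0; apply/eqP; apply: contraT => n0; exfalso; apply: nk.
  exact: commuting_symbol_scalar ax am f0 xn g0 n0.
have [->|b0] := eqVneq b 0; first by rewrite mulr0 mul0r.
have [->|c0] := eqVneq c 0; first by rewrite mulr0 mul0r.
have [n [g [g0 bn]]] := top_exact b0; have nE := ord0 b n g ab bn g0; rewrite nE in bn.
have [n' [g' [g'0 cn]]] := top_exact c0; have nE' := ord0 c n' g' ac cn g'0; rewrite nE' in cn.
apply/subr0_eq/eqP; apply: contraT => bc0.
have [l [h [h0 bcl]]] := top_exact bc0.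
have abc : a * (b * c - c * b) = (b * c - c * b) * a.
  by rewrite mulrBr mulrBl !mulrA ab ac -!mulrA ab ac.
have lE := ord0 _ _ _ abc bcl h0; rewrite lE in bcl.
have := topB (topM bn cn) (topM cn bn); rewrite addr0 mulrC subrr => t0.
by move: h0; rewrite (top_unique bcl t0) eqxx.
Qed.

End Fractions.
End Symbols.

(** * Differential operators and degrees of functions *)

Section FilteredAlgebra.
Variables (K : fieldType) (O : comAlgType K) (r : nat) (g : 'I_r -> O).

(** The polynomials of degree at most n in the generators. *)
Fixpoint word_space (n : nat) : set O :=
  if n is k.+1
  then lspan (word_space k `|` [set x | exists i y, word_space k y /\ x = g i * y])
  else lspan [set 1].

Lemma word_space_closed n : lspan (word_space n) `<=` word_space n.
Proof. by case: n => [|n]; exact: lspan_subset. Qed.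

Lemma word_spaceD n x y : word_space n x -> word_space n y -> word_space n (x + y).
Proof.
by move=> xn yn; apply: word_space_closed; apply: lspanD; exact: lspan_gen.
Qed.

Lemma word_spaceZ n k x : word_space n x -> word_space n (k *: x).
Proof. by move=> xn; apply: word_space_closed; apply: lspanZ; exact: lspan_gen. Qed.

Lemma word_spaceS n x : word_space n x -> word_space n.+1 x.
Proof. by move=> xn; apply: lspan_gen; left. Qed.

Lemma word_space_leq m n x : (m <= n)%N -> word_space m x -> word_space n x.
Proof.
by move=> /subnK <-; elim: (n - m)%N => [|k IH] //= /IH /word_spaceS.
Qed.

Lemma word_space_mul_gen n i x : word_space n x -> word_space n.+1 (g i * x).
Proof. by move=> xn; apply: lspan_gen; right; exists i, x. Qed.

Lemma word_space1 n : word_space n 1.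
Proof. by apply: (@word_space_leq 0) => //; exact: lspan_gen. Qed.

Lemma word_space_ind (P : nat -> O -> Prop) :
  (forall n, P n 0) -> (forall n x y, P n x -> P n y -> P n (x + y)) ->
  (forall n k x, P n x -> P n (k *: x)) -> P 0%N 1 ->
  (forall n x, word_space n x -> P n x -> P n.+1 x) ->
  (forall n i x, word_space n x -> P n x -> P n.+1 (g i * x)) ->
  forall n x, word_space n x -> P n x.
Proof.
move=> P0 PD PZ P1 PS Pg; elim=> [|n IH] x.
  by apply: (@lspan_ind _ _ _ (P 0%N)) => // [y z|k y ->]; [exact: PD | exact: PZ].
apply: (@lspan_ind _ _ _ (P n.+1)) => // [y z|k y [yn|[i [z [zn ->]]]]].
- exact: PD.
- by apply/PZ/PS/IH.
- by apply/PZ/Pg/IH.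
Qed.

Lemma word_spaceM m n x y : word_space m x -> word_space n y ->
  word_space (m + n) (x * y).
Proof.
move=> xm yn; move: m x xm.
apply: (@word_space_ind (fun m x => word_space (m + n) (x * y))).
- by move=> m; rewrite mul0r -(scale0r 1); apply/word_spaceZ/word_space1.
- by move=> m u v; rewrite mulrDl; exact: word_spaceD.
- by move=> m k u; rewrite -scalerAl; exact: word_spaceZ.
- by rewrite mul1r.
- by move=> m u _; exact: word_spaceS.
- by move=> m i u _; rewrite -mulrA; exact: word_space_mul_gen.
Qed.

Lemma word_spaceX m x k : word_space m x -> word_space (m * k) (x ^+ k).
Proof.
move=> xm; elim: k => [|k IH]; first by rewrite muln0; exact: word_space1.
by rewrite exprS mulnS; exact: word_spaceM.
Qed.

Hypothesis gen : forall S : subalgClosed O, (forall i, g i \in S) ->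
  forall x, x \in S.

Lemma word_space_exhaust x : exists n, word_space n x.
Proof.
apply: (@subalg_holds K O (fun x => exists n, word_space n x) _ _ _ r g gen).
- by exists 0%N; exact: word_space1.
- move=> k u v [m um] [n vn]; exists (m + n)%N; apply: word_spaceD.
    by apply: word_spaceZ; apply: word_space_leq um; rewrite leq_addr.
  by apply: word_space_leq vn; rewrite leq_addl.
- by move=> u v [m um] [n vn]; exists (m + n)%N; exact: word_spaceM.
- move=> i; exists 1%N; rewrite -[g i]mulr1; apply: word_space_mul_gen.
  exact: word_space1.
Qed.

(** Induction on the order: u (g x) = g (u x) + [u, g] x, and [u, g] has lower order. *)
Lemma diffop_shift_bound j (u : diffop O) : diffop_order j (val u) ->
  exists c, forall n x, word_space n x -> word_space (n + c) (val (val u) x).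
Proof.
elim: j u => [|j IH] u uj.
  have [c uc] := word_space_exhaust (ev u); exists c => n x xn.
  have uE := multiplication_of_commuting (order0_commutator_with uj).
  have -> : val (val u) x = x * ev u by rewrite {1}uE /= mulrC.
  exact: word_spaceM.
have /choice[c cP] : forall i : 'I_r, exists c, forall n x, word_space n x ->
    word_space (n + c) (val (val (commutator_with (@mul_diffop K O) (g i) u)) x).
  by move=> i; apply/IH/order_commutator_with.
have [c0 uc0] := word_space_exhaust (ev u).
pose C := maxn c0 (\max_i c i).
exists C; apply: word_space_ind.
- by move=> n; rewrite endo0 -(scale0r 1); apply/word_spaceZ/word_space1.
- by move=> n x y ux uy; rewrite endoD; exact: word_spaceD.
- by move=> n k x ux; rewrite endoZ; exact: word_spaceZ.
- by rewrite add0n; apply: word_space_leq uc0; exact: leq_maxl.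
- by move=> n x _ ux; rewrite addSn; exact: word_spaceS.
- move=> n i x xn ux.
  have -> : val (val u) (g i * x) = g i * val (val u) x +
      val (val (commutator_with (@mul_diffop K O) (g i) u)) x.
    by rewrite val_commutator_with addrC subrK.
  rewrite addSn; apply: word_spaceD; first exact: word_space_mul_gen.
  apply: word_space_leq (cP i n x xn); rewrite -addnS leq_add2l leqW //.
  by apply: leq_trans (leq_maxr _ _); exact: (leq_bigmax i).
Qed.

Lemma diffop_seq_shift_bound (W : seq (diffop O)) : exists c, forall u, u \in W ->
  forall n x, word_space n x -> word_space (n + c) (val (val u) x).
Proof.
elim: W => [|u W [c cP]]; first by exists 0%N.
have [j uj] := diffop_has_order u; have [d dP] := diffop_shift_bound uj.
exists (maxn c d) => v; rewrite inE => /orP[/eqP -> {v}|vW] n x xn.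
  by apply: word_space_leq (dP n x xn); rewrite leq_add2l leq_maxr.
by apply: word_space_leq (cP v vW n x xn); rewrite leq_add2l leq_maxl.
Qed.

Lemma diffop_word_shift (W : seq (diffop O)) c :
  (forall u, u \in W -> forall n x, word_space n x ->
     word_space (n + c) (val (val u) x)) ->
  forall s : seq (diffop O), {subset s <= W} -> forall n x, word_space n x ->
  word_space (n + c * size s) (val (val (\prod_(u <- s) u)) x).
Proof.
move=> cP; elim=> [|u s IH] sW n x xn; first by rewrite big_nil muln0 addn0.
rewrite big_cons rmorphM /= mulnS [(c + _)%N]addnC addnA; apply: cP.
  by apply: sW; rewrite mem_head.
by apply: IH => // v vs; apply: sW; rewrite inE vs orbT.
Qed.

Section NilpotentWords.
Variable t : O.
Local Notation delta := (commutator_with (@mul_diffop K O) t).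

Lemma iter_delta_leq m n u : (m <= n)%N -> iter m delta u = 0 -> iter n delta u = 0.
Proof.
move=> /subnK <- um; rewrite iterD um.
by elim: (n - m)%N => //= k ->; exact: commutator_with0.
Qed.

Lemma diffop_seq_nilpotent (W : seq (diffop O)) : exists q, forall u, u \in W ->
  iter q.+1 delta u = 0.
Proof.
elim: W => [|u W [q qP]]; first by exists 0%N.
have [d dP] := diffop_nilpotent t u.
exists (maxn q d) => v; rewrite inE => /orP[/eqP -> {v}|vW].
  by apply: iter_delta_leq dP; rewrite ltnS leq_maxr.
by apply: iter_delta_leq (qP v vW); rewrite ltnS leq_maxl.
Qed.

Lemma diffop_word_nilpotent (W : seq (diffop O)) q :
  (forall u, u \in W -> iter q.+1 delta u = 0) ->
  forall s : seq (diffop O), {subset s <= W} ->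
  iter (q * size s).+1 delta (\prod_(u <- s) u) = 0.
Proof.
move=> qP; elim=> [|u s IH] sW.
  by rewrite big_nil muln0 /= /commutator_with mul1r mulr1 subrr.
rewrite big_cons /= mulnS.
apply: (iter_leibniz_vanish (@commutator_withD _ _ _ t) (@commutator_withM _ _ _ t)).
- by apply: qP; apply: sW; rewrite mem_head.
- by apply: IH => v vs; apply: sW; rewrite inE vs orbT.
- exact: commutator_with0.
- exact: commutator_with0.
Qed.

Hypothesis ker_delta : forall u : diffop O, delta u = 0 -> u = mul_diffop (ev u).

(** If u vanishes on powers of t below n, then [u, t] vanishes on those below n - 1.
When [u, t] = 0, u is multiplication by u 1. *)
Lemma diffop_zero_on_powers n (u : diffop O) : iter n delta u = 0 ->
  (forall i, (i < n)%N -> val (val u) (t ^+ i) = 0) -> u = 0.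
Proof.
elim: n u => [|n IH] u un ut; first by [].
have du : delta u = 0.
  apply: IH; first by rewrite -iterSr.
  by move=> i ilt; rewrite val_commutator_with -exprS !ut ?mulr0 ?subr0 // ltnW.
rewrite (ker_delta du) /ev -(expr0 t) ut //; exact: rmorph0.
Qed.

End NilpotentWords.
End FilteredAlgebra.

(** * Linear growth of the coordinate algebra *)

Section LinearGrowth.
Variables (K : fieldType) (O : comAlgType K) (t : O).
Local Notation h := (horner_alg t).

(** An equation of y over K[t] of formal degree d with leading coefficient s, kept
separate from the others since the generators are to share d and s. *)
Definition monic_relation (y : O) (d : nat) (s : {poly K}) : Prop :=
  exists a : 'I_d -> {poly K}, h s * y ^+ d = \sum_(j < d) h (a j) * y ^+ j.

Lemma monic_relationM y d s p : monic_relation y d s -> monic_relation y d (p * s).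
Proof.
move=> [a ya]; exists (fun j => p * a j); rewrite rmorphM -mulrA ya mulr_sumr.
by apply: eq_bigr => j _; rewrite rmorphM mulrA.
Qed.

Lemma monic_relationS y d s : monic_relation y d s -> monic_relation y d.+1 s.
Proof.
move=> [a ya]; exists (fun j => if unlift ord0 j is Some k then a k else 0).
rewrite big_ord_recl unlift_none rmorph0 mul0r add0r exprSr mulrA ya mulr_suml.
by apply: eq_bigr => j _; rewrite liftK exprSr mulrA.
Qed.

Lemma monic_relation_leq y d d' s : (d <= d')%N ->
  monic_relation y d s -> monic_relation y d' s.
Proof.
by move=> /subnK <-; elim: (d' - d)%N => // k IH /IH /monic_relationS; rewrite addSn.
Qed.

Variables (r : nat) (g : 'I_r -> O) (s : {poly K}) (e m : nat).
Variable a : 'I_r -> 'I_m.+1 -> {poly K}.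
Hypotheses (se : (size s <= e.+1)%N) (ae : forall i j, (size (a i j) <= e.+1)%N).
Hypothesis rel : forall i, h s * g i ^+ m.+1 = \sum_(j < m.+1) h (a i j) * g i ^+ j.

(** The exponent of each generator is at most m, so that n enters only through the
exponent of t. *)
Definition reduced_monomial n (x : 'I_(e * n).+1 * {ffun 'I_r -> 'I_m.+1}) : O :=
  t ^+ x.1 * \prod_i g i ^+ x.2 i.

Local Notation V n := (lspan (range (@reduced_monomial n))).

Lemma horner_alg_sum p : h p = \sum_(i < size p) p`_i *: t ^+ i.
Proof.
rewrite -[in LHS](coefK p) poly_def raddf_sum /=; apply: eq_bigr => i _.
by rewrite linearZ /= mulr_algl rmorphXn /= horner_algX.
Qed.

Lemma reduced_span_scale n (p : {poly K}) x : (size p <= e.+1)%N -> V n x -> V n.+1 (h p * x).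
Proof.
move=> pe; move: x; apply: (@lspan_ind _ _ _ (fun x => V n.+1 (h p * x))).
- by rewrite mulr0; exact: lspan0.
- by move=> x y xV yV; rewrite mulrDr; exact: lspanD.
- move=> k _ [[i b] _ <-]; rewrite -scalerAr; apply: lspanZ.
  rewrite horner_alg_sum mulr_suml; apply: lspan_sum => j.
  rewrite -scalerAl; apply/lspanZ/lspan_gen.
  have jk : (j + i < (e * n.+1).+1)%N.
    by rewrite mulnS ltnS leq_add // -ltnS ?(leq_trans (ltn_ord j) pe).
  by exists (Ordinal jk, b); rewrite // /reduced_monomial /= exprD mulrA.
Qed.

Lemma reduced_span_gen n i x : V n x -> V n.+1 (h s * (g i * x)).
Proof.
move: x; apply: (@lspan_ind _ _ _ (fun x => V n.+1 (h s * (g i * x)))).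
- by rewrite !mulr0; exact: lspan0.
- by move=> x y xV yV; rewrite !mulrDr; exact: lspanD.
move=> k _ [[l b] _ <-]; rewrite -!scalerAr; apply: lspanZ.
rewrite /reduced_monomial /=; pose c := \prod_(j | j != i) g j ^+ b j.
have upd (j : 'I_m.+1) : V n (g i ^+ j * (t ^+ l * c)).
  apply: lspan_gen; exists (l, [ffun x => if x == i then j else b x]) => //.
  rewrite /reduced_monomial /= [in LHS](bigD1 i) //= ffunE eqxx mulrCA.
  congr (_ * (_ * _)); apply: eq_bigr => x /negbTE xi.
  by rewrite ffunE xi.
have -> : g i * (t ^+ l * \prod_j g j ^+ b j) = g i ^+ (b i).+1 * (t ^+ l * c).
  rewrite (bigD1 i) //= -/c exprS; ring.
have [bm|bm] := ltnP (b i) m.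
  by apply: reduced_span_scale => //; have := upd (inord (b i).+1); rewrite inordK.
have -> : nat_of_ord (b i) = m.
  by apply/eqP; rewrite eqn_leq bm andbT -ltnS.
rewrite [h s * _]mulrA rel mulr_suml; apply: lspan_sum => j; rewrite -mulrA.
by apply: reduced_span_scale.
Qed.

(** Each multiplication by a generator costs one factor s and raises the degree in t by
at most e, the bound for the degrees of the coefficients. *)
Lemma word_space_reduced n x : word_space g n x -> V n (h s ^+ n * x).
Proof.
move: n x; apply: (@word_space_ind _ _ _ _ (fun n x => V n (h s ^+ n * x))).
- by move=> n; rewrite mulr0; exact: lspan0.
- by move=> n x y xV yV; rewrite mulrDr; exact: lspanD.
- by move=> n k x xV; rewrite -scalerAr; exact: lspanZ.
- rewrite mulr1 expr0; apply: lspan_gen.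
  exists (ord0, [ffun=> ord0]) => //; rewrite /reduced_monomial /= mul1r.
  by rewrite big1 // => i _; rewrite ffunE.
- by move=> n x _ xV; rewrite exprS -mulrA; exact: reduced_span_scale.
- move=> n i x _ xV; rewrite exprS -mulrA [_ * (g i * x)]mulrCA.
  exact: reduced_span_gen.
Qed.

End LinearGrowth.

(** The factor z is harmless for counting, since multiplication by z is injective. *)
Definition linear_growth (K : fieldType) (O : comAlgType K) r (g : 'I_r -> O) : Prop :=
  exists e M : nat, forall n, exists z (T : finType) (w : T -> O),
    [/\ forall x, z * x = 0 -> x = 0, (#|T| <= (e * n).+1 * M)%N &
        forall x, word_space g n x -> lspan (range w) (z * x)].

Section CurveGrowth.
Variables (K : closedFieldType) (O : idomainAlgType K).
Variables (F : fieldType) (phi : {rmorphism O -> F}).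
Hypothesis phi_inj : injective phi.
Variable t : O.
Hypothesis nt : ~ is_scalar t.
Hypothesis talg : forall x, algebraic (curve_subring phi t) (phi x).
Local Notation h := (horner_alg t).

Lemma curve_monic_relation y : exists d s, s != 0 /\ monic_relation t y d s.
Proof.
have [p [/polyOverP pP p0 /rootP py]] := talg y.
have /choice[q qE] : forall i, exists q, p`_i = phi (h q).
  by move=> i; apply/curve_subringP.
have [d dE] : exists d, size p = d.+1.
  by exists (size p).-1; rewrite prednK // size_poly_gt0.
exists d, (q d); split.
  apply: contraNneq p0 => q0; rewrite -lead_coef_eq0 lead_coefE dE /= qE q0.
  by rewrite !rmorph0.
exists (fun j => - q j); apply/eqP; rewrite -subr_eq0 -(phi_eq0 phi_inj).
rewrite -[X in _ == X]py horner_coef dE big_ord_recr /= addrC rmorphB rmorph_sum.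
apply/eqP; congr (_ + _); first by rewrite qE rmorphM rmorphXn.
rewrite -sumrN; apply: eq_bigr => j _.
by rewrite qE rmorphM rmorphXn !rmorphN mulNr opprK.
Qed.

Lemma curve_linear_growth r (g : 'I_r -> O) : linear_growth g.
Proof.
have /choice[d /choice[s sP]] := fun i => curve_monic_relation (g i).
pose m := (\max_i d i)%N; pose S := \prod_i s i.
have S0 : S != 0 by apply/prodf_neq0 => i _; have [] := sP i.
have /choice[a aP] : forall i, monic_relation t (g i) m.+1 S.
  move=> i; rewrite /S (bigD1 i) //= mulrC.
  apply/monic_relationM; apply: (@monic_relation_leq _ _ _ _ (d i)).
    by apply/leqW/(leq_bigmax i).
  by have [] := sP i.
pose e := maxn (size S) (\max_i \max_j size (a i j))%N.
exists e, #|{ffun 'I_r -> 'I_m.+1}| => n.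
exists (h S ^+ n), ('I_(e * n).+1 * {ffun 'I_r -> 'I_m.+1})%type.
exists (@reduced_monomial K O t r g e m n); split.
- move=> x /eqP; rewrite mulf_eq0 expf_eq0 => /orP[/andP[_ hS]|/eqP //].
  by move: S0; rewrite (horner_alg_eq0 nt (eqP hS)) eqxx.
- by rewrite card_prod card_ord.
- apply: (@word_space_reduced K O t r g S e m a _ _ aP) => [|i j].
    by apply/leqW/leq_maxl.
  apply/leqW; apply: leq_trans (leq_maxr _ _).
  apply: leq_trans (leq_bigmax i); exact: (leq_bigmax j).
Qed.

End CurveGrowth.

(** * Quadratic growth of the differential operators *)

Lemma cubic_beats_quadratic q e M : exists n, (0 < n)%N /\
  ((q * (3 * n)).+1 * ((e * (3 * n)).+1 * M) < n * n * n)%N.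
Proof.
pose a := (q * 3).+1; pose b := (e * 3).+1; exists (a * b * M).+1.
set n := (a * b * M).+1; split=> //.
have qa : ((q * (3 * n)).+1 <= a * n)%N by rewrite /a mulnA mulSn; lia.
have eb : ((e * (3 * n)).+1 <= b * n)%N by rewrite /b mulnA mulSn; lia.
apply: (@leq_ltn_trans (a * n * (b * n * M))).
  by rewrite leq_mul // leq_mul.
have -> : (a * n * (b * n * M) = n * n * (a * b * M))%N by lia.
by rewrite ltn_pmul2l // muln_gt0.
Qed.

Section LinearDependence.
Variables (K : fieldType) (M : lmodType K).

Lemma dependent_of_card (S T : finType) (v : T -> M) (w : S -> M) :
  (forall i, lspan (range w) (v i)) -> (#|S| < #|T|)%N ->
  exists c : T -> K, (exists i, c i != 0) /\ \sum_i c i *: v i = 0.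
Proof.
move=> vw lt; apply: contrapT => noc; move: lt; rewrite ltnNge => /negP; apply.
apply: (free_card_le vw) => c c0 i; apply: contrapT => /eqP ci.
by apply: noc; exists c; split=> //; exists i.
Qed.
End LinearDependence.

Section FfunSpan.
Variables (K : fieldType) (M : lmodType K).

Lemma lspan_ffun (I T : finType) (w : T -> M) (v : {ffun I -> M}) :
  (forall i, lspan (range w) (v i)) ->
  lspan (range (fun p : I * T => [ffun i => if i == p.1 then w p.2 else 0])) v.
Proof.
move=> /(_ _)/lspan_rangeP vw; have /choice[c cE] := vw.
have -> : v = \sum_i \sum_s c i s *: [ffun k => if k == i then w s else 0].
  apply/ffunP => k; rewrite sum_ffunE (bigD1 k) //= [X in _ + X]big1 ?addr0; last first.
    move=> i ik; rewrite sum_ffunE big1 // => s _.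
    by rewrite !ffunE eq_sym (negbTE ik) scaler0.
  by rewrite /= sum_ffunE cE; apply: eq_bigr => s _; rewrite !ffunE eqxx.
apply: lspan_sum => i; apply: lspan_sum => s; apply/lspanZ/lspan_gen.
by exists (i, s).
Qed.
End FfunSpan.

Section DiffopGrowth.
Variables (K : fieldType) (O : comAlgType K) (r : nat) (g : 'I_r -> O).
Hypothesis gen : forall S : subalgClosed O, (forall i, g i \in S) ->
  forall x, x \in S.
Hypothesis growth : linear_growth g.
Variable t : O.
Hypothesis ker_delta : forall u : diffop O,
  commutator_with (@mul_diffop K O) t u = 0 -> u = mul_diffop (ev u).

Local Notation delta := (commutator_with (@mul_diffop K O) t).

(** A word u of length at most l = 3n is killed by q l + 1 commutators with t, so it
is determined by the q l + 1 values z u (t^i), each in a space of dimension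
linear in l. For large n the n^3 words are too many to be independent. *)
Lemma diffop_small_growth : small_growth (diffop O).
Proof.
move=> W; have [c cP] := diffop_seq_shift_bound gen W.
have [q qP] := diffop_seq_nilpotent t W.
have [k tk] := word_space_exhaust gen t.
have [e [M eM]] := growth.
have [n [n0 nbig]] := cubic_beats_quadratic q (e * (k * q + c)) M.
exists n => f fP; set l := (3 * n)%N in fP nbig.
have [z [T [w [zreg Tcard wP]]]] := eM ((k * q + c) * l)%N.
pose N := (q * l).+1; pose op s := \prod_(u <- f s) u.
pose v s : {ffun 'I_N -> O} := [ffun i : 'I_N => z * val (val (op s)) (t ^+ i)].
have vw s : lspan (range (fun p : 'I_N * T =>
    [ffun i => if i == p.1 then w p.2 else 0])) (v s).
  apply: lspan_ffun => i; rewrite ffunE; apply: wP.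
  have [fW fl] := fP s.
  apply: word_space_leq (diffop_word_shift cP fW (word_spaceX i tk)).
  rewrite mulnDl leq_add // ?leq_mul2l ?fl ?orbT //.
  by rewrite -mulnA leq_mul2l -ltnS ltn_ord orbT.
have [|a [[s0 a0] av]] := dependent_of_card vw.
  rewrite !card_prod !card_ord; apply: leq_ltn_trans nbig.
  by rewrite leq_mul //; apply: leq_trans Tcard _; rewrite mulnA.
exists a; split; first by exists s0.
have dD m x y : iter m delta (x + y) = iter m delta x + iter m delta y.
  by elim: m => //= m ->; exact: commutator_withD.
have dZ m k' x : iter m delta (k' *: x) = k' *: iter m delta x.
  by elim: m => //= m ->; rewrite /commutator_with -scalerAl -scalerAr -scalerBr.
apply: (diffop_zero_on_powers ker_delta (n := N)).
  apply: (big_ind (fun u => iter N delta u = 0)) => [|x y xN yN|s _].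
  - by elim: (N) => //= m ->; exact: commutator_with0.
  - by rewrite dD xN yN addr0.
  - have [fW fl] := fP s; rewrite dZ (iter_delta_leq _ (diffop_word_nilpotent qP fW)).
      by rewrite scaler0.
    by rewrite ltnS leq_mul2l fl orbT.
move=> i iN; apply: zreg.
have := congr1 (fun y : {ffun _} => y (Ordinal iN)) av.
rewrite sum_ffunE [in RHS]ffunE => <-.
pose E (x : diffop O) := z * val (val x) (t ^+ i).
have ED x y : E (x + y) = E x + E y by rewrite /E rmorphD -mulrDr.
have EZ k' x : E (k' *: x) = k' *: E x by rewrite /E linearZ scalerAr.
have E0 : E 0 = 0 by rewrite -[in LHS](scale0r 0) EZ scale0r.
rewrite -/(E _) (big_morph E ED E0); apply: eq_bigr => s _.
by rewrite EZ !ffunE.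
Qed.
End DiffopGrowth.

(** * The differential operators of a curve *)

Section CurveDifferentialOperators.
Variables (K : closedFieldType) (charK : [pchar K] =i pred0).
Variables (O : idomainAlgType K) (F : fieldType) (phi : {rmorphism O -> F}).
Hypothesis phi_inj : injective phi.
Hypothesis phi_frac : forall x, exists a b, b != 0 /\ x = phi a / phi b.
Hypotheses (fgO : finitely_generated O) (dimO : krull_dim O 1).
Variable G : unitAlgType K.
Hypothesis Gdiv : forall x : G, x != 0 -> x \is a GRing.unit.
Variable iota : {lrmorphism diffop O -> G}.
Hypothesis iota_inj : injective iota.
Hypothesis iota_right : forall x : G,
  exists (a s : diffop O), s != 0 /\ x = iota a * (iota s)^-1.

(** Noncommutativity comes from the operator s D, whose commutator with t is s. *)
Lemma curve_diffop_properties :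
  [/\ small_growth (diffop O), noncommutative (diffop O) &
      commutative_centralizers G].
Proof.
have [t [nt talg]] := curve_algebraic fgO phi_inj dimO.
have [D [dD DK Dt]] := curve_derivation charK phi_inj phi_frac fgO nt talg.
have [s [s0 sD]] := derivation_clear_denominators phi_inj phi_frac fgO dD DK.
have [E Es] := derivation_diffop phi_inj dD DK Dt sD.
have kd := ker_delta charK phi_inj talg.
split.
- have [r [g gen]] := fgO.
  exact: (diffop_small_growth gen (curve_linear_growth phi_inj nt talg g) kd).
- move=> com; have : mul_diffop s = 0 by rewrite -Es /commutator_with com subrr.
  move=> /(congr1 (@ev K O)); rewrite ev_mul_diffop ev0 => s00.
  by rewrite s00 eqxx in s0.
apply: (@ore_commutative_centralizers K O F phi phi_inj (charF charK phi)
  (diffop O) (@mul_diffop K O) (@mul_diffop_inj K O) (@mul_diffop_scalar K O) t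
  (diffop_nilpotent t) _ D dD (first_order_bracket charK phi_inj talg dD DK Dt)
  (constants_scalar charK phi_frac talg dD DK Dt) E s s0 Es G Gdiv iota
  iota_inj iota_right).
by move=> u /kd ->; exists (ev u).
Qed.

End CurveDifferentialOperators.

(** * The theorem *)

Section Fractions.
Local Open Scope quotient_scope.

Lemma fraction_quotient (R : idomainType) (x : {fraction R}) :
  exists a b : R, b != 0 /\ x = tofrac a / tofrac b.
Proof.
elim/quotW: x => f; exists (frac f).1, (frac f).2.
have f2 := denom_ratioP f; split=> //.
have t2 : tofrac (frac f).2 != 0 by rewrite tofrac_eq0.
apply: (canRL (mulfK t2)); unlock tofrac.
rewrite -[LHS]FracField.pi_mul; apply/eqmodP => /=.
by rewrite FracField.equivfE /FracField.mulf /= !numden_Ratio ?mulf_neq0 ?oner_neq0 // !mulr1 mulrC.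
Qed.

End Fractions.

Lemma curve_quotient_properties (K : closedFieldType) (charK : [pchar K] =i pred0)
    (O : idomainAlgType K) (curveO : smooth_affine_curve O)
    (Gamma : unitAlgType K) (iota : {lrmorphism diffop O -> Gamma})
    (quotGamma : quotient_division_ring iota) :
  [/\ small_growth (diffop O), noncommutative (diffop O) &
      commutative_centralizers Gamma].
Proof.
have [fgO _ dimO] := curveO; have [Gdiv iota_inj iota_right _] := quotGamma.
have tofrac_inj : injective (@tofrac O).
  by move=> x y /eqP; rewrite tofrac_eq => /eqP.
exact: (curve_diffop_properties charK tofrac_inj (@fraction_quotient O) fgO dimO
  Gdiv iota_inj iota_right).
Qed.

Section SubalgebraInclusion.
Variables (K : fieldType) (B : algType K) (S : subalgClosed B).

(** Named so as to carry the structure of an algebra morphism. *)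
Definition subalg_inclusion (x : subalg S) : B := val x.

Lemma subalg_inclusion_zmod : zmod_morphism subalg_inclusion.
Proof. by move=> x y; rewrite /subalg_inclusion rmorphB. Qed.

Lemma subalg_inclusion_monoid : monoid_morphism subalg_inclusion.
Proof. by split=> [|x y]; rewrite /subalg_inclusion ?rmorph1 ?rmorphM. Qed.

Lemma subalg_inclusion_scalable : scalable subalg_inclusion.
Proof. by move=> k x; rewrite /subalg_inclusion linearZ. Qed.

HB.instance Definition _ := GRing.isZmodMorphism.Build (subalg S) B
  subalg_inclusion subalg_inclusion_zmod.
HB.instance Definition _ := GRing.isMonoidMorphism.Build (subalg S) B
  subalg_inclusion subalg_inclusion_monoid.
HB.instance Definition _ := GRing.isScalable.Build K (subalg S) B *:%R
  subalg_inclusion subalg_inclusion_scalable.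

End SubalgebraInclusion.

Theorem corollary7p3 (R : realType)
    (K : closedFieldType) (charK : [pchar K] =i pred0)
    (O : idomainAlgType K) (curveO : smooth_affine_curve O)
    (Gamma : unitAlgType K) (iota : {lrmorphism diffop O -> Gamma})
    (quotGamma : quotient_division_ring iota) :
  [/\ dixmier_partition (diffop O),
      homogeneous_centralizer_condition (diffop O) &
      commutative_centralizer_condition (diffop O)] /\
  (forall A : subalgClosed Gamma,
     noncommutative (subalg A) ->
     (GKdim (subalg A) R < 3%:E)%E ->
     [/\ dixmier_partition (subalg A),
         homogeneous_centralizer_condition (subalg A) &
         commutative_centralizer_condition (subalg A)]).
Proof.
have [Dgrowth Dnc GC] := curve_quotient_properties charK curveO quotGamma.
have [Gdiv iota_inj _ _] := quotGamma.
split; first by split;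
  [ exact: (subalg_dixmier_partition Gdiv charK GC iota_inj Dgrowth Dnc)
  | exact: (subalg_homogeneous_centralizer_condition Gdiv charK GC iota_inj Dgrowth Dnc)
  | exact: (subalg_commutative_centralizer_condition GC iota_inj Dnc)].
move=> A Anc /GKdim_lt3_small_growth Agrowth.
pose j : {lrmorphism subalg A -> Gamma} := @subalg_inclusion K Gamma A.
have jinj : injective j by exact: val_inj.
split; [ exact: (subalg_dixmier_partition Gdiv charK GC jinj Agrowth Anc)
  | exact: (subalg_homogeneous_centralizer_condition Gdiv charK GC jinj Agrowth Anc)
  | exact: (subalg_commutative_centralizer_condition GC jinj Anc)].
Qed.
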